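(* Let $d,m\in\mathbb{N}$, let $\alpha>3d-3$ and $\Sigma\in\mathcal{S}_{++}^d$. Let $h\in C_b^{md}(\mathcal{S}_{++}^d)$ be real-valued, and let $$f_h(W)=-\int_0^\infty\Big\{\mathcal{P}_t^{\mathcal{W}}h(W)-\mathsf{E}[h(\mathfrak{W}_\infty)]\Big\}\,\mathrm{d}t,\qquad W\in\mathcal{S}_{++}^d,\quad \mathfrak{W}_\infty\sim\mathcal{W}_d(\alpha,\Sigma),$$ be the semigroup solution of the Wishart Stein equation. Then the following hold. (i) If $h\in\mathcal{B}_m^{\mathcal{D},\Sigma}(\mathcal{S}_{++}^d)$, then for any index pairs $(i_1,j_1),\dots,(i_m,j_m)\in\{1,\dots,d\}^2$, $$\left\|\Big(\prod_{\ell=1}^m\nabla_{\!W,i_\ell j_\ell}\Big)f_h\right\|_\infty\le\frac1{2m}\sup_{t>0}\left\|\Big(\prod_{\ell=1}^m(\mathcal{D}_{t,\Sigma})_{i_\ell j_\ell}\Big)h\right\|_\infty.$$ (ii) For sufficiently smooth $g:\mathcal{S}_{++}^d\to\mathbb{R}$ define $$\mathcal{M}_m(g)=\sup_{W\in\mathcal{S}_{++}^d}\ \sup_{\substack{U_1,\dots,U_m\in\mathcal{S}^d\\ \|U_1\|_F=\dots=\|U_m\|_F=1}}\big|D^mg(W)[U_1,\dots,U_m]\big|,$$ and define $$\mathcal{M}_m^{\mathcal{D},\Sigma}(h)=\sup_{t>0}\ \sup_{W\in\mathcal{S}_{++}^d}\ \sup_{\substack{U_1,\dots,U_m\in\mathcal{S}^d\\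 \|U_1\|_F=\dots=\|U_m\|_F=1}}\left|\Big(\prod_{\ell=1}^m\langle U_\ell,\mathcal{D}_{t,\Sigma}\rangle_F\Big)h(W)\right|,\qquad\langle U,\mathcal{D}_{t,\Sigma}\rangle_F=\sum_{i,j=1}^dU_{ij}(\mathcal{D}_{t,\Sigma})_{ij}.$$ If $\mathcal{M}_m^{\mathcal{D},\Sigma}(h)<\infty$, then $$\mathcal{M}_m(f_h)\le\frac1{2m}\,\mathcal{M}_m^{\mathcal{D},\Sigma}(h).$$
   Context: $\mathcal{S}^d,\mathcal{S}_+^d,\mathcal{S}_{++}^d$: real symmetric, nonnegative definite, positive definite $d\times d$ matrices. $\|\cdot\|_F$ Frobenius norm, $\|\cdot\|_\infty$ supremum norm over $\mathcal{S}_{++}^d$. $C_b^k(\mathcal{S}_{++}^d)$: real functions, $k$ times continuously differentiable with all partial derivatives of orders $0,\dots,k$ bounded. $D^mg(W)$ is the $m$-th Fréchet derivative, an $m$-linear map on $\mathcal{S}^d$. $\nabla_{\!W}=(\tfrac12(1+\delta_{ij})\,\partial/\partial W_{ij})_{i,j}$ is the symmetric gradient (commuting constant-coefficient entries $\nabla_{\!W,ij}$). With $\Sigma_t=(1-e^{-2t})\Sigma$, $\mathcal{D}_{t,\Sigma}=\nabla_{\!W}\,\mathrm{adj}(I_d-2\Sigma_t\nabla_{\!W})$, a $d\times d$ matrix of differential operators ($\mathrm{adj}$ is the adjugate). $\mathcal{B}_p^{\mathcal{D},\Sigma}(\mathcal{S}_{++}^d)$ is the class of functions $h:\mathcal{S}_{++}^d\to\mathbb{R}$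 such that, for every choice of $(i_1,j_1),\dots,(i_p,j_p)\in\{1,\dots,d\}^2$, the iterated derivatives $(\prod_{\ell=1}^p(\mathcal{D}_{t,\Sigma})_{i_\ell j_\ell})h$ exist for every $t>0$ and $\sup_{t>0}\|(\prod_{\ell=1}^p(\mathcal{D}_{t,\Sigma})_{i_\ell j_\ell})h\|_\infty<\infty$. $(\mathcal{P}_t^{\mathcal{W}})_{t\ge0}$ is the transition semigroup $\mathcal{P}_t^{\mathcal{W}}h(W)=\mathsf{E}[h(\mathfrak{W}_t)\mid\mathfrak{W}_0=W]$ of the Wishart process $\mathrm{d}\mathfrak{W}_t=2(\alpha\Sigma-\mathfrak{W}_t)\mathrm{d}t+\sqrt2(\mathfrak{W}_t^{1/2}\mathrm{d}\mathfrak{B}_t\Sigma^{1/2}+\Sigma^{1/2}\mathrm{d}\mathfrak{B}_t^\top\mathfrak{W}_t^{1/2})$, with $\mathfrak{B}_t$ a $d\times d$ matrix of independent standard Brownian motions; for $t>0$, $\mathfrak{W}_t\mid\{\mathfrak{W}_0=W\}\sim\mathcal{W}_d(\alpha,\Sigma_t,e^{-2t}\Sigma_t^{-1}W)$. Here the noncentral Wishart law $\mathcal{W}_d(\alpha,\Sigma,\Theta)$ (for $\alpha>d-1$, $\Sigma\in\mathcal{S}_{++}^d$, $\Theta\Sigma^{-1}\in\mathcal{S}_+^d$) is the law on $\mathcal{S}_{++}^d$ with Laplace transform $\mathsf{E}[e^{-\mathrm{tr}(T\mathfrak{X})}]=\exp[-\mathrm{tr}\{T\Sigma(I_d+2T\Sigma)^{-1}\Theta\}]\,|I_d+2T\Sigma|^{-\alpha/2}$,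 $T\in\mathcal{S}_+^d$, $|\cdot|$ the determinant, and $\mathcal{W}_d(\alpha,\Sigma)=\mathcal{W}_d(\alpha,\Sigma,0)$. Under the stated assumptions the integral defining $f_h$ converges, and $f_h$ solves $\mathcal{A}^{\mathcal{W}}f_h=h-\mathsf{E}[h(\mathfrak{W}_\infty)]$ with $\mathcal{A}^{\mathcal{W}}$ the generator of the process. *)

(* Defs.v *)
From HB Require Import structures.
From mathcomp Require Import all_boot all_order all_algebra.
From mathcomp Require Import all_classical all_reals all_analysis.
From mathcomp Require Import -(notations) mpoly.
From mathcomp Require Import ring lra.

Set Implicit Arguments.
Unset Strict Implicit.
Unset Printing Implicit Defensive.

Import Order.TTheory GRing.Theory Num.Theory.
Import numFieldNormedType.Exports.

Local Open Scope classical_set_scope.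
Local Open Scope ring_scope.

Definition is_sym (R : realType) (d : nat) : {pred 'M[R]_d} :=
  fun A => A^T == A.

Lemma is_sym_submod (R : realType) (d : nat) : submod_closed (@is_sym R d).
Proof.
split=> [|a A B]; rewrite !unfold_in ?trmx0 //.
by move=> /eqP hA /eqP hB; rewrite !linearD !linearZ /= hA hB.
Qed.

HB.instance Definition _ (R : realType) (d : nat) :=
  GRing.isSubmodClosed.Build R 'M[R]_d (@is_sym R d)
    (GRing.submod_closed_semi (@is_sym_submod R d)).

Record sym (R : realType) (d : nat) :=
  Sym { symmx :> 'M[R]_d; _ : symmx \in @is_sym R d }.

HB.instance Definition _ (R : realType) (d : nat) :=
  [isSub for @symmx R d].
HB.instance Definition _ (R : realType) (d : nat) :=
  [Choice of sym R d by <:].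
HB.instance Definition _ (R : realType) (d : nat) :=
  [SubChoice_isSubLmodule of sym R d by <:].

Definition frob (R : realType) (d : nat) (A : sym R d) : R :=
  Num.sqrt (\sum_i \sum_j A i j ^+ 2).

Section FrobeniusNorm.
Variables (R : realType) (d : nat).
Implicit Types A B : sym R d.

Let ip A B := \sum_i \sum_j A i j * B i j.

Let ipDZ (a b : R) A B : ip (a *: A + b *: B) (a *: A + b *: B) =
  a ^+ 2 * ip A A + 2 * a * b * ip A B + b ^+ 2 * ip B B.
Proof.
rewrite /ip !mulr_sumr -!big_split; apply: eq_bigr => i _ /=.
rewrite !mulr_sumr -!big_split; apply: eq_bigr => j _ /=.
by rewrite !mxE; ring.
Qed.

Let ip_ge0 A : 0 <= ip A A.
Proof. by do 2!apply: sumr_ge0 => ? _; rewrite -expr2 sqr_ge0. Qed.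

Let frobE A : frob A = Num.sqrt (ip A A).
Proof.
by congr Num.sqrt; apply: eq_bigr => i _; apply: eq_bigr => j _; rewrite expr2.
Qed.

Lemma frob_eq0 A : frob A = 0 -> A = 0.
Proof.
rewrite frobE => /eqP; rewrite sqrtr_eq0 => le0.
have /eqP : ip A A = 0 by apply/le_anti; rewrite le0 ip_ge0.
rewrite psumr_eq0 => [/allP /= h|i _]; last first.
  by apply: sumr_ge0 => j _; rewrite -expr2 sqr_ge0.
apply/val_inj/matrixP => i j; rewrite [RHS]mxE.
have := h i (mem_index_enum _); rewrite psumr_eq0 => [/allP /= h'|k _].
  by have := h' j (mem_index_enum _); rewrite mulf_eq0 orbb => /eqP.
by rewrite -expr2 sqr_ge0.
Qed.

Lemma frobZ (a : R) A : frob (a *: A) = `|a| * frob A.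
Proof.
have -> : a *: A = a *: A + 0 *: A by rewrite scale0r addr0.
rewrite !frobE ipDZ mulr0 expr0n !mul0r !addr0.
by rewrite sqrtrM ?sqr_ge0 // sqrtr_sqr.
Qed.

Let cauchy_schwarz A B : ip A B ^+ 2 <= ip A A * ip B B.
Proof.
have [/eqP B0|Bn0] := eqVneq (frob B) 0.
  have -> : B = 0 by apply: frob_eq0; apply/eqP.
  have z C : ip C 0 = 0.
    by apply: big1 => i _; apply: big1 => j _; rewrite [X in _ * X]mxE mulr0.
  by rewrite !z expr0n mulr0.
have Bgt0 : 0 < ip B B.
  rewrite lt_def ip_ge0 andbT; apply: contra_neq Bn0 => B0.
  by rewrite frobE B0 sqrtr0.
have := ip_ge0 (ip B B *: A + (- ip A B) *: B).
rewrite ipDZ.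
set a := ip A A; set b := ip B B; set c := ip A B => H.
have : 0 <= b * (a * b - c ^+ 2).
  by apply: (le_trans H); rewrite le_eqVlt; apply/orP; left; apply/eqP; ring.
by rewrite pmulr_rge0 // subr_ge0.
Qed.

Lemma ler_frobD A B : frob (A + B) <= frob A + frob B.
Proof.
rewrite -ler_sqr ?nnegrE ?addr_ge0 ?sqrtr_ge0 // sqrrD.
rewrite !frobE !sqr_sqrtr ?ip_ge0 //.
have -> : A + B = 1 *: A + 1 *: B by rewrite !scale1r.
rewrite ipDZ expr1n !mul1r !mulr1.
have : ip A B <= Num.sqrt (ip A A) * Num.sqrt (ip B B).
  rewrite -sqrtrM ?ip_ge0 // (le_trans (ler_norm _)) // -sqrtr_sqr.
  by rewrite ler_wsqrtr // cauchy_schwarz.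
by rewrite -mulr_natl; lra.
Qed.

End FrobeniusNorm.

HB.instance Definition _ (R : realType) (d : nat) :=
  Lmodule_isNormed.Build R (sym R d)
    (@ler_frobD R d) (@frobZ R d) (@frob_eq0 R d).

Lemma sym_normE (R : realType) (d : nat) (A : sym R d) : `|A| = frob A.
Proof. by []. Qed.

Definition posdef (R : realType) (d : nat) : set (sym R d) :=
  [set A | forall x : 'cV[R]_d, x != 0 -> 0 < (x^T *m A *m x) 0 0].

Definition possemidef (R : realType) (d : nat) : set (sym R d) :=
  [set A | forall x : 'cV[R]_d, 0 <= (x^T *m A *m x) 0 0].

(* A function on the open cone S_{++}^d of S^d is represented by a total      *)
(* function on S^d; only its values on [posdef] are ever used.                *)

Definition supnorm (R : realType) (d : nat) (g : sym R d -> R) : \bar R :=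
  ereal_sup [set `|g W|%:E | W in @posdef R d].

(* Partial derivatives. The free coordinates of a symmetric matrix are its    *)
(* entries W_ij = W_ji, so for i != j the partial derivative d/dW_ij moves    *)
(* both entries, i.e. it is taken along E_ij + E_ji.                          *)

Definition coord_mx (R : realType) (d : nat) (p : 'I_d * 'I_d) : 'M[R]_d :=
  if p.1 == p.2 then delta_mx p.1 p.2
  else delta_mx p.1 p.2 + delta_mx p.2 p.1.

Lemma coord_mx_sym (R : realType) (d : nat) (p : 'I_d * 'I_d) :
  coord_mx R p \in @is_sym R d.
Proof.
case: p => i j; rewrite unfold_in /coord_mx /=.
case: (i =P j) => [->|_]; first by rewrite trmx_delta.
by rewrite linearD /= !trmx_delta addrC.
Qed.

Definition coord_dir (R : realType) (d : nat) (p : 'I_d * 'I_d) : sym R d :=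
  Sym (coord_mx_sym R p).

Definition pderiv (R : realType) (d : nat) (p : 'I_d * 'I_d)
    (g : sym R d -> R) : sym R d -> R :=
  fun W => 'D_(coord_dir R p) g W.

Definition pderivs (R : realType) (d : nat) (s : seq ('I_d * 'I_d))
    (g : sym R d -> R) : sym R d -> R :=
  foldr (@pderiv R d) g s.

Fixpoint pderivs_exist (R : realType) (d : nat) (s : seq ('I_d * 'I_d))
    (g : sym R d -> R) : Prop :=
  if s is p :: s' then
    pderivs_exist s' g /\
    forall W, posdef W -> derivable (pderivs s' g) W (coord_dir R p)
  else True.

Definition Cb (R : realType) (d k : nat) (g : sym R d -> R) : Prop :=
  forall s : seq ('I_d * 'I_d), (size s <= k)%N ->
    [/\ pderivs_exist s g,
        {within @posdef R d, continuous (pderivs s g)} &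
        exists C : R, forall W, posdef W -> `|pderivs s g W| <= C].

Definition nabla (R : realType) (d : nat) (p : 'I_d * 'I_d)
    (g : sym R d -> R) : sym R d -> R :=
  fun W => 2^-1 * (1 + (p.1 == p.2)%:R) * pderiv p g W.

(* [nablas s g] exists iff [pderivs s g] does: the two differ by a nonzero    *)
(* constant factor.                                                           *)
Definition nablas (R : realType) (d : nat) (s : seq ('I_d * 'I_d))
    (g : sym R d -> R) : sym R d -> R :=
  foldr (@nabla R d) g s.

(* Constant-coefficient differential operators are represented by their       *)
(* symbols: polynomials in commuting variables indexed by pairs (i, j), the   *)
(* variable of (i, j) standing for nabla_ij. Since nabla_ij = nabla_ji, only  *)
(* the variables with i <= j occur in [nabla_symb]. Products of symbols are   *)
(* compositions of operators.                                                 *)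

Definition symbol (R : realType) (d : nat) : comNzRingType :=
  mpoly #|{: 'I_d * 'I_d}| R.

Definition nabla_symb (R : realType) (d : nat) : 'M[symbol R d]_d :=
  \matrix_(i, j)
    mpolyX R (mnm1 (enum_rank (if (i <= j)%N then (i, j) else (j, i)))).

Definition mono_seq (d : nat) (k : multinom #|{: 'I_d * 'I_d}|) :
    seq ('I_d * 'I_d) :=
  flatten [seq nseq (k v) (enum_val v) | v <- enum 'I_#|{: 'I_d * 'I_d}|].

Definition diffop (R : realType) (d : nat) (P : symbol R d)
    (g : sym R d -> R) : sym R d -> R :=
  fun W => \sum_(k <- msupp P) mcoeff k P * nablas (mono_seq k) g W.

Definition diffop_exists (R : realType) (d : nat) (P : symbol R d)
    (g : sym R d -> R) : Prop :=
  forall k, k \in msupp P -> pderivs_exist (mono_seq k) g.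

Definition Sigma_ (R : realType) (d : nat) (Sigma : sym R d) (t : R) :
    'M[R]_d :=
  (1 - expR (- 2 * t)) *: (Sigma : 'M[R]_d).

Definition D_symb (R : realType) (d : nat) (Sigma : sym R d) (t : R) :
    'M[symbol R d]_d :=
  nabla_symb R d *m
  \adj (1%:M -
    map_mx (mpolyC _ (R := R)) (Sigma_ Sigma t) *m nabla_symb R d *+ 2).

Definition D_prod (R : realType) (d m : nat) (Sigma : sym R d) (t : R)
    (ij : m.-tuple ('I_d * 'I_d)) : symbol R d :=
  \prod_(l < m) D_symb Sigma t (tnth ij l).1 (tnth ij l).2.

Definition D_supnorm (R : realType) (d m : nat) (Sigma : sym R d)
    (ij : m.-tuple ('I_d * 'I_d)) (h : sym R d -> R) : \bar R :=
  ereal_sup [set supnorm (diffop (D_prod Sigma t ij) h)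
            | t in [set t : R | 0 < t]].

Definition B_class (R : realType) (d p : nat) (Sigma : sym R d)
    (h : sym R d -> R) : Prop :=
  forall ij : p.-tuple ('I_d * 'I_d),
    (forall t : R, 0 < t -> diffop_exists (D_prod Sigma t ij) h) /\
    (D_supnorm Sigma ij h < +oo)%E.

Definition unit_dirs (R : realType) (d m : nat) : set (m.-tuple (sym R d)) :=
  [set us | forall l : 'I_m, `|tnth us l| = 1].

Definition D_frob (R : realType) (d : nat) (Sigma : sym R d) (t : R)
    (U : sym R d) : symbol R d :=
  \sum_i \sum_j U i j *: (D_symb Sigma t i j : mpoly _ R).

Definition MD (R : realType) (d m : nat) (Sigma : sym R d)
    (h : sym R d -> R) : \bar R :=
  ereal_sup [set
    ereal_sup [set
      ereal_sup [set
        `|diffop (\prod_(l < m) D_frob Sigma t (tnth us l)) h W|%:E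
      | us in @unit_dirs R d m]
    | W in @posdef R d]
  | t in [set t : R | 0 < t]].

(* [frechet g [:: U_1; ..; U_k] W] is D^k g(W)[U_1, .., U_k].                 *)
Fixpoint frechet (R : realType) (d : nat) (g : sym R d -> R)
    (us : seq (sym R d)) : sym R d -> R :=
  if us is U :: us' then fun W => 'd (frechet g us') W U else g.

(* D^0 g, .., D^(m-1) g are Frechet differentiable on S_{++}^d; the second    *)
(* clause says that the remainder of the k-linear-map-valued D^k g is small   *)
(* in operator norm, i.e. uniformly in the k unit directions.                 *)
Definition frechet_differentiable (R : realType) (d m : nat)
    (g : sym R d -> R) : Prop :=
  forall k, (k < m)%N -> forall W, posdef W ->
    (forall us : k.-tuple (sym R d), differentiable (frechet g us) W) /\
    (forall e : R, 0 < e -> \forall H \near (0 : sym R d),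
      forall us, @unit_dirs R d k us ->
      `|frechet g us (W + H) - frechet g us W - 'd (frechet g us) W H|
        <= e * `|H|).

Definition M_ (R : realType) (d m : nat) (g : sym R d -> R) : \bar R :=
  ereal_sup [set
    ereal_sup [set `|frechet g us W|%:E | us in @unit_dirs R d m]
  | W in @posdef R d].

Definition symB (R : realType) (d : nat) :=
  g_sigma_algebraType (@open (sym R d)).

(* The law W_d(alpha, Sigma, Theta), given by its support and its Laplace     *)
(* transform.                                                                 *)
Definition is_wishart (R : realType) (d : nat) (alpha : R)
    (Sigma Theta : 'M[R]_d) (mu : probability (symB R d) R) : Prop :=
  mu (@posdef R d) = 1%E /\
  forall T : sym R d, possemidef T ->
    \int[mu]_(X in @posdef R d) expR (- \tr (T *m (X : sym R d))) =
    expR (- \tr (T *m Sigma *m invmx (1%:M + T *m Sigma *+ 2) *m Theta)) *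
    \det (1%:M + T *m Sigma *+ 2) `^ (- (alpha / 2)).

(* The Wishart diffusion enters only through its transition laws: [K t W] is  *)
(* the law at time t of the process started from W. Its SDE is not formalized.*)
Definition wishart_transition (R : realType) (d : nat) (alpha : R)
    (Sigma : sym R d) (K : R -> sym R d -> probability (symB R d) R) : Prop :=
  forall W, posdef W ->
    (forall A : set (symB R d), measurable A ->
      K 0 W A = \d_(W : symB R d) A) /\
    forall t, 0 < t ->
      is_wishart alpha (Sigma_ Sigma t)
        (expR (- 2 * t) *: (invmx (Sigma_ Sigma t) *m W)) (K t W).

Definition semigroup (R : realType) (d : nat)
    (K : R -> sym R d -> probability (symB R d) R) (t : R)
    (h : sym R d -> R) : sym R d -> R :=
  fun W => \int[K t W]_(X in @posdef R d) h X.

Definition stein_sol (R : realType) (d : nat)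
    (K : R -> sym R d -> probability (symB R d) R)
    (Winfty : probability (symB R d) R) (h : sym R d -> R) : sym R d -> R :=
  fun W => - \int[lebesgue_measure]_(t in `[0, +oo[)
    (semigroup K t h W - \int[Winfty]_(X in @posdef R d) h X).

(* Main.v *)
(* Write T# = (1 + 2 T S_t)^-1 T with S_t = (1 - e^{-2t}) Sigma.  The law K t W integrates exp(-tr(T X)) to
   exp(-e^{-2t} tr(T# W)) det(1 + 2 T S_t)^(-alpha/2).  Differentiating in W along U produces the factor
   -e^{-2t} tr(T# U), and -det(1 + 2 T S_t) tr(T# U) is what <U, D_{t,Sigma}> does to exp(-tr(T X)).
   Hence a W-derivative of K t W h is e^{-2t} times the value at <U, D> h of the law with alpha
   replaced by alpha + 2; that law is K t W convolved with two Gaussian squares.  After m derivatives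
   the factor e^{-2mt} integrates to 1/(2m).  Identities between integral functionals are checked on
   exponentials only (monotone classes), constant-coefficient operators being moved from h to
   exponentials by averaging and difference quotients, so that nothing beyond C_b^{md} is needed.
   The derivatives of top order are continuous in W because, once a Gaussian square is present,
   moving W by r l l^T amounts to shifting a Gaussian mean, which is small in total variation. *)

From HB Require Import structures.
From mathcomp Require Import all_boot all_order all_algebra.
From mathcomp Require Import all_classical all_reals all_analysis.
From mathcomp Require Import measurable_realfun.
From mathcomp Require Import -(notations) ssrcomplements mpoly.
From mathcomp Require Import ring lra.
Require Import Defs.

Set Implicit Arguments.
Unset Strict Implicit.
Unset Printing Implicit Defensive.

Import Order.TTheory GRing.Theory Num.Theory.
Import numFieldNormedType.Exports.

Local Open Scope classical_set_scope.
Local Open Scope ring_scope.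

(** * Symmetric matrices *)

(** The kernel is known only through its support and its Laplace transforms: no density, no sample
    path, no measurability in t or W. All of this has to be read off exponentials, so each operation
    is phrased as a functional [bpl]: linear, bounded, continuous along bounded pointwise limits.
    The adjugate keeps the symbol of D polynomial at the price of the factor det(1 + 2 T S_t).
    Dividing it out costs one det^(-1/2) for each Gaussian square, hence two squares per derivative.
    Derivatives in W are first obtained in integrated form along segments, an identity linear in h
    and therefore testable on exponentials; pointwise derivatives follow once the integrand is
    continuous. The squares come from vectors l with S_t = sum of l l^T. These vectors can be chosen
    to contain multiples of all e_i + e_j and e_i - e_j, so that every symmetric direction of W is
    reached. *)

Section QuadraticForms.
Variables (R : realType) (d : nat).
Implicit Types (A B : 'M[R]_d) (x y u v : 'cV[R]_d) (T S W : sym R d).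

Definition bform A x y : R := (x^T *m A *m y) 0 0.

Lemma bformE A x y : bform A x y = \sum_i \sum_j x i 0 * A i j * y j 0.
Proof.
rewrite /bform mxE exchange_big /=; apply: eq_bigr => j _.
by rewrite mxE mulr_suml; apply: eq_bigr => i _; rewrite mxE.
Qed.

Lemma bformDl A x y u : bform A (x + y) u = bform A x u + bform A y u.
Proof. by rewrite /bform linearD /= !mulmxDl mxE. Qed.

Lemma bformDr A u x y : bform A u (x + y) = bform A u x + bform A u y.
Proof. by rewrite /bform mulmxDr mxE. Qed.

Lemma bformZl A a x y : bform A (a *: x) y = a * bform A x y.
Proof. by rewrite /bform linearZ /= -!scalemxAl mxE. Qed.

Lemma bformZr A a x y : bform A x (a *: y) = a * bform A x y.
Proof. by rewrite /bform -scalemxAr mxE. Qed.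

Lemma bformD A B x y : bform (A + B) x y = bform A x y + bform B x y.
Proof. by rewrite /bform mulmxDr mulmxDl mxE. Qed.

Lemma bformZ a A x y : bform (a *: A) x y = a * bform A x y.
Proof. by rewrite /bform -scalemxAr -scalemxAl mxE. Qed.

Lemma bform0 x y : bform 0 x y = 0.
Proof. by rewrite /bform mulmx0 mul0mx mxE. Qed.

Lemma bformN A x y : bform (- A) x y = - bform A x y.
Proof. by rewrite -scaleN1r bformZ mulN1r. Qed.

Lemma bform1 x y : bform 1%:M x y = \sum_i x i 0 * y i 0.
Proof. by rewrite /bform mulmx1 mxE; apply: eq_bigr => i _; rewrite mxE. Qed.

Lemma bform_delta A i j : bform A (delta_mx i 0) (delta_mx j 0) = A i j.
Proof.
rewrite bformE (bigD1 i) //= [X in X + _ = _](bigD1 j) //= !big1 ?addr0.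
- by rewrite !mxE !eqxx mul1r mulr1.
- by move=> k ki; apply: big1 => l _; rewrite !mxE (negbTE ki) !mul0r.
- by move=> k kj; rewrite !mxE (negbTE kj) mulr0.
Qed.

Lemma sym_tr T : (T : 'M[R]_d)^T = T.
Proof. by case: T => A /= /eqP. Qed.

Lemma symE T i j : T i j = T j i.
Proof. by rewrite -{1}(sym_tr T) mxE. Qed.

Lemma bformC T x y : bform T x y = bform T y x.
Proof.
rewrite !bformE exchange_big /=; apply: eq_bigr => i _; apply: eq_bigr => j _.
by rewrite symE; ring.
Qed.

Lemma qformD T x y :
  bform T (x + y) (x + y) = bform T x x + 2 * bform T x y + bform T y y.
Proof. by rewrite bformDl !bformDr (bformC T y x); ring. Qed.

Lemma mxtrace_rank1 A u v : \tr (A *m (u *m v^T)) = bform A v u.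
Proof. by rewrite mulmxA mxtrace_mulC mulmxA /bform /mxtrace big_ord1. Qed.

Lemma bform_rank1 u v x y :
  bform (u *m v^T) x y = (x^T *m u) 0 0 * (v^T *m y) 0 0.
Proof. by rewrite /bform !mulmxA -mulmxA mxE big_ord1. Qed.

Lemma dot_sym x y : (x^T *m y) 0 0 = (y^T *m x) 0 0.
Proof. by rewrite !mxE; apply: eq_bigr => i _; rewrite !mxE mulrC. Qed.

Lemma rank1_subproof u : u *m u^T \in @is_sym R d.
Proof. by rewrite unfold_in trmx_mul trmxK. Qed.

Definition rank1 u : sym R d := Sym (rank1_subproof u).

Lemma qform_rank1 u x : bform (rank1 u) x x = (u^T *m x) 0 0 ^+ 2.
Proof. by rewrite /= bform_rank1 dot_sym expr2. Qed.

Lemma rank1_ge0 u : possemidef (rank1 u).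
Proof. by move=> x; rewrite -/(bform _ _ _) qform_rank1 sqr_ge0. Qed.

Lemma symmxD S T : symmx (S + T) = symmx S + symmx T. Proof. by []. Qed.
Lemma symmxN S : symmx (- S) = - symmx S. Proof. by []. Qed.
Lemma symmxB S T : symmx (S - T) = symmx S - symmx T. Proof. by []. Qed.
Lemma symmxZ a S : symmx (a *: S) = a *: symmx S. Proof. by []. Qed.
Lemma symmx0 : symmx (0 : sym R d) = 0. Proof. by []. Qed.
Lemma symmx_sum (I : Type) (s : seq I) (P : pred I) (f : I -> sym R d) :
  symmx (\sum_(i <- s | P i) f i) = \sum_(i <- s | P i) symmx (f i).
Proof. exact: (big_morph (@symmx R d) symmxD symmx0). Qed.

Lemma possemidefE T : possemidef T = forall x, 0 <= bform T x x.
Proof. by []. Qed.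

Lemma posdefE T : posdef T = forall x, x != 0 -> 0 < bform T x x.
Proof. by []. Qed.

Lemma posdefW T : posdef T -> possemidef T.
Proof.
move=> Tp x; have [->|/Tp/ltW//] := eqVneq x 0.
by rewrite mulmx0 mxE.
Qed.

Lemma possemidefD S T : possemidef S -> possemidef T -> possemidef (S + T).
Proof.
rewrite !possemidefE => Sp Tp x; rewrite symmxD bformD; exact: addr_ge0.
Qed.

Lemma posdefD S T : posdef S -> possemidef T -> posdef (S + T).
Proof.
rewrite !posdefE => Sp Tp x x0; rewrite symmxD bformD.
by apply: ltr_pwDl; [exact: Sp|exact: Tp].
Qed.

Lemma possemidefZ a T : 0 <= a -> possemidef T -> possemidef (a *: T).
Proof.
rewrite !possemidefE => a0 Tp x; rewrite symmxZ bformZ; exact: mulr_ge0.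
Qed.

Lemma posdefZ a T : 0 < a -> posdef T -> posdef (a *: T).
Proof. by rewrite !posdefE => a0 Tp x x0; rewrite symmxZ bformZ; apply: mulr_gt0 => //; exact: Tp. Qed.

Lemma possemidef0 : possemidef (0 : sym R d).
Proof. by move=> x; rewrite -/(bform _ _ _) bform0. Qed.

Lemma possemidef_sum (I : eqType) (s : seq I) (f : I -> sym R d) :
  (forall i, i \in s -> possemidef (f i)) -> possemidef (\sum_(i <- s) f i).
Proof.
move=> fp; rewrite big_seq; apply: (@big_ind _ (@possemidef R d)) => //.
  exact: possemidef0.
exact: possemidefD.
Qed.

Lemma sym1_subproof : (1%:M : 'M[R]_d) \in @is_sym R d.
Proof. by rewrite unfold_in trmx1. Qed.

Definition sym1 : sym R d := Sym sym1_subproof.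

Lemma posdef1 : posdef sym1.
Proof.
rewrite posdefE => x x0; rewrite bform1 lt_neqAle eq_sym.
rewrite sumr_ge0 ?andbT => [|i _]; last by rewrite -expr2 sqr_ge0.
apply: contra x0; rewrite psumr_eq0 => [/allP x0|i _]; last by rewrite -expr2 sqr_ge0.
apply/eqP/matrixP => i j; rewrite (ord1 j) mxE.
by have := x0 i (mem_index_enum _); rewrite mulf_eq0 orbb => /eqP.
Qed.

Lemma psd_CauchySchwarz T x y : possemidef T ->
  bform T x y ^+ 2 <= bform T x x * bform T y y.
Proof.
rewrite possemidefE => Tp.
have q a b : 0 <= a ^+ 2 * bform T x x + 2 * a * b * bform T x y + b ^+ 2 * bform T y y.
  have := Tp (a *: x + b *: y); rewrite qformD !bformZl !bformZr.
  by congr (_ <= _); ring.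
have := Tp y; rewrite le_eqVlt => /predU1P[y0|y0]; last first.
  (* With a, b, c the values at (x, x), (y, y), (x, y), the form at b x - c y equals b (a b -
     c^2). *)
  have := q (bform T y y) (- bform T x y).
  set a := bform T x x; set b := bform T y y in y0 *; set c := bform T x y.
  move=> H; have : 0 <= b * (a * b - c ^+ 2).
    by apply: (le_trans H); rewrite le_eqVlt; apply/orP; left; apply/eqP; ring.
  by rewrite pmulr_rge0 // subr_ge0.
rewrite -y0 mulr0; have [->|c0] := eqVneq (bform T x y) 0; first by rewrite expr0n.
(* If y is isotropic and c is not zero, the form at x + s y is affine in s, namely a + 2 s c; this s
   makes it -1, a contradiction. *)
have := q 1 (- (bform T x x + 1) / (2 * bform T x y)).
rewrite -y0 mulr0 addr0 expr1n mul1r mulr1.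
suff -> : bform T x x + 2 * (- (bform T x x + 1) / (2 * bform T x y)) * bform T x y = -1.
  by rewrite ler0N1.
by field.
Qed.

(* A Schur complement step kills one more diagonal entry. *)
Lemma psd_sum_rank1 T : possemidef T ->
  exists ls : seq 'cV[R]_d, T = \sum_(l <- ls) rank1 l.
Proof.
have [n] := ubnP #|[set i | T i i != 0]%SET|.
elim: n T => // n IH T Tn Tp.
have [T0|[i Ti]] : (forall i, T i i = 0) \/ (exists i, T i i != 0).
  have [/existsP|/existsPn T0] := boolP [exists i, T i i != 0]; first by right.
  by left => i; apply/eqP; rewrite -[_ == _]negbK.
  exists [::]; rewrite big_nil; apply/val_inj/matrixP => i j; rewrite [RHS]mxE.
  have := psd_CauchySchwarz (delta_mx i 0) (delta_mx j 0) Tp.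
  by rewrite !bform_delta T0 mul0r exprn_even_le0 //= => /eqP.
have Tp' j : 0 <= T j j by have := Tp (delta_mx j 0); rewrite -/(bform _ _ _) bform_delta.
have Ti0 : 0 < T i i by rewrite lt_neqAle eq_sym Ti Tp'.
pose u : 'cV_d := (Num.sqrt (T i i))^-1 *: ((T : 'M[R]_d) *m delta_mx i 0).
have uE x : (u^T *m x) 0 0 ^+ 2 = bform T x (delta_mx i 0) ^+ 2 / T i i.
  rewrite /u linearZ /= -scalemxAl mxE exprMn exprVn sqr_sqrtr // mulrC.
  by congr (_ ^+ 2 / _); rewrite bformC trmx_mul sym_tr.
have T'p : possemidef (T - rank1 u).
  rewrite possemidefE => x; rewrite symmxB bformD bformN -/(symmx (rank1 u)).
  rewrite qform_rank1 uE subr_ge0 ler_pdivrMr //.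
  by have := psd_CauchySchwarz x (delta_mx i 0) Tp; rewrite bform_delta.
have T'i j : (T - rank1 u) j j = T j j - T j i ^+ 2 / T i i.
  rewrite -bform_delta symmxB bformD bformN -/(symmx (rank1 u)) qform_rank1 uE.
  by rewrite !bform_delta.
have [||ls E] := IH (T - rank1 u); last 2 first.
- exact: T'p.
- by exists (u :: ls); rewrite big_cons -E addrC subrK.
rewrite -ltnS; apply: leq_trans Tn; rewrite ltnS; apply: proper_card.
apply/properP; split.
  (* A zero diagonal entry forces its whole row to vanish, so the step creates no new nonzero
     diagonal entry. *)
  apply/fintype.subsetP => j; rewrite !inE T'i; apply: contra => /eqP Tj.
  have := psd_CauchySchwarz (delta_mx j 0) (delta_mx i 0) Tp.
  rewrite !bform_delta Tj mul0r exprn_even_le0 //= => /eqP ->.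
  by rewrite expr0n mul0r subrr.
by exists i; rewrite !inE // T'i expr2 mulfK // subrr eqxx.
Qed.

Lemma posdef_unitmx T : posdef T -> (T : 'M[R]_d) \in unitmx.
Proof.
move=> Tp; rewrite -row_free_unit; apply/row_freeP.
have : kermx (T : 'M[R]_d) == 0.
  apply/eqP/row_matrixP => i; rewrite row0.
  apply/eqP/negPn/negP => ki.
  have := Tp (row i (kermx T))^T; rewrite trmxK.
  have -> : row i (kermx T) *m T = 0 by rewrite -row_mul mulmx_ker row0.
  rewrite mul0mx mxE ltxx => H; suff : false by []; apply: H.
  by apply: contra ki => /eqP H; rewrite -[row _ _]trmxK H trmx0.
by rewrite kermx_eq0 => /row_freeP.
Qed.

Lemma inv_sym_subproof T : invmx (T : 'M[R]_d) \in @is_sym R d.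
Proof. by rewrite unfold_in trmx_inv sym_tr. Qed.

Definition inv_sym T : sym R d := Sym (inv_sym_subproof T).

Lemma posdef_inv T : posdef T -> posdef (inv_sym T).
Proof.
move=> Tp; have Tu := posdef_unitmx Tp; rewrite posdefE => x x0.
have := Tp (invmx (T : 'M[R]_d) *m x).
rewrite trmx_mul trmx_inv sym_tr -!mulmxA (mulmxA (T : 'M[R]_d)) mulmxV // mul1mx mulmxA.
apply; apply: contra x0 => /eqP H; apply/eqP.
by rewrite -[x]mul1mx -(mulmxV Tu) -mulmxA H mulmx0.
Qed.

(** Cauchy-Schwarz for the form T at the vectors T^-1 u and x. *)
Lemma posdef_ge_rank1 T u x : posdef T ->
  (u^T *m x) 0 0 ^+ 2 <= bform (inv_sym T) u u * bform T x x.
Proof.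
move=> Tp; have Tu := posdef_unitmx Tp.
have := psd_CauchySchwarz (invmx (T : 'M[R]_d) *m u) x (posdefW Tp).
congr (_ <= _).
  by congr (_ ^+ 2); rewrite /bform trmx_mul trmx_inv sym_tr mulmxKV.
congr (_ * _); rewrite /bform /= trmx_mul trmx_inv sym_tr.
by rewrite -!mulmxA (mulmxA (T : 'M[R]_d)) mulmxV // mul1mx.
Qed.

(** Summing [posdef_ge_rank1] over the basis vectors bounds the squared length of x by tr(T^-1)
    times the form, so no compactness of the sphere is involved. The added 1 makes the constant
    invertible. *)
Lemma posdef_coercive T : posdef T ->
  exists2 c : R, 0 < c & forall x, c * \sum_i x i 0 ^+ 2 <= bform T x x.
Proof.
move=> Tp; pose b := 1 + \sum_i bform (inv_sym T) (delta_mx i 0) (delta_mx i 0).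
have inv0 i : 0 <= bform (inv_sym T) (delta_mx i 0) (delta_mx i 0).
  exact/posdefW/posdef_inv.
have b0 : 0 < b by rewrite ltr_pwDl // sumr_ge0.
exists b^-1; first by rewrite invr_gt0.
move=> x; rewrite mulrC ler_pdivrMr // mulrDr mulr1 mulr_sumr -[leLHS]add0r lerD //.
  exact: posdefW.
apply: ler_sum => i _; rewrite mulrC.
have := posdef_ge_rank1 (delta_mx i 0) x Tp; congr (_ <= _); congr (_ ^+ 2).
by rewrite trmx_delta -rowE mxE.
Qed.

Lemma ler_norm_entry T i j : `|T i j| <= `|T|.
Proof.
rewrite sym_normE /frob -sqrtr_sqr ler_wsqrtr //.
rewrite (bigD1 i) //= (bigD1 j) //= -addrA lerDl addr_ge0 //.
  by apply: sumr_ge0 => k _; rewrite sqr_ge0.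
by do 2!apply: sumr_ge0 => ? _; rewrite sqr_ge0.
Qed.

Lemma ler_normM2 (a b : R) : `|a * b| <= a ^+ 2 + b ^+ 2.
Proof.
rewrite normrM -(real_normK (num_real a)) -(real_normK (num_real b)).
have := sqr_ge0 (`|a| - `|b|); have := normr_ge0 a; have := normr_ge0 b; nra.
Qed.

Lemma ler_norm_qform T x : `|bform T x x| <= `|T| * (2 * d%:R * \sum_i x i 0 ^+ 2).
Proof.
rewrite bformE (le_trans (ler_norm_sum _ _ _)) //.
have -> : 2 * d%:R * \sum_i x i 0 ^+ 2 = \sum_i \sum_j (x i 0 ^+ 2 + x j 0 ^+ 2).
  under [RHS]eq_bigr do rewrite big_split /= sumr_const card_ord -mulr_natl.
  by rewrite big_split /= sumr_const card_ord -mulr_sumr -mulr_natl; ring.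
rewrite mulr_sumr; apply: ler_sum => i _.
rewrite (le_trans (ler_norm_sum _ _ _)) // mulr_sumr; apply: ler_sum => j _.
rewrite mulrAC mulrC normrM ler_pM ?ler_norm_entry //.
exact: ler_normM2.
Qed.

Lemma posdef_open : open (@posdef R d).
Proof.
rewrite openE => T Tp; have [c c0 cT] := posdef_coercive Tp.
apply/nbhs_ballP; exists (c / (2 * d%:R + 1)) => /=.
  by rewrite divr_gt0 // ltr_wpDl // mulr_ge0.
move=> S; rewrite -ball_normE /= => TS; rewrite posdefE => x x0.
have -> : S = T - (T - S) by rewrite opprB addrC subrK.
rewrite symmxB bformD bformN subr_gt0.
have s0 : 0 < \sum_i x i 0 ^+ 2.
  have := posdef1 x0; rewrite -/(bform _ _ _) bform1.
  by under eq_bigr do rewrite -expr2.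
apply: lt_le_trans (cT x); apply: le_lt_trans (ler_norm _) _.
apply: le_lt_trans (ler_norm_qform (T - S) x) _.
rewrite mulrA ltr_pM2r //; apply: le_lt_trans (_ : _ <= `|T - S| * (2 * d%:R + 1)) _.
  by rewrite ler_wpM2l // lerDl.
by rewrite -ltr_pdivlMr // ltr_wpDl // mulr_ge0.
Qed.

End QuadraticForms.

(** * The matrix (1 + 2 T S)^-1 T and the determinant of 1 + 2 T S *)

Section Sharp.
Variables (R : realType) (d : nat).
Implicit Types (M S : 'M[R]_d) (u v l : 'cV[R]_d) (T W : sym R d) (ls : seq 'cV[R]_d).

(** Two factorizations of one block matrix of size d + 1 into triangular blocks, one exposing the d
    x d block and the other the 1 x 1 block. *)
Lemma det_rank1_update u v : \det (1%:M + u *m v^T) = 1 + (v^T *m u) 0 0.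
Proof.
have E : block_mx 1%:M 0 u 1%:M *m block_mx 1%:M (- v^T) 0 (1%:M + u *m v^T) =
    block_mx (1%:M + v^T *m u) (- v^T) 0 1%:M *m block_mx (1%:M : 'M[R]_1) 0 u 1%:M.
  rewrite !mulmx_block !(mul0mx, mulmx0, mulmx1, mul1mx, addr0, add0r) mulmxN.
  by rewrite mulNmx addrK addrC addrK.
have := congr1 determinant E.
rewrite !det_mulmx !det_lblock !det_ublock !det1 !mul1r !mulr1 => ->.
by rewrite det_mx11 !mxE.
Qed.

Lemma mulmx_shift M S : M *m (1%:M + S *+ 2) = M + (M *m S) *+ 2.
Proof. by rewrite mulmxDr mulmx1 !mulr2n mulmxDr. Qed.

(** The Sherman-Morrison formula for (1 + 2 T l l^T)^-1 T, see [shrink_eq]. In this form symmetry is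
    built in and positivity reduces to Cauchy-Schwarz. *)
Definition shrink l T : sym R d :=
  T - (2 / (1 + 2 * bform T l l)) *: rank1 ((T : 'M[R]_d) *m l).

Lemma shrink_ge0 l T : possemidef T -> possemidef (shrink l T).
Proof.
rewrite !possemidefE => Tp x; rewrite /shrink symmxB symmxZ bformD bformN bformZ.
rewrite qform_rank1 trmx_mul sym_tr -/(bform _ _ _) subr_ge0.
have p0 : 0 < 1 + 2 * bform T l l by rewrite ltr_wpDr // mulr_ge0 //; exact: Tp.
rewrite mulrAC ler_pdivrMr //.
have := psd_CauchySchwarz l x Tp; have := Tp x; have := Tp l.
set a := bform T l l; set b := bform T x x; set c := bform T l x; nra.
Qed.

Definition shrinks ls T := foldr shrink T ls.

(** det(1 + 2 T [gram ls]) factor by factor: each vector contributes by the determinant lemma,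
    evaluated at the matrix already shrunk by the vectors after it. *)
Fixpoint shrinks_det ls T : R :=
  if ls is l :: ls' then shrinks_det ls' T * (1 + 2 * bform (shrinks ls' T) l l) else 1.

Lemma shrinks_ge0 ls T : possemidef T -> possemidef (shrinks ls T).
Proof. by move=> Tp; elim: ls => //= l ls IH; exact: shrink_ge0. Qed.

Lemma shrinks_det_ge1 ls T : possemidef T -> 1 <= shrinks_det ls T.
Proof.
move=> Tp; elim: ls => //= l ls IH; rewrite -[leLHS]mulr1 ler_pM //.
by rewrite lerDl mulr_ge0 //; exact: shrinks_ge0.
Qed.

Lemma shrink_eq l T : possemidef T ->
  (1%:M + ((T : 'M[R]_d) *m (l *m l^T)) *+ 2) *m shrink l T = T.
Proof.
move=> Tp; have p0 : 1 + 2 * bform T l l != 0.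
  by rewrite gt_eqF // ltr_wpDr // mulr_ge0 //; exact: Tp.
rewrite /shrink symmxB symmxZ /= trmx_mul sym_tr.
set p := bform T l l in p0 *; set T' : 'M[R]_d := T.
have E : l^T *m T' *m l = p%:M.
  by apply/matrixP => i j; rewrite !ord1 [RHS]mxE eqxx mulr1n.
have E2 : T' *m (l *m l^T) *m (T' *m l *m (l^T *m T')) = p *: (T' *m l *m (l^T *m T')).
  rewrite !mulmxA -(mulmxA (T' *m l)) -(mulmxA (T' *m l) _ l) E mul_mx_scalar.
  by rewrite -!scalemxAl !mulmxA.
have E3 : T' *m (l *m l^T) *m T' = T' *m l *m (l^T *m T') by rewrite !mulmxA.
rewrite mulmxBr -scalemxAr !mulmxDl !mul1mx E2 E3.
move: (_ *m (l^T *m T')) => X; apply/matrixP => i j; rewrite !mxE.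
by field.
Qed.

Definition gram ls : 'M[R]_d := \sum_(l <- ls) l *m l^T.

(** If (1 + 2 T S) T1 = T, then 1 + 2 T (l l^T + S) = (1 + 2 T S)(1 + 2 T1 l l^T), so both claims
    pass from S to S + l l^T by one [shrink]. *)
Lemma shrinks_eq ls T : possemidef T ->
  (1%:M + ((T : 'M[R]_d) *m gram ls) *+ 2) *m shrinks ls T = T /\
  \det (1%:M + ((T : 'M[R]_d) *m gram ls) *+ 2) = shrinks_det ls T.
Proof.
move=> Tp; rewrite /gram; elim: ls => [|l ls [IH1 IH2]] /=.
  by rewrite big_nil mulmx0 mul0rn addr0 mul1mx det1.
rewrite big_cons; set S := \sum_(_ <- _) _ in IH1 IH2 *.
have T1p := shrinks_ge0 ls Tp; set T1 := shrinks ls T in IH1 T1p *.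
have -> : 1%:M + ((T : 'M[R]_d) *m (l *m l^T + S)) *+ 2 =
    (1%:M + ((T : 'M[R]_d) *m S) *+ 2) *m (1%:M + ((T1 : 'M[R]_d) *m (l *m l^T)) *+ 2).
  rewrite mulmx_shift mulmxA IH1 mulmxDr; move: (_ *m (l *m l^T)) (_ *m S) => A B.
  by apply/matrixP => i j; rewrite !mxE; ring.
rewrite -mulmxA shrink_eq // det_mulmx IH2; split => //; congr (_ * _).
have -> : ((T1 : 'M[R]_d) *m (l *m l^T)) *+ 2 = (2 *: ((T1 : 'M[R]_d) *m l)) *m l^T.
  by rewrite -scalemxAl -mulmxA scaler_nat.
by rewrite det_rank1_update -scalemxAr mxE /bform mulmxA.
Qed.

Definition sharp T S : 'M[R]_d := invmx (1%:M + ((T : 'M[R]_d) *m S) *+ 2) *m T.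

Lemma shrinksE ls T : possemidef T -> shrinks ls T = sharp T (gram ls) :> 'M[R]_d.
Proof.
move=> Tp; have [E1 E2] := shrinks_eq ls Tp.
rewrite /sharp -{2}E1 mulKmx // unitmxE unitfE E2 gt_eqF //.
exact: lt_le_trans (shrinks_det_ge1 _ Tp).
Qed.

Section PsdScale.
Variables (T : sym R d) (S : sym R d).
Hypotheses (Tp : possemidef T) (Sp : possemidef S).

Lemma det_ge1 : 1 <= \det (1%:M + ((T : 'M[R]_d) *m S) *+ 2).
Proof.
have [ls ->] := psd_sum_rank1 Sp; rewrite symmx_sum.
by have [_ ->] := shrinks_eq ls Tp; exact: shrinks_det_ge1.
Qed.

Lemma det_gt0 : 0 < \det (1%:M + ((T : 'M[R]_d) *m S) *+ 2).
Proof. exact: lt_le_trans det_ge1. Qed.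

Lemma unitmx_shift : 1%:M + ((T : 'M[R]_d) *m S) *+ 2 \in unitmx.
Proof. by rewrite unitmxE unitfE gt_eqF // det_gt0. Qed.

(** Neither symmetry nor positivity shows in the formula of [sharp]; both come from writing S as a
    sum of squares and shrinking one square at a time. *)
Lemma sharp_psd : exists2 T' : sym R d, possemidef T' & symmx T' = sharp T S.
Proof.
have [ls ->] := psd_sum_rank1 Sp; rewrite symmx_sum.
by exists (shrinks ls T); [exact: shrinks_ge0|exact: shrinksE].
Qed.

Lemma sharp_mul : (1%:M + ((T : 'M[R]_d) *m S) *+ 2) *m sharp T S = T.
Proof. by rewrite /sharp mulKVmx // unitmx_shift. Qed.

(** Up to sign, the left side is the symbol matrix of D evaluated at nabla = -T. The adjugate there
    has S T instead of T S, hence the transpositions and the appeal to the symmetry of T#. *)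
Lemma mul_adj_sharp :
  (T : 'M[R]_d) *m \adj (1%:M + ((S : 'M[R]_d) *m T) *+ 2) =
  \det (1%:M + ((T : 'M[R]_d) *m S) *+ 2) *: sharp T S.
Proof.
have [T' _ ET'] := sharp_psd.
have -> : 1%:M + ((S : 'M[R]_d) *m T) *+ 2 = (1%:M + ((T : 'M[R]_d) *m S) *+ 2)^T.
  by rewrite linearD /= trmx1 linearMn /= trmx_mul !sym_tr.
have sM := sharp_mul; set M := 1%:M + _ in sM *.
rewrite -trmx_adj -{1}(sym_tr T) -trmx_mul -{1}sM mulmxA mul_adj_mx mul_scalar_mx.
by rewrite linearZ /= -ET' sym_tr.
Qed.

(** T S commutes with (1 + 2 T S)^-1, and S cancels the S^-1 inside the noncentrality parameter. *)
Lemma laplace_exponent W c : posdef S ->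
  \tr ((T : 'M[R]_d) *m S *m invmx (1%:M + ((T : 'M[R]_d) *m S) *+ 2) *m
       (c *: (invmx (S : 'M[R]_d) *m W))) = c * \tr (sharp T S *m W).
Proof.
move=> Sp'; rewrite -scalemxAr mxtraceZ; congr (c * \tr _).
set M := 1%:M + _; have Mu : M \in unitmx := unitmx_shift.
have -> : (T : 'M[R]_d) *m S *m invmx M = invmx M *m ((T : 'M[R]_d) *m S).
  apply: (can_inj (mulKmx Mu)); rewrite mulKVmx //.
  have -> : M *m ((T : 'M[R]_d) *m S *m invmx M) = ((T : 'M[R]_d) *m S) *m M *m invmx M.
    by rewrite mulmxA; congr (_ *m _); rewrite /M mulmx_shift mulmxDl mul1mx !mulr2n mulmxDl.
  by rewrite mulmxK.
by rewrite -!mulmxA (mulmxA (S : 'M[R]_d)) mulmxV ?posdef_unitmx // mul1mx !mulmxA.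
Qed.

End PsdScale.

(** Composition rule for scales: once S is dealt with, S' is seen through T# instead of T. This is
    what makes the stationary law invariant. *)
Lemma det_mul_sharp T (S S' : sym R d) : possemidef T -> possemidef S ->
  \det (1%:M + ((T : 'M[R]_d) *m (symmx S + symmx S')) *+ 2) =
  \det (1%:M + ((T : 'M[R]_d) *m S) *+ 2) * \det (1%:M + (sharp T S *m S') *+ 2).
Proof.
move=> Tp Sp; rewrite -det_mulmx; congr (\det _).
rewrite mulmx_shift mulmxA sharp_mul //.
by rewrite mulmxDr mulrnDl addrA.
Qed.

End Sharp.

(** * Monotone class theorem for exponentials *)

Section Borel.
Variables (R : realType) (d : nat).
Implicit Types (S T W X Y : sym R d).

Lemma ler_norm_sum_entries T : `|T| <= \sum_i \sum_j `|T i j|.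
Proof.
have s0 : 0 <= \sum_i \sum_j `|T i j| by do 2!apply: sumr_ge0 => ? _.
rewrite sym_normE /frob -(ger0_norm s0) -sqrtr_sqr ler_wsqrtr // expr2 mulr_suml.
apply: ler_sum => i _.
apply: le_trans (_ : (\sum_j `|T i j|) * (\sum_j `|T i j|) <= _); last first.
  rewrite ler_wpM2l ?sumr_ge0 // [leRHS](bigD1 i) //= lerDl.
  by do 2!apply: sumr_ge0 => ? _.
rewrite mulr_suml; apply: ler_sum => j _.
rewrite -real_normK ?num_real // expr2 ler_wpM2l // [leRHS](bigD1 j) //= lerDl.
exact: sumr_ge0.
Qed.

(** The rational center need not be symmetric, so the distance is taken entrywise and not in the
    norm of [sym]. *)
Definition entry_dist (q : 'M[rat]_d) X : R := \sum_i \sum_j `|X i j - ratr (q i j)|.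

(** Second countability: an open set is the union of the countably many rational balls that it
    contains, and each such ball is cut out by the entries. *)
Lemma measurable_sym d' (Z : measurableType d') (D : set Z) (f : Z -> symB R d) :
  (forall i j, measurable_fun D (fun z => (f z : sym R d) i j)) -> measurable_fun D f.
Proof.
move=> mf mD; apply: (@measurability _ _ Z (symB R d) D f (@open (sym R d))) => // {} _ [U oU <-].
pose B (p : 'M[rat]_d * nat) := [set X | entry_dist p.1 X < p.2.+1%:R^-1].
have -> : D `&` f @^-1` U =
    \bigcup_p (if `[< B p `<=` U >] then D `&` [set z | B p (f z)] else set0).
  apply/seteqP; split => [z [Dz Uz]|z [p _]]; last first.
    by case: ifPn => // /asboolP BU [Dz Bz]; split => //; exact: BU.
  have : nbhs (f z : sym R d) U by apply: open_nbhs_nbhs; split.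
  move=> /nbhs_ballP[e /= e0 eU].
  (* Two points of a ball of radius 1/(n+1) are closer than 2/(n+1), which has to stay below e. *)
  pose n := Num.truncn (2 / e).
  have ne : 2 * n.+1%:R^-1 < e.
    by rewrite ltr_pdivrMr // mulrC -ltr_pdivrMr // truncnS_gt.
  (* The d * d entries together stay strictly below 1/(n+1), also when d = 0. *)
  pose c : R := n.+1%:R^-1 / (d * d).+1%:R.
  have c0 : 0 < c by rewrite divr_gt0.
  have /choice[q qP] (p : 'I_d * 'I_d) :
      exists q : rat, ratr q \in `](f z : sym R d) p.1 p.2 - c, (f z : sym R d) p.1 p.2 + c[.
    by apply: rat_in_itvoo; rewrite ltrBlDr -addrA ltrDl addr_gt0.
  pose Q : 'M[rat]_d := \matrix_(i, j) q (i, j).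
  have Qz : entry_dist Q (f z) < n.+1%:R^-1.
    apply: (@le_lt_trans _ _ (\sum_(i < d) \sum_(j < d) c)).
      apply: ler_sum => i _; apply: ler_sum => j _; rewrite mxE.
      have := qP (i, j); rewrite in_itv /= => /andP[h1 h2]; rewrite ler_norml.
      by apply/andP; split; lra.
    rewrite !sumr_const card_ord -mulrnA -[ltLHS]mulr_natl mulrCA -[ltRHS]mulr1.
    by rewrite ltr_pM2l // ltr_pdivrMr // mul1r ltr_nat.
  have BU : `[< B (Q, n) `<=` U >].
    apply/asboolP => Y BY; apply: eU; rewrite -ball_normE /=.
    apply: le_lt_trans ne; apply: le_trans (ler_norm_sum_entries _) _.
    apply: (@le_trans _ _ (entry_dist Q (f z) + entry_dist Q Y)); last first.
      by rewrite mulr_natl mulr2n lerD // ltW.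
    rewrite /entry_dist -big_split; apply: ler_sum => i _ /=.
    rewrite -big_split; apply: ler_sum => j _ /=.
    rewrite !mxE (le_trans _ (ler_normB _ _)) //.
    by rewrite le_eqVlt; apply/orP; left; apply/eqP; congr `|_|; ring.
  by exists (Q, n) => //; rewrite BU.
apply: countable_bigcupT_measurable => // p; case: ifP => // _.
rewrite (_ : [set z | _] = (fun z => entry_dist p.1 (f z)) @^-1` `]-oo, p.2.+1%:R^-1[%classic).
  suff mE : measurable_fun D (fun z => entry_dist p.1 (f z)) by by apply: mE => //; exact: measurable_itv.
  apply: measurable_sum => i; apply: measurable_sum => j.
  apply: measurableT_comp => //; apply: measurable_funB; first exact: mf.
  exact: measurable_cst.
by apply/seteqP; split => z; rewrite /B /= in_itv.
Qed.

End Borel.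

Section MonotoneClass.
Variables (R : realType) (d : nat).
Implicit Types (S T W X Y : sym R d) (f g : symB R d -> R).
Local Notation pd := (@posdef R d : set (symB R d)).

Lemma measurable_posdef : measurable pd.
Proof. by apply: sub_sigma_algebra; exact: posdef_open. Qed.
Hint Resolve measurable_posdef : core.

Lemma measurable_within f : {within @posdef R d, continuous f} -> measurable_fun pd f.
Proof.
move=> cf; apply: (measurability _ (RGenOInfty.measurableE R)) => _ [_ [x ->] <-].
apply: sub_sigma_algebra; move: cf; rewrite continuous_open_subspace; last exact: posdef_open.
by rewrite continuous_inP; [apply; exact: interval_open|exact: posdef_open].
Qed.

Lemma sym_cvgP (f : sym R d -> R) X (l : R) : f @ nbhs X --> l <->
  forall e : R, 0 < e -> exists2 dl : R, 0 < dl & forall Y, `|Y - X| < dl -> `|f Y - l| <= e.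
Proof.
have FF : Filter (nbhs X) by exact: nbhs_filter.
split => [/(@cvgrPdist_le R R^o (sym R d) (nbhs X) FF) h e e0|h].
  have /nbhs_ballP[dl /= dl0 dlh] := h e e0; exists dl => // Y YX.
  by rewrite distrC; apply: dlh; rewrite -ball_normE /= distrC.
apply/(@cvgrPdist_le R R^o (sym R d) (nbhs X) FF) => e e0.
have [dl dl0 dlh] := h e e0; apply/nbhs_ballP; exists dl => //= Y.
by rewrite -ball_normE /= distrC => YX; rewrite distrC dlh.
Qed.

Lemma continuous_entry i j : continuous (fun X : sym R d => X i j).
Proof.
move=> X; apply/sym_cvgP => e e0; exists e => // Y YX.
by have := ler_norm_entry (Y - X) i j; rewrite symmxB !mxE => /le_trans; apply; exact: ltW.
Qed.

Lemma measurable_entry D i j : measurable_fun D (fun X : symB R d => (X : sym R d) i j).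
Proof.
apply: measurable_funS (@measurableT _ _) (@subsetT _ _) _.
apply: (measurability _ (RGenOInfty.measurableE R)) => _ [_ [x ->] <-].
rewrite setTI; apply: sub_sigma_algebra.
by have /continuousP := @continuous_entry i j; apply; exact: interval_open.
Qed.

Lemma mxtraceM_sum (A B : 'M[R]_d) : \tr (A *m B) = \sum_i \sum_j A i j * B j i.
Proof. by apply: eq_bigr => i _; rewrite mxE. Qed.

Lemma mxtrace_psd T X : possemidef T -> possemidef X -> 0 <= \tr ((T : 'M[R]_d) *m X).
Proof.
move=> Tp /psd_sum_rank1[ls ->]; rewrite symmx_sum mulmx_sumr raddf_sum /=.
by apply: sumr_ge0 => l _; rewrite mxtrace_rank1; exact: Tp.
Qed.

Definition lexp T : symB R d -> R := fun X => expR (- \tr ((T : 'M[R]_d) *m (X : sym R d))).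

Definition bmf f := measurable_fun pd f /\ exists C, forall X, posdef X -> `|f X| <= C.

Lemma lexp_ge0 T X : 0 <= lexp T X. Proof. exact: expR_ge0. Qed.

Lemma lexp_le1 T X : possemidef T -> posdef X -> lexp T X <= 1.
Proof.
by move=> Tp Xp; rewrite -expR0 ler_expR oppr_le0 mxtrace_psd //; exact: posdefW.
Qed.

Lemma lexpD S T X : lexp (S + T) X = lexp S X * lexp T X.
Proof. by rewrite /lexp symmxD mulmxDl mxtraceD opprD expRD. Qed.

Lemma measurable_mxtraceM T D :
  measurable_fun D (fun X : symB R d => \tr ((T : 'M[R]_d) *m (X : sym R d))).
Proof.
under eq_fun do rewrite mxtraceM_sum.
apply: measurable_sum => i; apply: measurable_sum => j.
by apply: measurable_funM => //; exact: measurable_entry.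
Qed.

Lemma bmf_lexp T : possemidef T -> bmf (lexp T).
Proof.
move=> Tp; split; last by exists 1 => X Xp; rewrite ger0_norm ?lexp_ge0 ?lexp_le1.
apply: measurableT_comp => //; apply: measurableT_comp => //.
exact: measurable_mxtraceM.
Qed.

Lemma bmf_cst c : bmf (fun=> c).
Proof. by split; [exact: measurable_cst|exists `|c|]. Qed.

Lemma bmfD f g : bmf f -> bmf g -> bmf (fun X => f X + g X).
Proof.
move=> [mf [C fC]] [mg [C' gC]]; split; first exact: measurable_funD.
by exists (C + C') => X Xp; rewrite (le_trans (ler_normD _ _)) // lerD ?fC ?gC.
Qed.

Lemma bmfM f g : bmf f -> bmf g -> bmf (fun X => f X * g X).
Proof.
move=> [mf [C fC]] [mg [C' gC]]; split; first exact: measurable_funM.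
by exists (C * C') => X Xp; rewrite normrM ler_pM ?fC ?gC.
Qed.

Lemma bmfZ a f : bmf f -> bmf (fun X => a * f X).
Proof. by move=> bf; apply: bmfM => //; exact: bmf_cst. Qed.

Lemma bmf_sum (I : Type) (s : seq I) (h : I -> symB R d -> R) :
  (forall i, bmf (h i)) -> bmf (fun X => \sum_(i <- s) h i X).
Proof.
move=> bh; elim: s => [|i s IH].
  by under eq_fun do rewrite big_nil; exact: bmf_cst.
by under eq_fun do rewrite big_cons; exact: bmfD.
Qed.

Lemma bmf_eq f g : {in pd, f =1 g} -> bmf f -> bmf g.
Proof.
move=> fg [mf [C fC]]; split; first exact: eq_measurable_fun mf.
by exists C => X Xp; rewrite -fg ?inE // fC.
Qed.

Lemma bmf_cvg (f_ : nat -> symB R d -> R) f (C : R) : (forall n, bmf (f_ n)) ->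
  (forall n X, posdef X -> `|f_ n X| <= C) ->
  (forall X, posdef X -> f_ ^~ X @ \oo --> f X) -> bmf f.
Proof.
move=> bf fC ff; split.
  by apply: (measurable_fun_cvg (h := f_)) => // n; have [] := bf n.
exists C => X Xp; have /cvg_norm h := ff _ Xp.
rewrite -(cvg_lim _ h) //; apply: limr_le; first by apply/cvg_ex; eexists; exact: h.
by apply: nearW => n; exact: fC.
Qed.

Lemma bmf_indic (A : set (symB R d)) : measurable A -> bmf (fun X => (X \in A)%:R).
Proof.
move=> mA; split; last by exists 1 => X _; case: (X \in A); rewrite ?normr1 ?normr0.
exact: measurable_indic.
Qed.

Record mclass (H : (symB R d -> R) -> Prop) : Prop := MClass {
  mc_ext : forall f g, (forall X, posdef X -> f X = g X) -> H f -> H g;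
  mc_lin : forall a f g, bmf f -> bmf g -> H f -> H g -> H (fun X => a * f X + g X);
  mc_bp : forall (f_ : nat -> symB R d -> R) f (C : R), (forall n, bmf (f_ n)) ->
    (forall n, H (f_ n)) -> (forall n X, posdef X -> `|f_ n X| <= C) ->
    (forall X, posdef X -> f_ ^~ X @ \oo --> f X) -> H f }.

End MonotoneClass.

Section Threshold.
Variable R : realType.

Lemma bernoulli_ineq (y : R) n : 0 <= y <= 1 -> 1 - y *+ n <= (1 - y) ^+ n.
Proof.
move=> /andP[y0 y1]; elim: n => [|n IH]; first by rewrite mulr0n subr0 expr0.
rewrite exprS; apply: le_trans (_ : (1 - y) * (1 - y *+ n) <= _); last first.
  by rewrite ler_wpM2l // subr_ge0.
rewrite mulrS -[y *+ n]mulr_natl; have : 0 <= n%:R * y ^+ 2 by rewrite mulr_ge0 // sqr_ge0.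
by nra.
Qed.

(** Indicators as bounded limits of polynomials in one exponential. With u = exp(-x ln 2 / a) one
    has 2 u < 1 exactly when a < x, and (1 - u^m)^(m 2^m) behaves like exp(-m (2 u)^m). The extra
    factor m makes the limit 0 at x = a too, where 2 u = 1. *)
Lemma cvg_threshold (a x : R) : 0 < a -> 0 <= x ->
  (1 - expR (- (ln 2 / a * x)) ^+ n.+1) ^+ (n.+1 * 2 ^ n.+1)
    @[n --> \oo] --> ((a < x)%R%:R : R).
Proof.
move=> a0 x0; have l2 : 0 < ln (2 : R) by rewrite ln_gt0 // ltr1n.
set u := expR _; have u0 : 0 < u by exact: expR_gt0.
have u2 : 2 * u = expR (ln 2 / a * (a - x)).
  rewrite -{1}[2](@lnK R) ?posrE // /u -expRD; congr expR.
  by rewrite mulrBr divfK ?gt_eqF.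
have u1 : u <= 1 by rewrite -expR0 ler_expR oppr_le0 mulr_ge0 // divr_ge0 // ltW.
have uE m : u ^+ m *+ (m * 2 ^ m) = m%:R * (2 * u) ^+ m.
  by rewrite -mulr_natl natrM natrX exprMn; ring.
have un m : 0 <= u ^+ m <= 1 by rewrite exprn_ge0 ?exprn_ile1 // ltW.
have [ax|xa] := ltP a x.
  have d0 : 0 < ln 2 / a * (x - a) by rewrite mulr_gt0 ?subr_gt0 // divr_gt0.
  set dl := ln 2 / a * (x - a) in d0 *.
  have {}u2 : 2 * u = expR (- dl) by rewrite u2; congr expR; rewrite /dl -mulrN opprB.
  apply: (@squeeze_cvgr _ _ _ _ (fun n => 1 - 4 / dl ^+ 2 * n.+1%:R^-1) (fun=> 1)).
  - apply: nearW => n; apply/andP; split; last first.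
      have /andP[h1 h2] := un n.+1.
      by rewrite exprn_ile1 // ?subr_ge0 ?gerBl.
    apply: le_trans (bernoulli_ineq _ (un _)).
    rewrite lerD2l lerN2 uE u2 -expRM_natl mulrN expRN.
    have m0 : 0 < n.+1%:R :> R by [].
    set m := n.+1%:R in m0 *.
    (* Squaring 1 + z/2 <= exp(z/2) shows that m exp(-m dl) is at most 4 / (dl^2 m), which tends to
       0. *)
    have E : m ^+ 2 * dl ^+ 2 / 4 <= expR (m * dl).
      have -> : m * dl = m * dl / 2 + m * dl / 2 by field.
      rewrite expRD; have := expR_ge1Dx (m * dl / 2).
      have : 0 < m * dl by rewrite mulr_gt0.
      rewrite -exprMn; move: (m * dl) => z; move: (expR (z / 2)) => e z0 ze.
      have : (1 + z / 2) * (1 + z / 2) <= e * e by rewrite ler_pM //; lra.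
      by nra.
    rewrite ler_pdivrMr ?expR_gt0 //.
    apply: le_trans (_ : 4 / dl ^+ 2 * m^-1 * (m ^+ 2 * dl ^+ 2 / 4) <= _).
      rewrite le_eqVlt; apply/orP; left; apply/eqP; field.
      by rewrite !gt_eqF.
    by rewrite ler_wpM2l // mulr_ge0 ?invr_ge0 ?divr_ge0 ?exprn_ge0 // ltW.
  - rewrite -[X in _ --> X](subr0 1); apply: cvgB; first exact: cvg_cst.
    rewrite -(mulr0 (4 / dl ^+ 2)); apply: cvgM; first exact: cvg_cst.
    exact: cvg_harmonic.
  - exact: cvg_cst.
apply: (@squeeze_cvgr _ _ _ _ (fun=> 0) (fun n => n.+1%:R^-1)).
- apply: nearW => n; have /andP[h1 h2] := un n.+1; apply/andP; split.
    by rewrite exprn_ge0 // subr_ge0.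
  apply: le_trans (_ : expR (- u ^+ n.+1) ^+ (n.+1 * 2 ^ n.+1) <= _).
    by rewrite lerXn2r ?nnegrE ?expR_ge0 ?subr_ge0 // expR_ge1Dx.
  rewrite -expRM_natl mulrN mulr_natl uE expRN lef_pV2 ?posrE ?expR_gt0 //.
  apply: le_trans (_ : expR (n.+1%:R) <= _).
    by apply: le_trans (expR_ge1Dx _); rewrite lerDr.
  rewrite ler_expR ler_peMr // exprn_ege1 // u2 -[leLHS]expR0 ler_expR.
  by rewrite mulr_ge0 ?subr_ge0 // divr_ge0 // ltW.
- exact: cvg_cst.
- exact: cvg_harmonic.
Qed.

(** The sum counts the integers from 1 to n that are at most y: it is the integer part of y. *)
Lemma sum_nat_threshold (y : R) n : 0 <= y <= n%:R ->
  `|\sum_(k < n) (k.+1%:R <= y)%R%:R - y| <= 1.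
Proof.
move=> /andP[y0 yn].
have : if n%:R <= y then \sum_(k < n) (k.+1%:R <= y)%R%:R = n%:R :> R
    else y - 1 <= \sum_(k < n) (k.+1%:R <= y)%R%:R <= y.
  elim: n {yn} => [|n IH]; first by rewrite y0 big_ord0.
  rewrite big_ord_recr /=; case: (leP n.+1%:R y) => yn.
    have ny : n%:R <= y by apply: le_trans yn; rewrite ler_nat.
    by rewrite ny in IH; rewrite IH -natr1.
  rewrite addr0; case: (leP n%:R y) IH => ny // ->.
  by rewrite ny andbT lerBlDr natr1 ltW.
rewrite ler_norml lerBlDr lerBrDr; case: ifP => [h ->|_ /andP[h1 h2]].
  by apply/andP; split; lra.
by apply/andP; split; lra.
Qed.

End Threshold.

Section MonotoneClassTheorem.
Variables (R : realType) (d : nat) (H : (symB R d -> R) -> Prop).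
Hypothesis Hc : mclass H.
Hypothesis Hexp : forall T : sym R d, possemidef T -> H (lexp T).
Implicit Types (S T W X Y : sym R d) (f g : symB R d -> R).
Local Notation pd := (@posdef R d : set (symB R d)).

Let H' f := bmf f /\ H f.

Let H'_lin a f g : H' f -> H' g -> H' (fun X => a * f X + g X).
Proof.
move=> [bf Hf] [bg Hg]; split; first by apply: bmfD => //; exact: bmfZ.
exact: (mc_lin Hc).
Qed.

Let H'_bp (f_ : nat -> symB R d -> R) f (C : R) : (forall n, H' (f_ n)) ->
    (forall n X, posdef X -> `|f_ n X| <= C) ->
    (forall X, posdef X -> f_ ^~ X @ \oo --> f X) -> H' f.
Proof.
move=> Hf fC ff; split; first by apply: bmf_cvg fC ff => n; have [] := Hf n.
by apply: (mc_bp Hc) fC ff => n; have [] := Hf n.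
Qed.

Let H'_ext f g : (forall X, posdef X -> f X = g X) -> H' f -> H' g.
Proof.
move=> fg [bf Hf]; split; last exact: (mc_ext Hc) Hf.
by apply: bmf_eq bf => X; rewrite inE => /fg.
Qed.

Let H'1 : H' (fun=> 1).
Proof.
apply: (@H'_ext (lexp 0)).
  by move=> X _; rewrite /lexp symmx0 mul0mx mxtrace0 oppr0 expR0.
by split; [apply: bmf_lexp|apply: Hexp]; exact: possemidef0.
Qed.

Let H'0 : H' (fun=> 0).
Proof. by apply: (H'_ext _ (H'_lin (-1) H'1 H'1)) => X _; ring. Qed.

Let H'_sum (I : Type) (s : seq I) (c : I -> R) (h : I -> symB R d -> R) :
  (forall i, H' (h i)) -> H' (fun X => \sum_(i <- s) c i * h i X).
Proof.
move=> Hh; elim: s => [|i s IH].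
  by under eq_fun do rewrite big_nil.
by under eq_fun do rewrite big_cons; exact: H'_lin.
Qed.

Let half (p : sym R d * R) X : bool := p.2 < \tr ((p.1 : 'M[R]_d) *m X).

Let halves (s : seq (sym R d * R)) X : bool := all (half^~ X) s.

(** The factor [lexp T0] makes the induction close: the binomial expansion of the power in
    [cvg_threshold] multiplies by exponentials of multiples of T, and these are absorbed into T0. *)
Let H'_halves s T0 : (forall p, p \in s -> possemidef p.1) -> possemidef T0 ->
  H' (fun X => lexp T0 X * (halves s X)%:R).
Proof.
elim: s T0 => [|[T a] s IH] T0 sp T0p.
  apply: (@H'_ext (lexp T0)) => [X _|]; first by rewrite mulr1.
  by split; [apply: bmf_lexp|apply: Hexp].
have {}IH S : possemidef S -> H' (fun X => lexp S X * (halves s X)%:R).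
  by move=> Sp; apply: IH => // p ps; apply: sp; rewrite inE ps orbT.
have Tp : possemidef T by apply: (sp (T, a)); rewrite mem_head.
have tr0 X : posdef X -> 0 <= \tr ((T : 'M[R]_d) *m X).
  by move=> Xp; apply: mxtrace_psd => //; exact: posdefW.
have le1 S (b : bool) X : possemidef S -> posdef X -> `|lexp S X * b%:R| <= 1.
  move=> Sp Xp; rewrite ger0_norm ?mulr_ge0 ?lexp_ge0 //.
  by case: b; rewrite ?mulr0 // mulr1 lexp_le1.
have pos b : 0 < b -> H' (fun X => lexp T0 X * (halves ((T, b) :: s) X)%:R).
  move=> b0; pose c := ln 2 / b.
  have c0 : 0 <= c by rewrite divr_ge0 ?ln_ge0 ?ler1n // ltW.
  pose f_ n X := (1 - expR (- (c * \tr ((T : 'M[R]_d) *m X))) ^+ n.+1) ^+ (n.+1 * 2 ^ n.+1)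
     * (lexp T0 X * (halves s X)%:R).
  apply: (@H'_bp f_ _ 1) => [n|n X Xp|X Xp].
  - pose N := (n.+1 * 2 ^ n.+1)%N.
    pose g (i : 'I_N.+1) X := lexp (T0 + (c *+ (n.+1 * i)) *: T) X * (halves s X)%:R.
    apply: (@H'_ext (fun X => \sum_(i < N.+1) ((-1) ^+ i *+ 'C(N, i)) * g i X)); last first.
      apply: H'_sum => i; apply: IH; apply: possemidefD => //; apply: possemidefZ => //.
      by rewrite mulrn_wge0.
    move=> X _; rewrite /f_ exprBn mulr_suml; apply: eq_bigr => i _.
    rewrite /g lexpD expr1n mulr1 -exprM -/(N) !mulrA.
    have -> : lexp ((c *+ (n.+1 * i)) *: T) X =
        expR (- (c * \tr ((T : 'M[R]_d) *m X))) ^+ (n.+1 * i).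
      rewrite -expRM_natl /lexp symmxZ -scalemxAl mxtraceZ; congr expR.
      by rewrite -mulr_natl; ring.
    by rewrite -[in LHS]mulr_natr -[in RHS]mulr_natr; ring.
  - rewrite normrM; rewrite -[leRHS]mulr1 ler_pM ?le1 // normrX exprn_ile1 //.
    rewrite ger0_norm ?gerBl ?subr_ge0 ?exprn_ge0 ?expR_ge0 //.
    by rewrite exprn_ile1 ?expR_ge0 // -expR0 ler_expR oppr_le0 mulr_ge0 ?tr0.
  rewrite [X in _ --> X](_ : _ = (b < \tr ((T : 'M[R]_d) *m X))%R%:R * (lexp T0 X * (halves s X)%:R)).
    by apply: cvgM; [apply: cvg_threshold => //; exact: tr0|exact: cvg_cst].
  by rewrite /halves /= /half /=; case: (b < _) => /=; rewrite ?mul1r // mul0r mulr0.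
have [a0|a0|a0] := ltgtP a 0.
- apply: H'_ext (IH _ T0p) => X Xp.
  by rewrite /halves /= /half /= (lt_le_trans a0 (tr0 _ Xp)).
- exact: pos.
(* [cvg_threshold] requires a positive threshold; the threshold 0 is approached from above by
   1/(n+1). *)
apply: (@H'_bp (fun n X => lexp T0 X * (halves ((T, n.+1%:R^-1) :: s) X)%:R) _ 1).
- by move=> n; apply: pos; rewrite invr_gt0.
- by move=> n X Xp; exact: le1.
move=> X Xp; apply: cvgM; first exact: cvg_cst.
rewrite /halves /= /half a0 /=; case: ltP => [x0|x0].
  apply: cvg_near_cst; have := near_infty_natSinv_lt (PosNum x0).
  by apply: filterS => n /= ->.
apply: cvg_near_cst; apply: nearW => n.
by rewrite ltNge (le_trans x0).
Qed.

Let G : set (set (symB R d)) :=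
  [set A | exists2 s, forall p, p \in s -> possemidef p.1 & A = [set X | halves s X]].

Let GI : setI_closed G.
Proof.
move=> _ _ [s sp ->] [s' sp' ->]; exists (s ++ s').
  by move=> p; rewrite mem_cat => /orP[/sp|/sp'].
by apply/seteqP; split => X /=; rewrite /halves all_cat => /andP.
Qed.

Let measurable_half_lt T x : possemidef T ->
  measurable ([set X | x < \tr ((T : 'M[R]_d) *m X)] : set (g_sigma_algebraType G)).
Proof.
move=> Tp; apply: sub_sigma_algebra; exists [:: (T, x)].
  by move=> p; rewrite inE => /eqP ->.
by apply/seteqP; split => X /=; rewrite /halves /= andbT.
Qed.

(** The half spaces given by squares u u^T make all quadratic forms of X measurable, and
    polarization recovers the entries. *)
Let measurableG : @measurable _ (symB R d) = <<s G>>.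
Proof.
apply/seteqP; split.
  have mid : measurable_fun setT (id : g_sigma_algebraType G -> symB R d).
    have mq u : measurable_fun setT
        (fun X : g_sigma_algebraType G => bform (X : sym R d) u u).
      apply: (measurability _ (RGenOInfty.measurableE R)) => _ [_ [x ->] <-].
      rewrite setTI; suff -> : (fun X : g_sigma_algebraType G => bform (X : sym R d) u u) @^-1` `]x, +oo[ =
          [set X : g_sigma_algebraType G | x < \tr ((rank1 u : 'M[R]_d) *m (X : sym R d))].
        by apply: measurable_half_lt; exact: rank1_ge0.
      by apply/seteqP; split => X /=; rewrite in_itv /= andbT mxtrace_mulC mxtrace_rank1.
    apply: measurable_sym => i j.
    rewrite (_ : (fun z : g_sigma_algebraType G => _) = (fun X : g_sigma_algebraType G =>
      2^-1 * (bform (X : sym R d) (delta_mx i 0 + delta_mx j 0) (delta_mx i 0 + delta_mx j 0)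
        - bform (X : sym R d) (delta_mx i 0) (delta_mx i 0)
        - bform (X : sym R d) (delta_mx j 0) (delta_mx j 0)))).
      by apply: measurable_funM => //; apply: measurable_funB => //; apply: measurable_funB.
    by apply/funext => X; rewrite qformD !bform_delta; field.
  by move=> A mA; have := mid measurableT A mA; rewrite setTI.
apply: smallest_sub; first exact: sigma_algebra_measurable.
move=> _ [s sp ->]; elim: s sp => [|[T x] s IH] sp.
  by rewrite (_ : [set X | _] = setT) //; apply/seteqP; split.
rewrite (_ : [set X | _] = [set X | x < \tr ((T : 'M[R]_d) *m (X : sym R d))] `&` [set X | halves s X]).
  apply: measurableI; last by apply: IH => p ps; apply: sp; rewrite inE ps orbT.
  rewrite (_ : [set X | _] = setT `&` (fun X : symB R d => \tr ((T : 'M[R]_d) *m (X : sym R d))) @^-1` `]x, +oo[).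
    by apply: measurable_mxtraceM => //; exact: measurable_itv.
  by apply/seteqP; split => X /=; rewrite in_itv /= ?andbT // => -[].
by apply/seteqP; split => X /= /andP.
Qed.

Let H'_indic (A : set (symB R d)) : measurable A -> H' (fun X => (X \in A)%:R).
Proof.
move=> mA; have : <<s G >> A by rewrite -measurableG.
have bd1 (b : bool) : `|b%:R| <= 1 :> R by case: b; rewrite ?normr1 ?normr0.
apply: (@dynkin_induction _ (symB R d) G (fun A => H' (fun X => (X \in A)%:R))) => //.
- by apply: H'_ext H'1 => X _; rewrite mem_set.
- move=> _ [s sp ->]; apply: H'_ext (H'_halves sp (@possemidef0 R d)) => X _.
  rewrite /lexp symmx0 mul0mx mxtrace0 oppr0 expR0 mul1r; congr ((nat_of_bool _)%:R).
  by case E: (halves s X); apply/esym; [apply/mem_set|apply/memNset]; rewrite /= E.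
- move=> S _ HS; apply: H'_ext (H'_lin (-1) HS H'1) => X _.
  by rewrite in_setC; case: (X \in S) => /=; ring.
move=> F mF tF HF; pose B n := \big[setU/set0]_(k < n) F k.
apply: (@H'_bp (fun n X => (X \in B n)%:R) _ 1) => // [n|X Xp].
  elim: n => [|n IH]; first by apply: H'_ext H'0 => X _; rewrite /B big_ord0 in_set0.
  apply: H'_ext (H'_lin 1 IH (HF n)) => X _.
  rewrite /B big_ord_recr in_setU mul1r -/(B n).
  case XB: (X \in B n); case XF: (X \in F n); rewrite /= ?addr0 ?add0r //.
  exfalso; move/set_mem: XB; move/set_mem: XF => Fn; rewrite /B -bigcup_mkord => -[k /= kn Fk].
  have E := tF k n I I (ex_intro _ X (conj Fk Fn)).
  by rewrite E ltnn in kn.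
have [[k _ Fk]|nF] := pselect ((\bigcup_k F k) X).
  apply: cvg_near_cst; exists k.+1 => // n /= kn; congr ((nat_of_bool _)%:R).
  by rewrite !mem_set //; [exists k|rewrite /B -bigcup_mkord; exists k].
apply: cvg_near_cst; apply: nearW => n; congr ((nat_of_bool _)%:R).
rewrite (memNset nF) memNset // /B -bigcup_mkord => -[k _ Fk].
by apply: nF; exists k.
Qed.

Theorem monotone_class g : bmf g -> H g.
Proof.
move=> bg; suff : H' g by case.
have [mg [C gC]] := bg; pose K : R := `|C| + 1.
have K0 : 0 < K by rewrite ltr_wpDl.
have gK X : posdef X -> `|g X| <= K.
  by move=> Xp; rewrite (le_trans (gC _ Xp)) // (le_trans (ler_norm _)) // lerDl.
pose y X := (g X + K) / (2 * K).
have y01 X : posdef X -> 0 <= y X <= 1.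
  move=> Xp; have := gK _ Xp; rewrite ler_norml => /andP[h1 h2].
  by apply/andP; split; [rewrite divr_ge0 ?mulr_ge0 ?(ltW K0) //|
    rewrite ler_pdivrMr ?mulr_gt0 // mul1r]; lra.
suff Hy : H' y.
  apply: (H'_ext _ (H'_lin (2 * K) Hy (H'_lin (- K) H'1 H'0))) => X _.
  by rewrite /y; field; rewrite gt_eqF.
(* [f_ n] is the integer part of (n+1) y divided by n+1, hence uniformly close to y on the cone. *)
pose A n (k : 'I_n.+1) : set (symB R d) := pd `&` [set X | k.+1%:R <= n.+1%:R * y X].
have mA n k : measurable (@A n k).
  have := measurable_posdef; rewrite /A => mpd.
  have my : measurable_fun pd (fun X => n.+1%:R * y X).
    apply: measurable_funM => //; apply: measurable_funM => //.
    by apply: measurable_funD.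
  rewrite (_ : [set X | _] = (fun X => n.+1%:R * y X) @^-1` `[k.+1%:R, +oo[).
    by apply: my => //; exact: measurable_itv.
  by apply/seteqP; split => X /=; rewrite in_itv /= andbT.
pose f_ n X : R := \sum_(k < n.+1) n.+1%:R^-1 * (X \in @A n k)%:R.
have f_y n X : posdef X -> `|f_ n X - y X| <= n.+1%:R^-1.
  move=> Xp; have n0 : n.+1%:R != 0 :> R by rewrite pnatr_eq0.
  have -> : f_ n X - y X = n.+1%:R^-1 *
      (\sum_(k < n.+1) (k.+1%:R <= n.+1%:R * y X)%R%:R - n.+1%:R * y X).
    rewrite mulrBr mulKf // mulr_sumr; congr (_ - _); apply: eq_bigr => k _.
    congr (_ * (nat_of_bool _)%:R); case E: (k.+1%:R <= _); last first.
      by apply/memNset => -[_] /=; rewrite E.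
    by apply/mem_set; split.
  rewrite normrM ger0_norm // -[leRHS]mulr1 ler_wpM2l // sum_nat_threshold //.
  have /andP[h1 h2] := y01 _ Xp.
  by rewrite mulr_ge0 //= -[leRHS]mulr1 ler_wpM2l.
apply: (@H'_bp f_ _ 2) => [n|n X Xp|X Xp].
- by apply: H'_sum => k; exact: H'_indic.
- have := f_y n _ Xp; have /andP[h1 h2] := y01 _ Xp.
  have : n.+1%:R^-1 <= 1 :> R by rewrite invf_le1 // ler1n.
  move: (n.+1%:R^-1) (f_ n X) (y X) h1 h2 => a b c h1 h2 h3.
  by rewrite !ler_norml => /andP[h4 h5]; apply/andP; split; lra.
apply/(@cvgrPdist_le _ R^o) => e e0.
have := near_infty_natSinv_lt (PosNum e0); apply: filterS => n /= ne.
by rewrite distrC (le_trans (f_y n _ Xp)) // ltW.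
Qed.

End MonotoneClassTheorem.

(** * Bounded functionals and operators on functions of the cone *)

Section RintegralBounded.
Context {dZ} {Z : measurableType dZ} {R : realType}.
Variables (mu : {measure set Z -> \bar R}) (D : set Z).
Hypothesis mD : measurable D.

Lemma Rintegral_cvg (G : Z -> R) (f_ : nat -> Z -> R) (f : Z -> R) :
  mu.-integrable D (EFin \o G) ->
  (forall n, measurable_fun D (f_ n)) ->
  (forall n z, D z -> `|f_ n z| <= G z) ->
  (forall z, D z -> f_ ^~ z @ \oo --> f z) ->
  \int[mu]_(z in D) f_ n z @[n --> \oo] --> \int[mu]_(z in D) f z.
Proof.
move=> iG mf fG ff.
have mf' n : measurable_fun D (EFin \o f_ n) by exact/measurable_EFinP.
have mg : measurable_fun D (EFin \o f).
  by apply/measurable_EFinP; exact: (measurable_fun_cvg mf ff).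
have ff' : {ae mu, forall z, D z -> (fun n => (f_ n z)%:E) @ \oo --> (f z)%:E}.
  by apply: aeW => z Dz; apply: cvg_EFin; [exact: nearW|exact: ff].
have fG' : {ae mu, forall z n, D z -> (`|(f_ n z)%:E| <= (G z)%:E)%E}.
  by apply: aeW => z n Dz; rewrite lee_fin; exact: fG.
have [fi _ cv] := dominated_convergence mD mf' mg ff' iG fG'.
apply: fine_cvg; rewrite fineK //.
exact: integrable_fin_num.
Qed.

Hypothesis muD : (mu D < +oo)%E.

Lemma integrable_bounded (f : Z -> R) (C : R) : measurable_fun D f ->
  (forall z, D z -> `|f z| <= C) -> mu.-integrable D (EFin \o f).
Proof.
move=> mf fC; apply: (@le_integrable _ _ _ mu D mD _ (EFin \o cst C)).
- exact/measurable_EFinP.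
- by move=> z Dz; rewrite /= lee_fin (le_trans (fC _ Dz)) // ler_norm.
- apply/integrableP; split; first exact/measurable_EFinP.
  under eq_integral do rewrite /=; rewrite integral_cst //.
  by rewrite lte_mul_pinfty.
Qed.

Lemma ler_norm_Rintegral (f : Z -> R) (C : R) : measurable_fun D f ->
  (forall z, D z -> `|f z| <= C) -> `|\int[mu]_(z in D) f z| <= C * fine (mu D).
Proof.
move=> mf fC; rewrite (le_trans (le_normr_Rintegral mD _)) //.
  exact: integrable_bounded mf fC.
rewrite -Rintegral_cst //; apply: le_Rintegral => //.
- apply: (@integrable_bounded _ C); first exact: measurableT_comp.
  by move=> z Dz; rewrite normr_id fC.
- by apply: (@integrable_bounded _ `|C|).
Qed.

End RintegralBounded.

Section BoundedFunctionals.
Variables (R : realType) (d : nat).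
Implicit Types (S T W X Y : sym R d) (f g : symB R d -> R) (rho : (symB R d -> R) -> R).
Local Notation pd := (@posdef R d : set (symB R d)).

(** A bounded signed measure on the cone, seen only through its action on functions. The class is
    closed under composition, mixing and linear combination without any measure being
    constructed. *)
Record bpl (B : R) rho : Prop := Bpl {
  bpl_ext : forall f g, (forall X, posdef X -> f X = g X) -> rho f = rho g;
  bpl_lin : forall a f g, bmf f -> bmf g ->
    rho (fun X => a * f X + g X) = a * rho f + rho g;
  bpl_cvg : forall (f_ : nat -> symB R d -> R) f (C : R), (forall n, bmf (f_ n)) ->
    (forall n X, posdef X -> `|f_ n X| <= C) ->
    (forall X, posdef X -> f_ ^~ X @ \oo --> f X) -> rho (f_ n) @[n --> \oo] --> rho f;
  bpl_bound : forall f (C : R), bmf f -> (forall X, posdef X -> `|f X| <= C) ->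
    `|rho f| <= B * C }.

Lemma bplZ B rho a f : bpl B rho -> bmf f -> rho (fun X => a * f X) = a * rho f.
Proof.
move=> rb bf; have r0 : rho (fun=> 0) = 0.
  have := bpl_lin rb (-1) (bmf_cst _ 0) (bmf_cst _ 0).
  rewrite (_ : (fun X => -1 * 0 + 0) = fun=> 0); first by move=> ->; ring.
  by apply/funext => X; ring.
rewrite -[RHS]addr0 -r0 -(bpl_lin rb) //; last exact: bmf_cst.
by congr rho; apply/funext => X; rewrite addr0.
Qed.

Lemma bpl0 B rho : bpl B rho -> rho (fun=> 0) = 0.
Proof.
move=> rb; rewrite -[RHS](mul0r (rho (fun=> 0))) -(bplZ _ rb) ?mulr0 //.
exact: bmf_cst.
Qed.

Lemma bplD B rho f g : bpl B rho -> bmf f -> bmf g ->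
  rho (fun X => f X + g X) = rho f + rho g.
Proof.
move=> rb bf bg; rewrite -[rho f]mul1r -(bpl_lin rb) //.
by congr rho; apply/funext => X; rewrite mul1r.
Qed.

Lemma bpl_sum B rho (I : Type) (s : seq I) (c : I -> R) (h : I -> symB R d -> R) :
  bpl B rho -> (forall i, bmf (h i)) ->
  rho (fun X => \sum_(i <- s) c i * h i X) = \sum_(i <- s) c i * rho (h i).
Proof.
move=> rb bh; elim: s => [|i s IH].
  by under eq_fun do rewrite big_nil; rewrite big_nil (bpl0 rb).
under eq_fun do rewrite big_cons; rewrite big_cons -IH -(bpl_lin rb) //.
by apply: bmf_sum => j; exact: bmfZ.
Qed.

Theorem bpl_unique B B' rho rho' : bpl B rho -> bpl B' rho' ->
  (forall T, possemidef T -> rho (lexp T) = rho' (lexp T)) ->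
  forall g, bmf g -> rho g = rho' g.
Proof.
move=> rb rb' E; apply: monotone_class => //; split => [f g fg fE|a f g bf bg fE gE|f_ f C bf fE fC ff].
- by rewrite -(bpl_ext rb fg) -(bpl_ext rb' fg).
- by rewrite (bpl_lin rb) // (bpl_lin rb') // fE gE.
have := bpl_cvg rb' bf fC ff; rewrite -(eq_cvg _ _ fE) => h.
have h' := bpl_cvg rb bf fC ff.
exact: (cvg_unique _ h' h).
Qed.

Section Family.
Context {dZ} {Z : measurableType dZ}.
Variables (D : set Z) (kappa : Z -> (symB R d -> R) -> R).
Hypothesis mD : measurable D.

(** The substitute for a measurability axiom on the kernel: dependence on the parameter needs
    checking on exponentials only. *)
Theorem bpl_measurable : (forall z, D z -> exists B, bpl B (kappa z)) ->
  (forall T, possemidef T -> measurable_fun D (fun z => kappa z (lexp T))) ->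
  forall g, bmf g -> measurable_fun D (fun z => kappa z g).
Proof.
move=> kb mexp; apply: monotone_class => //; split => [f g fg mf|a f g bf bg mf mg|f_ f C bf mf fC ff].
- apply: eq_measurable_fun mf => z /set_mem Dz.
  by have [B kB] := kb z Dz; exact: bpl_ext kB _ _ fg.
- apply: (@eq_measurable_fun _ _ _ _ _ (fun z => a * kappa z f + kappa z g)).
    by move=> z /set_mem Dz; have [B kB] := kb z Dz; rewrite (bpl_lin kB).
  by apply: measurable_funD => //; exact: measurable_funM.
apply: (measurable_fun_cvg mf) => z Dz.
by have [B kB] := kb z Dz; exact: bpl_cvg kB _ _ _ bf fC ff.
Qed.

Lemma bpl_integral B (mu : {measure set Z -> \bar R}) : 0 <= B -> (mu D < +oo)%E ->
  (forall z, D z -> bpl B (kappa z)) ->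
  (forall g, bmf g -> measurable_fun D (fun z => kappa z g)) ->
  bpl (B * fine (mu D)) (fun g => \int[mu]_(z in D) kappa z g).
Proof.
move=> B0 muD kb mk.
have kB f z : bmf f -> exists C, forall z, D z -> `|kappa z f| <= B * C.
  by move=> bf; have [_ [C fC]] := bf; exists C => z' Dz; exact: bpl_bound (kb _ Dz) _ _ bf fC.
have ik f : bmf f -> mu.-integrable D (EFin \o (fun z => kappa z f)).
  move=> bf; have [_ [C fC]] := bf.
  apply: (@integrable_bounded _ _ _ mu D mD muD _ (B * C)); first exact: mk.
  by move=> z Dz; exact: bpl_bound (kb _ Dz) _ _ bf fC.
split => [f g fg|a f g bf bg|f_ f C bf fC ff|f C bf fC].
- by apply: eq_Rintegral => z /set_mem Dz; exact: bpl_ext (kb _ Dz) _ _ fg.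
- rewrite -RintegralZl //; last exact: ik.
  rewrite -RintegralD //; first last.
  + exact: ik.
  + by have := integrableZl mD a (ik _ bf); under eq_fun do rewrite /= -EFinM.
  by apply: eq_Rintegral => z /set_mem Dz; rewrite (bpl_lin (kb _ Dz)).
- apply: (@Rintegral_cvg _ _ _ mu D mD (fun=> B * C)).
  + by apply: (@integrable_bounded _ _ _ mu D mD muD _ `|B * C|).
  + by move=> n; exact: mk.
  + by move=> n z Dz; exact: bpl_bound (kb _ Dz) _ _ (bf n) (fC n).
  + by move=> z Dz; exact: bpl_cvg (kb _ Dz) _ _ _ bf fC ff.
- rewrite mulrAC; apply: ler_norm_Rintegral => //; first exact: mk.
  by move=> z Dz; exact: bpl_bound (kb _ Dz) _ _ bf fC.
Qed.

End Family.

Lemma bpl_eval X : posdef X -> bpl 1 (fun g => g X).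
Proof.
move=> Xp; split => [f g|//|f_ f C _ _|f C _ fC]; [exact|exact|].
by rewrite mul1r fC.
Qed.

Definition bpop (B : R) (A : (symB R d -> R) -> symB R d -> R) : Prop :=
  (forall X, posdef X -> bpl B (A^~ X)) /\ (forall g, bmf g -> measurable_fun pd (A g)).

Lemma bpop_bmf B A g : bpop B A -> bmf g -> bmf (A g).
Proof.
move=> [Ab mA] bg; split; first exact: mA.
have [_ [C gC]] := bg; exists (B * C) => X Xp.
exact: bpl_bound (Ab _ Xp) _ _ bg gC.
Qed.

Lemma bpl_comp B B' rho A : bpl B rho -> bpop B' A -> bpl (B * B') (fun g => rho (A g)).
Proof.
move=> rb Ab; have [kb mA] := Ab; split => [f g fg|a f g bf bg|f_ f C bf fC ff|f C bf fC].
- by apply: (bpl_ext rb) => X Xp; exact: bpl_ext (kb _ Xp) _ _ fg.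
- rewrite -(bpl_lin rb); [|exact: bpop_bmf Ab _|exact: bpop_bmf Ab _].
  by apply: (bpl_ext rb) => X Xp; rewrite (bpl_lin (kb _ Xp)).
- apply: (@bpl_cvg _ _ rb _ _ (B' * C)) => [n|n X Xp|X Xp].
  + exact: bpop_bmf Ab _.
  + exact: bpl_bound (kb _ Xp) _ _ (bf n) (fC n).
  + exact: bpl_cvg (kb _ Xp) _ _ _ bf fC ff.
- rewrite -mulrA; apply: (bpl_bound rb); first exact: bpop_bmf Ab _.
  by move=> X Xp; exact: bpl_bound (kb _ Xp) _ _ bf fC.
Qed.

Lemma bpop_comp B B' A A' : bpop B A -> bpop B' A' -> bpop (B * B') (fun g => A (A' g)).
Proof.
move=> Ab Ab'; split => [X Xp|g bg].
  by have := bpl_comp (Ab.1 _ Xp) Ab'.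
by apply: Ab.2; exact: bpop_bmf Ab' _.
Qed.

Lemma bpop_id : bpop 1 id.
Proof. by split => [X Xp|g []]; [exact: bpl_eval|]. Qed.

Lemma bplD_closed B B' rho rho' a : bpl B rho -> bpl B' rho' ->
  bpl (`|a| * B + B') (fun g => a * rho g + rho' g).
Proof.
move=> rb rb'; split => [f g fg|b f g bf bg|f_ f C bf fC ff|f C bf fC].
- by rewrite (bpl_ext rb fg) (bpl_ext rb' fg).
- by rewrite (bpl_lin rb) // (bpl_lin rb') //; ring.
- apply: cvgD; last exact: bpl_cvg rb' _ _ _ bf fC ff.
  by apply: cvgM; [exact: cvg_cst|exact: bpl_cvg rb _ _ _ bf fC ff].
- rewrite mulrDl (le_trans (ler_normD _ _)) // lerD ?(bpl_bound rb') //.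
  by rewrite normrM -mulrA ler_wpM2l // (bpl_bound rb).
Qed.

Lemma bplZ_closed B rho a : bpl B rho -> bpl (`|a| * B) (fun g => a * rho g).
Proof.
move=> rb; split => [f g fg|b f g bf bg|f_ f C bf fC ff|f C bf fC].
- by rewrite (bpl_ext rb fg).
- by rewrite (bpl_lin rb) //; ring.
- by apply: cvgM; [exact: cvg_cst|exact: bpl_cvg rb _ _ _ bf fC ff].
- by rewrite normrM -mulrA ler_wpM2l // (bpl_bound rb).
Qed.

End BoundedFunctionals.

(** * Elimination of constant-coefficient derivatives *)

Section Lines.
Variables (R : realType) (d : nat).
Implicit Types (S T V W X Y : sym R d) (f g : sym R d -> R).

Lemma is_derive_line f X V (y df : R) : is_derive (X + y *: V) V f df ->
  is_derive (y : R^o) (1 : R^o) (fun t : R^o => f (X + t *: V) : R^o) df.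
Proof.
move=> [fd fv].
have E : (fun h : R => h^-1 *: (((fun t : R^o => f (X + t *: V) : R^o) \o shift y) (h *: (1 : R^o)) - f (X + y *: V))) =
    (fun h : R => h^-1 *: ((f \o shift (X + y *: V)) (h *: V) - f (X + y *: V))).
  apply/funext => h; congr (_ *: (f _ - _)) => /=.
  by rewrite scaler1 scalerDl addrCA.
by split; [rewrite /derivable E|rewrite /derive E].
Qed.

Lemma is_derive_line_inv f X V (df : R) :
  is_derive (0 : R^o) (1 : R^o) (fun t : R^o => f (X + t *: V) : R^o) df ->
  is_derive X V f df.
Proof.
move=> [fd fv].
have E : (fun h : R => h^-1 *: ((f \o shift X) (h *: V) - f X)) =
    (fun h : R => h^-1 *: (((fun t : R^o => f (X + t *: V) : R^o) \o shift 0) (h *: (1 : R^o)) - f (X + 0 *: V))).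
  apply/funext => h; congr (_ *: (f _ - f _)) => /=; last by rewrite scale0r addr0.
  by rewrite addr0 scaler1 addrC.
by split; [rewrite /derivable E|rewrite /derive E].
Qed.

Lemma continuous_line X V : continuous (fun t : R => X + t *: V).
Proof.
move=> t; apply: (@cvgD R (sym R d)); first exact: cvg_cst.
by apply: cvgZl; exact: cvg_id.
Qed.

Lemma posdef_line X V (a : R) : posdef X -> posdef (X + a *: V) ->
  forall t, t \in `[0, a] -> posdef (X + t *: V).
Proof.
move=> Xp Xap t; rewrite in_itv /= => /andP[t0 ta].
have [t00|tn0] := eqVneq t 0; first by rewrite t00 scale0r addr0.
have tp : 0 < t by rewrite lt_neqAle eq_sym tn0.
have ap : 0 < a by exact: lt_le_trans ta.
have -> : X + t *: V = (t / a) *: (X + a *: V) + (1 - t / a) *: X.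
  rewrite scalerDr scalerA divfK ?gt_eqF // addrAC -scalerDl.
  by rewrite (_ : t / a + (1 - t / a) = 1) ?scale1r //; ring.
apply: posdefD; first by apply: posdefZ => //; rewrite divr_gt0.
apply: possemidefZ; last exact: posdefW.
by rewrite subr_ge0 ler_pdivrMr // mul1r.
Qed.

Lemma line_FTC f (df : sym R d -> R) X V (a : R) : 0 < a ->
  (forall t, t \in `[0, a] -> is_derive (X + t *: V) V f (df (X + t *: V))) ->
  (forall t, t \in `[0, a] -> {for t, continuous (fun t : R => df (X + t *: V))}) ->
  \int[lebesgue_measure]_(t in `[0, a]) df (X + t *: V) = f (X + a *: V) - f X.
Proof.
move=> a0 fd dfc.
pose F := fun t : R^o => f (X + t *: V) : R^o.
have Fd t : t \in `[0, a] -> is_derive (t : R^o) 1 F (df (X + t *: V)).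
  by move=> t0a; apply: is_derive_line; exact: fd.
have Fc t : t \in `[0, a] -> {for t, continuous F}.
  move=> t0a; apply: differentiable_continuous; apply/derivable1_diffP.
  by have [] := Fd t t0a.
rewrite /Rintegral (@continuous_FTC2 _ (fun t => df (X + t *: V)) F 0 a a0) //.
- by rewrite /F scale0r addr0.
- apply: continuous_in_subspaceT => t; rewrite inE => /= t0a; exact: dfc.
- split.
  + by move=> t /subset_itv_oo_cc t0a; have [] := Fd t t0a.
  + by apply: cvg_at_right_filter; apply: Fc; rewrite in_itv /= lexx ltW.
  + by apply: cvg_at_left_filter; apply: Fc; rewrite in_itv /= lexx ltW.
- move=> t /subset_itv_oo_cc t0a; rewrite derive1E.
  by have [_ ->] := Fd t t0a.
Qed.

Lemma is_derive_lexp T X V :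
  is_derive X V (lexp T) (- \tr ((T : 'M[R]_d) *m V) * lexp T X).
Proof.
apply: is_derive_line_inv.
have -> : (fun t : R^o => lexp T (X + t *: V) : R^o) =
    (fun t : R^o => expR (- \tr ((T : 'M[R]_d) *m X) + t * (- \tr ((T : 'M[R]_d) *m V)))).
  apply/funext => t; rewrite /lexp symmxD symmxZ mulmxDr -scalemxAr mxtraceD mxtraceZ.
  by congr expR; rewrite opprD mulrN.
rewrite mulrC; apply: is_derive_eq.
by rewrite mul0r addr0 scaler0 add0r scaler1 !add0r mul1r.
Qed.

End Lines.

Section Smoothing.
Variables (R : realType) (d : nat).
Implicit Types (S T V W X Y : sym R d) (f g : symB R d -> R) (p : 'I_d * 'I_d) (e t : R).
Local Notation pd := (@posdef R d : set (symB R d)).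
Local Notation leb := (@lebesgue_measure R).

Lemma bform_delta_mx i j (x y : 'cV[R]_d) : bform (delta_mx i j) x y = x i 0 * y j 0.
Proof.
rewrite -(mul_delta_mx (0 : 'I_1)) -(trmx_delta _ j 0) bform_rank1.
by rewrite dot_sym !trmx_delta -!rowE !mxE.
Qed.

Lemma sym1_coord_ge0 p : possemidef (sym1 R d + coord_dir R p).
Proof.
rewrite possemidefE => x; rewrite symmxD bformD bform1 /= /coord_mx.
under eq_bigr do rewrite -expr2.
case: ifPn => [/eqP <-|ij].
  by rewrite bform_delta_mx -expr2 addr_ge0 ?sqr_ge0 // sumr_ge0 // => k _; rewrite sqr_ge0.
rewrite bformD !bform_delta_mx (bigD1 p.1) //= (bigD1 p.2) ?(eq_sym p.2) //=.
have : 0 <= \sum_(i | (i != p.1) && (i != p.2)) x i 0 ^+ 2.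
  by apply: sumr_ge0 => k _; rewrite sqr_ge0.
have := sqr_ge0 (x p.1 0 + x p.2 0); nra.
Qed.

(** E_ij + E_ji is not nonnegative, but 1 + E_ij + E_ji is. The shift by e times the identity
    therefore keeps the whole segment, t from 0 to e, inside the cone. *)
Definition nudge e p t X : sym R d := X + e *: sym1 R d + t *: coord_dir R p.

Lemma posdef_nudge e p t X : posdef X -> t \in `[0, e] -> posdef (nudge e p t X).
Proof.
rewrite in_itv /= => Xp /andP[t0 te].
have -> : nudge e p t X = X + ((e - t) *: sym1 R d + t *: (sym1 R d + coord_dir R p)).
  by rewrite /nudge scalerDr [RHS]addrA [RHS]addrA -[in RHS](addrA X) -scalerDl subrK.
apply: posdefD => //; apply: possemidefD; apply: possemidefZ; rewrite ?subr_ge0 //.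
  exact/posdefW/posdef1.
exact: sym1_coord_ge0.
Qed.

Lemma measurable_bmf_comp {dZ} {Z : measurableType dZ} (D : set Z) (phi : Z -> symB R d) g :
  measurable D -> (forall z, D z -> posdef (phi z)) ->
  (forall i j, measurable_fun D (fun z => (phi z : sym R d) i j)) ->
  bmf g -> measurable_fun D (fun z => g (phi z)).
Proof.
move=> mD Dp mphi [mg _]; apply: (measurable_comp (F := pd)) mg _.
- exact: measurable_posdef.
- by move=> _ [z Dz <-]; exact: Dp.
- exact: measurable_sym.
Qed.

Lemma lexp_nudge T e p t X : lexp T (nudge e p t X) = lexp T X * lexp T (nudge e p t 0).
Proof.
rewrite /lexp -expRD -opprD -mxtraceD -mulmxDr; congr (expR (- \tr (_ *m _))).
by rewrite /nudge add0r -addrA !symmxD.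
Qed.

Lemma measurable_line X V D i j :
  measurable_fun D (fun t : R => (X + t *: V : sym R d) i j).
Proof.
under eq_fun do rewrite symmxD symmxZ !mxE.
by apply: measurable_funD => //; apply: measurable_funM.
Qed.

Definition average e p g X : R := e^-1 * \int[leb]_(t in `[0, e]) g (nudge e p t X).

(** The [average] of the derivative of g over the same segment. On [lexp T] both operators act by
    constants, and the constants differ by exactly the factor [weight T p]. *)
Definition diffquot e p g X : R := e^-1 * (g (nudge e p e X) - g (nudge e p 0 X)).

Section FixedStep.
Variables (e : R) (p : 'I_d * 'I_d).
Hypothesis e0 : 0 < e.

Let leb_e : leb `[0, e] = e%:E.
Proof. by rewrite lebesgue_measure_itv /= lte_fin e0 -EFinB subr0. Qed.

Let leb_fin : (leb `[0%R, e]%classic < +oo)%E.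
Proof. by rewrite leb_e ltry. Qed.

Let measurable_nudge g X : bmf g -> posdef X ->
  measurable_fun `[0, e] (fun t => g (nudge e p t X)).
Proof.
move=> bg Xp; apply: measurable_bmf_comp => // [t /= te|i j].
  exact: posdef_nudge.
exact: measurable_line.
Qed.

Let bpl_average X : posdef X -> bpl 1 ((average e p)^~ X).
Proof.
move=> Xp.
have ev t : t \in `[0, e] -> bpl 1 (fun g => g (nudge e p t X)).
  by move=> te; exact/bpl_eval/posdef_nudge.
have h := @bpl_integral R d _ (measurableTypeR R) `[0, e]%classic (fun t g => g (nudge e p t X))
  (measurable_itv _) 1 leb ler01 leb_fin ev (fun g bg => measurable_nudge bg Xp).
have := bplZ_closed e^-1 h.
have -> : `|e^-1| * (1 * fine (leb `[0%R, e]%classic)) = 1; last by [].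
by rewrite leb_e mul1r ger0_norm ?invr_ge0 ?ltW // mulVf // gt_eqF.
Qed.

Definition average_lexp T : R := e^-1 * \int[leb]_(t in `[0, e]) lexp T (nudge e p t 0).

Lemma averageE T X : possemidef T -> posdef X ->
  average e p (lexp T) X = average_lexp T * lexp T X.
Proof.
move=> Tp Xp; rewrite /average /average_lexp -mulrA; congr (_ * _).
rewrite mulrC -RintegralZl //; first by apply: eq_Rintegral => t _; rewrite lexp_nudge.
apply: (@integrable_bounded _ _ _ _ _ _ _ _ ((lexp T X)^-1)) => //.
- have := measurable_nudge (bmf_lexp Tp) Xp.
  have l0 : lexp T X != 0 by rewrite gt_eqF ?expR_gt0.
  move=> /(measurable_funM (measurable_cst ((lexp T X)^-1))).
  by apply: eq_measurable_fun => t _ /=; rewrite lexp_nudge mulKf.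
- move=> t te; rewrite ger0_norm ?lexp_ge0 //.
  rewrite -[leLHS](mulKf (_ : lexp T X != 0)) ?gt_eqF ?expR_gt0 // -lexp_nudge.
  rewrite -[leRHS]mulr1 ler_wpM2l ?invr_ge0 ?lexp_ge0 // lexp_le1 //.
  exact: posdef_nudge.
Qed.

Lemma bpop_average : bpop 1 (average e p).
Proof.
split=> [|g bg]; first exact: bpl_average.
apply: (@bpl_measurable R d _ (symB R d) pd (fun X g => average e p g X)) bg => //.
- by move=> X Xp; exists 1; exact: bpl_average.
move=> T Tp; apply: (@eq_measurable_fun _ _ (symB R d) _ pd (fun X => average_lexp T * lexp T X)).
  by move=> X /set_mem Xp; rewrite averageE.
by have [] := bmfZ (average_lexp T) (bmf_lexp Tp).
Qed.

Lemma bpop_diffquot : exists B, bpop B (diffquot e p).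
Proof.
have ev t : t \in `[0, e] -> bpop 1 (fun g X => g (nudge e p t X)).
  move=> te; split=> [X Xp|g bg]; first exact/bpl_eval/posdef_nudge.
  apply: measurable_bmf_comp => //; first exact: measurable_posdef.
    by move=> X Xp; exact: posdef_nudge.
  move=> i j; rewrite /nudge; under eq_fun do rewrite !symmxD !mxE.
  apply: measurable_funD => //; apply: measurable_funD => //; exact: measurable_entry.
have e1 : e \in `[0, e] by rewrite in_itv /= lexx ltW.
have e2 : 0 \in `[0, e] by rewrite in_itv /= lexx ltW.
exists (`|e^-1| * (`|-1| * 1 + 1)); split=> [X Xp|g bg].
  rewrite /diffquot; apply: bplZ_closed.
  have := bplD_closed (-1) ((ev _ e2).1 X Xp) ((ev _ e1).1 X Xp).
  by under eq_fun do rewrite mulN1r addrC.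
apply: measurable_funM => //; apply: measurable_funB.
  exact: (ev _ e1).2.
exact: (ev _ e2).2.
Qed.

Lemma average_FTC f (df : sym R d -> R) X : posdef X ->
  (forall Y, posdef Y -> is_derive Y (coord_dir R p) f (df Y)) ->
  (forall Y, posdef Y -> {for Y, continuous df}) ->
  average e p df X = diffquot e p f X.
Proof.
move=> Xp fd dfc; rewrite /average /diffquot; congr (_ * _).
have fd' t : t \in `[0, e] -> is_derive (X + e *: sym1 R d + t *: coord_dir R p) (coord_dir R p)
    f (df (X + e *: sym1 R d + t *: coord_dir R p)).
  by move=> te; apply: fd; exact: posdef_nudge.
rewrite /nudge (line_FTC e0 fd') ?scale0r ?addr0 // => t te.
apply: continuous_comp; first exact: continuous_line.
by apply: dfc; exact: posdef_nudge.
Qed.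

End FixedStep.

End Smoothing.

Lemma cvg_bigsum (R : realType) {T : Type} {F : set_system T} {FF : Filter F}
    (I : Type) (r : seq I) (f : I -> T -> R) (l : I -> R) :
  (forall i, f i @ F --> l i) ->
  (fun x => \sum_(i <- r) f i x) @ F --> \sum_(i <- r) l i.
Proof.
move=> fl; elim: r => [|i r IH].
  by under eq_fun do rewrite big_nil; rewrite big_nil; exact: cvg_cst.
by under eq_fun do rewrite big_cons; rewrite big_cons; exact: cvgD.
Qed.

Section Elimination.
Variables (R : realType) (d : nat).
Implicit Types (S T V W X Y : sym R d) (f g h : symB R d -> R) (p : 'I_d * 'I_d) (e t : R).
Local Notation pd := (@posdef R d : set (symB R d)).
Local Notation leb := (@lebesgue_measure R).

(** The eigenvalue of the partial derivative along [coord_dir R p] on the eigenfunction [lexp T]. *)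
Definition weight T p : R := - \tr ((T : 'M[R]_d) *m coord_dir R p).

Definition weights T (s : seq ('I_d * 'I_d)) : R := \prod_(p <- s) weight T p.

Lemma continuous_mxtraceM T : continuous (fun X : sym R d => \tr ((T : 'M[R]_d) *m X)).
Proof.
have -> : (fun X : sym R d => \tr ((T : 'M[R]_d) *m X)) =
    (fun X => \sum_i \sum_j (T : 'M[R]_d) i j * X j i) by apply/funext => X; rewrite mxtraceM_sum.
move=> X.
apply: (@cvg_bigsum _ _ (nbhs X) (nbhs_filter X)) => i.
apply: (@cvg_bigsum _ _ (nbhs X) (nbhs_filter X)) => j.
by apply: (@cvgM _ _ (nbhs X) (nbhs_filter X)); [exact: cvg_cst|exact: continuous_entry].
Qed.

Lemma continuous_lexp T : continuous (lexp T : sym R d -> R).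
Proof.
move=> X; apply: (cvg_comp (fun X : sym R d => - \tr ((T : 'M[R]_d) *m X)) expR).
  by apply: (@cvgN _ _ _ (nbhs X) (nbhs_filter X)); exact: continuous_mxtraceM.
exact: continuous_expR.
Qed.

Lemma diffquot_lexp e p T X : 0 < e -> possemidef T -> posdef X ->
  diffquot e p (lexp T) X = average_lexp e p T * weight T p * lexp T X.
Proof.
move=> e0 Tp Xp.
have dl Y : posdef Y -> is_derive Y (coord_dir R p) (lexp T) (weight T p * lexp T Y).
  by move=> _; exact: is_derive_lexp.
have cl Y : posdef Y -> {for Y, continuous (fun X : sym R d => weight T p * lexp T X)}.
  move=> _; apply: (@cvgM _ _ (nbhs Y) (nbhs_filter Y)); first exact: cvg_cst.
  exact: continuous_lexp.
rewrite -(average_FTC e0 Xp dl cl).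
rewrite (bplZ _ ((bpop_average p e0).1 _ Xp)); last exact: bmf_lexp.
by rewrite averageE // mulrCA mulrA.
Qed.

Lemma fine_leb_itv e : 0 < e -> fine (leb `[0%R, e]%classic) = e.
Proof. by move=> e0; rewrite lebesgue_measure_itv /= lte_fin e0 -EFinB subr0. Qed.

Lemma leb_itv_fin e : (leb `[0%R, e]%classic < +oo)%E.
Proof. by rewrite lebesgue_measure_itv /=; case: ifP => _; rewrite ltry. Qed.

Lemma average_cst e p c X : 0 < e -> average e p (fun=> c) X = c.
Proof.
move=> e0; rewrite /average Rintegral_cst // mulrCA; have := fine_leb_itv e0 => /= E.
by rewrite [X in _ * (_ * X)]E mulVf ?mulr1 // gt_eqF.
Qed.

Lemma cvg_average g p X : bmf g -> posdef X -> {for X, continuous g} ->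
  average n.+1%:R^-1 p g X @[n --> \oo] --> g X.
Proof.
move=> bg Xp /sym_cvgP gc; apply/(@cvgrPdist_le _ R^o) => eta eta0.
have [dl dl0 gdl] := gc _ eta0.
pose N := `|sym1 R d| + `|coord_dir R p| + 1.
have N0 : 0 < N by rewrite ltr_wpDl ?addr_ge0.
have dN : 0 < dl / N by rewrite divr_gt0.
have := near_infty_natSinv_lt (PosNum dN); apply: filterS => n /=.
set e := n.+1%:R^-1; have e0 : 0 < e by rewrite invr_gt0.
move=> edl; rewrite distrC.
have bA := (bpop_average p e0).1 _ Xp.
have -> : average e p g X - g X = average e p (fun Y => g Y + (- g X)) X.
  by rewrite (bplD bA bg (bmf_cst _ _)) average_cst.
rewrite /average normrM ger0_norm ?invr_ge0 ?(ltW e0) // ler_pdivrMl // mulrC.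
rewrite -[X in _ * X](fine_leb_itv e0); apply: ler_norm_Rintegral => //.
- exact: leb_itv_fin.
- apply: (measurable_bmf_comp (D := `[0, e]%classic) (phi := fun t => nudge e p t X) (g := fun Y => g Y + - g X)) => //.
  + by move=> t te; exact: posdef_nudge.
  + exact: measurable_line.
  + by apply: bmfD => //; exact: bmf_cst.
move=> t /=; rewrite in_itv /= => /andP[t0 te]; apply: gdl.
rewrite /nudge -[X + _ + _]addrA [X + _]addrC addrK.
apply: (le_lt_trans (ler_normD _ _)); rewrite !normrZ !ger0_norm ?(ltW e0) //.
apply: (@le_lt_trans _ _ (e * N)); last by rewrite -ltr_pdivlMr.
rewrite /N !mulrDr mulr1 -[leLHS]addr0 lerD ?(ltW e0) // lerD // ler_wpM2r //.
Qed.

Section CbFacts.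
Variables (k : nat) (h : sym R d -> R).
Hypothesis hh : Cb k h.

Lemma Cb_bmf s : (size s <= k)%N -> bmf (pderivs s h).
Proof.
move=> /hh[_ c [C hC]]; split; last by exists C.
exact: measurable_within.
Qed.

Lemma Cb_continuous s X : (size s <= k)%N -> posdef X -> {for X, continuous (pderivs s h)}.
Proof.
move=> /hh[_ + _] Xp; rewrite continuous_open_subspace; last exact: posdef_open.
by apply; rewrite inE.
Qed.

Lemma Cb_derive p s X : (size (p :: s) <= k)%N -> posdef X ->
  is_derive X (coord_dir R p) (pderivs s h) (pderivs (p :: s) h X).
Proof. by move=> /hh[[_ dh] _ _] Xp; apply: DeriveDef => //; exact: dh. Qed.

End CbFacts.

(* Each derivative is traded, one coordinate at a time, for a difference quotient; the other terms are
   averaged over the same step, which keeps the identity on exponentials exact, and the step tends to 0. *)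
Theorem elimination (I : finType) (s : I -> seq ('I_d * 'I_d))
    (rho : I -> (symB R d -> R) -> R) k h :
  Cb k h -> (forall i, (size (s i) <= k)%N) -> (forall i, exists B, bpl B (rho i)) ->
  (forall T, possemidef T -> \sum_i weights T (s i) * rho i (lexp T) = 0) ->
  \sum_i rho i (pderivs (s i) h) = 0.
Proof.
move=> hh; have [n] := ubnP (\sum_i size (s i))%N.
elim: n s rho => // n IH s rho sn sk rb E.
(* With no derivative left, the sum is one functional that vanishes on exponentials, hence
   everywhere by [bpl_unique]. *)
have [/existsP[i0]|/existsPn s0] := boolP [exists i, s i != [::]]; last first.
  have {}s0 i : s i = [::] by apply/eqP; rewrite -[_ == _]negbK s0.
  have -> : \sum_i rho i (pderivs (s i) h) = (fun g => \sum_i rho i g) h.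
    by apply: eq_bigr => i _; rewrite s0.
  have [B bB] : exists B, bpl B (fun g => \sum_i rho i g).
    elim: (index_enum I) => [|i r [B bB]].
      exists 0; split => [f g _|a f g _ _|f_ f C _ _ _|f C _ _].
      + by rewrite !big_nil.
      + by rewrite !big_nil mulr0 addr0.
      + by under eq_fun do rewrite big_nil; rewrite big_nil; exact: cvg_cst.
      + by rewrite big_nil normr0 mul0r.
    have [B' bB'] := rb i; exists (`|1| * B' + B).
    by under eq_fun do rewrite big_cons -[rho i _]mul1r; exact: bplD_closed.
  have := bpl_unique bB (bplZ_closed 0 bB) _ (Cb_bmf (s := [::]) hh isT).
  rewrite mul0r; apply=> T Tp; rewrite mul0r -[RHS](E T Tp); apply: eq_bigr => i _.
  by rewrite s0 /weights big_nil mul1r.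
case s0E : (s i0) => [//|p s0] _.
(* The outermost derivative is removed where it is [p]; all other terms are only averaged. The total
   number of derivatives drops because the term [i0] loses one. *)
pose cut (r : seq ('I_d * 'I_d)) := if r is q :: r' then if q == p then r' else r else [::].
pose hit (r : seq ('I_d * 'I_d)) := if r is q :: _ then q == p else false.
pose op e i g := if hit (s i) then diffquot e p g else average e p g.
have cutE r : r = if hit r then p :: cut r else cut r.
  by case: r => //= q r; case: eqP => // ->.
have opb e i : 0 < e -> exists B, bpop B (op e i).
  move=> e0; rewrite /op; case: (hit _); first exact: bpop_diffquot.
  by exists 1; exact: bpop_average.
have step e : 0 < e -> \sum_i rho i (average e p (pderivs (s i) h)) = 0.
  move=> e0; rewrite -[RHS](IH (fun i => cut (s i)) (fun i g => rho i (op e i g))).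
  - apply: eq_bigr => i _; have [B bB] := rb i; apply: (bpl_ext bB) => X Xp.
    rewrite /op; move: (cutE (s i)) (sk i); case: (hit _) => {1 2}-> sik.
      apply: average_FTC => // Y Yp; last exact: (Cb_continuous hh).
      exact: (Cb_derive hh).
    by [].
  - rewrite -ltnS; apply: leq_trans sn; rewrite ltnS.
    rewrite (bigD1 i0) // [ltnRHS](bigD1 i0) //= -addSn leq_add //.
      by rewrite s0E /= eqxx.
    by apply: leq_sum => i _; case: (s i) => //= q r; case: ifP.
  - by move=> i; apply: leq_trans (sk i); case: (s i) => //= q r; case: ifP => //= _; exact: leqW.
  - move=> i; have [B bB] := rb i; have [B' bB'] := opb e i e0.
    by exists (B * B'); exact: bpl_comp.
  move=> T Tp; rewrite -[RHS](mulr0 (average_lexp e p T)) -[in RHS](E T Tp) mulr_sumr.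
  apply: eq_bigr => i _; have [B bB] := rb i.
  have -> : rho i (op e i (lexp T)) =
      (if hit (s i) then average_lexp e p T * weight T p else average_lexp e p T) * rho i (lexp T).
    rewrite -(bplZ _ bB (bmf_lexp Tp)) /op; apply: (bpl_ext bB) => X Xp.
    by case: (hit (s i)); [exact: diffquot_lexp|exact: averageE].
  rewrite [in RHS](cutE (s i)); case: (hit (s i)); rewrite /weights ?big_cons; ring.
have cv : \sum_i rho i (average m.+1%:R^-1 p (pderivs (s i) h)) @[m --> \oo] -->
    \sum_i rho i (pderivs (s i) h).
  apply: cvg_bigsum => i; have [B bB] := rb i.
  have bh := Cb_bmf hh (sk i); have [_ [C hC]] := bh.
  have e0 (m : nat) : 0 < m.+1%:R^-1 :> R by rewrite invr_gt0.
  apply: (@bpl_cvg _ _ _ _ bB _ _ C) => [m|m X Xp|X Xp].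
  - exact: bpop_bmf (bpop_average p (e0 m)) bh.
  - by rewrite -[leRHS]mul1r; apply: (bpl_bound ((bpop_average p (e0 m)).1 _ Xp) bh hC).
  - by apply: cvg_average => //; exact: (Cb_continuous hh (sk i)).
apply: (cvg_unique _ cv) => //=.
by under eq_fun do rewrite step ?invr_gt0 //; exact: cvg_cst.
Qed.

End Elimination.

(** * Gaussian squares *)

Section Gaussian.
Variables (R : realType).
Local Notation leb := (@lebesgue_measure R).
Implicit Types (a b P Q z : R).

Lemma integrable_pdf_bounded (f : R -> R) (C : R) a : measurable_fun setT f ->
  (forall z, `|f z| <= C) -> leb.-integrable setT (EFin \o (fun z => f z * normal_pdf a 1 z)).
Proof.
move=> mf fC; apply: (@le_integrable _ _ _ leb setT measurableT _
  (EFin \o (fun z => C * normal_pdf a 1 z))).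
- apply/measurable_EFinP; apply: measurable_funM => //; exact: measurable_normal_pdf.
- by move=> z _ /=; rewrite lee_fin !normrM ler_wpM2r // (le_trans (fC z)) // ler_norm.
- have := integrableZl measurableT C (integrable_normal_pdf a 1).
  by under eq_fun do rewrite -EFinM.
Qed.

Lemma Rintegral_normal_pdf a s : \int[leb]_z normal_pdf a s z = 1.
Proof. by rewrite /Rintegral integral_normal_pdf. Qed.

(** Completing the square: the integrand is a constant times the normal density of mean a - 2 b / (1
    + 2 P) and variance 1 / (1 + 2 P). *)
Lemma gaussian_integral a b P Q : 0 <= P ->
  \int[leb]_z (expR (- (Q + 2 * b * (z - a) + P * (z - a) ^+ 2)) * normal_pdf a 1 z) =
  (Num.sqrt (1 + 2 * P))^-1 * expR (- (Q - 2 * b ^+ 2 / (1 + 2 * P))).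
Proof.
move=> P0; have p0 : 0 < 1 + 2 * P by rewrite ltr_wpDr // mulr_ge0.
pose s := (Num.sqrt (1 + 2 * P))^-1.
have s0 : 0 < s by rewrite invr_gt0 sqrtr_gt0.
have s2 : s ^+ 2 = (1 + 2 * P)^-1 by rewrite exprVn sqr_sqrtr // ltW.
pose c := s * expR (- (Q - 2 * b ^+ 2 / (1 + 2 * P))).
transitivity (c * \int[leb]_z normal_pdf (a - 2 * b / (1 + 2 * P)) s z); last first.
  by rewrite -[RHS]mulr1; congr (_ * _); exact: Rintegral_normal_pdf.
have ip := integrable_normal_pdf (a - 2 * b / (1 + 2 * P)) s.
rewrite -(RintegralZl c measurableT ip).
apply: eq_Rintegral => z _; rewrite !normal_pdfE ?oner_eq0 ?gt_eqF //.
rewrite /normal_fun /normal_peak expr1n mul1r /c.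
have -> : (Num.sqrt (s ^+ 2 * pi *+ 2))^-1 = s^-1 * (Num.sqrt (pi *+ 2))^-1.
  rewrite -mulrnAr sqrtrM ?sqr_ge0 // sqrtr_sqr gtr0_norm // invfM //.
set E1 := expR (- (Q - 2 * b ^+ 2 / _)); set E2 := expR (- (z - (a - _)) ^+ 2 / _).
set k := (Num.sqrt (pi *+ 2))^-1.
transitivity (k * (E1 * E2)); last by field; rewrite gt_eqF.
rewrite mulrCA; congr (_ * _); rewrite /E1 /E2 -!expRD s2; congr expR.
have pi1 : 1 + 2 * P != 0 by rewrite gt_eqF.
by field; rewrite pi1.
Qed.

Lemma integrable_pdf_comb k1 k2 k3 a1 a2 a3 : leb.-integrable setT (EFin \o
  (fun z => k1 * normal_pdf a1 1 z + (k2 * normal_pdf a2 1 z + k3 * normal_pdf a3 1 z))).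
Proof.
have h k a : leb.-integrable setT (EFin \o (fun z => k * normal_pdf a 1 z)).
  by have := integrableZl measurableT k (integrable_normal_pdf a 1); under eq_fun do rewrite -EFinM.
have h2 := integrableD measurableT (h k2 a2) (h k3 a3).
exact: (integrableD measurableT (h k1 a1) h2).
Qed.

Lemma Rintegral_pdf_comb k1 k2 k3 a1 a2 a3 :
  \int[leb]_z (k1 * normal_pdf a1 1 z + (k2 * normal_pdf a2 1 z + k3 * normal_pdf a3 1 z)) =
  k1 + (k2 + k3).
Proof.
have h k a : leb.-integrable setT (EFin \o (fun z => k * normal_pdf a 1 z)).
  by have := integrableZl measurableT k (integrable_normal_pdf a 1); under eq_fun do rewrite -EFinM.
have e k a : \int[leb]_z (k * normal_pdf a 1 z) = k.
  rewrite RintegralZl //; last exact: integrable_normal_pdf.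
  by rewrite -[RHS]mulr1; congr (_ * _); exact: Rintegral_normal_pdf.
rewrite RintegralD //; last exact: (integrableD measurableT (h k2 a2) (h k3 a3)).
by rewrite RintegralD // !e.
Qed.

(** Total variation bounded by the chi-square distance. Cauchy-Schwarz for integrals is replaced by
    the pointwise inequality |r - 1| <= sg/2 + (r - 1)^2 / (2 sg), which is optimal after
    integration for this sg. *)
Lemma gaussian_shift (f : R -> R) (C : R) a : measurable_fun setT f -> (forall z, `|f z| <= C) ->
  `|\int[leb]_z (f z * normal_pdf a 1 z) - \int[leb]_z (f z * normal_pdf 0 1 z)|
    <= C * Num.sqrt (expR (a ^+ 2) - 1).
Proof.
move=> mf fC.
have C0 : 0 <= C by exact: le_trans (fC 0).
have [->|a0] := eqVneq a 0; first by rewrite subrr normr0 mulr_ge0.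
(* The likelihood ratio of the shifted to the centered density. Its square is exp(a^2) times the
   ratio for the mean 2 a, so the second moment is exp(a^2). *)
pose r z := expR (a * z - a ^+ 2 / 2).
have pdfE z : normal_pdf a 1 z = r z * normal_pdf 0 1 z.
  rewrite !normal_pdfE ?oner_eq0 // mulrCA; congr (_ * _).
  by rewrite /normal_fun /r -expRD; congr expR; field.
have pdfE2 z : expR (a ^+ 2) * normal_pdf (2 * a) 1 z = r z ^+ 2 * normal_pdf 0 1 z.
  rewrite !normal_pdfE ?oner_eq0 // mulrCA [RHS]mulrCA; congr (_ * _).
  by rewrite /normal_fun /r -[expR (a * z - _) ^+ 2]expRM_natl -!expRD; congr expR; field.
set sg := Num.sqrt _.
have sg0 : 0 < sg by rewrite sqrtr_gt0 subr_gt0 -[ltLHS]expR0 ltr_expR exprn_even_gt0.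
have sg2 : sg ^+ 2 = expR (a ^+ 2) - 1.
  by rewrite sqr_sqrtr // subr_ge0 -[leLHS]expR0 ler_expR sqr_ge0.
have i1 := integrable_pdf_bounded a mf fC.
have i0 := integrable_pdf_bounded 0 mf fC.
rewrite -RintegralB //.
have i10 := integrableB measurableT i1 i0.
have {}i10 : leb.-integrable setT (EFin \o (fun z => f z * normal_pdf a 1 z - f z * normal_pdf 0 1 z)).
  by apply: eq_integrable i10 => // z _ /=; rewrite EFinB.
apply: le_trans (le_normr_Rintegral measurableT i10) _.
(* The majorant expanded in the densities of means 0, 2 a and a, each of total mass 1. *)
pose k1 := C * (sg / 2 + (2 * sg)^-1).
pose k2 := C * (2 * sg)^-1 * expR (a ^+ 2); pose k3 := - (C / sg).
have -> : C * sg = k1 + (k2 + k3).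
  rewrite /k1 /k2 /k3; have -> : expR (a ^+ 2) = sg ^+ 2 + 1 by rewrite sg2 subrK.
  by field; rewrite gt_eqF.
rewrite -(Rintegral_pdf_comb k1 k2 k3 0 (2 * a) a); apply: le_Rintegral => //.
- by have := integrable_norm i10; apply: eq_integrable.
- exact: integrable_pdf_comb.
move=> z _; rewrite /k2 -[X in _ + (X + _)]mulrA pdfE2 pdfE.
have p0 := normal_pdf_ge0 0 1 z; move: (normal_pdf 0 1 z) p0 (r z) (f z) (fC z) => p p0 y u uC.
rewrite mulrA -mulrBl -[u in _ - u]mulr1 -mulrBr !normrM (ger0_norm p0).
rewrite /k1 /k3 -/(_ / _).
have -> : C * (sg / 2 + (2 * sg)^-1) * p + (C / (2 * sg) * (y ^+ 2 * p) + - (C / sg) * (y * p)) =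
   C * (sg / 2 + (y - 1) ^+ 2 / (2 * sg)) * p by field; rewrite gt_eqF.
rewrite ler_wpM2r // ler_pM //.
have -> : sg / 2 + (y - 1) ^+ 2 / (2 * sg) = (sg ^+ 2 + `|y - 1| ^+ 2) / (2 * sg).
  by rewrite real_normK ?num_real //; field; rewrite gt_eqF.
rewrite ler_pdivlMr ?mulr_gt0 //.
have := sqr_ge0 (sg - `|y - 1|); nra.
Qed.

End Gaussian.

Section GaussianMean.
Variables (R : realType) (d : nat).
Implicit Types (T W X Y : sym R d) (g : symB R d -> R) (l u v : 'cV[R]_d).
Implicit Types (la : seq ('cV[R]_d * R)).
Local Notation pd := (@posdef R d : set (symB R d)).
Local Notation leb := (@lebesgue_measure R).

Lemma ler_norm_pdf (f : R -> R) (K a : R) : measurable_fun setT f -> (forall z, `|f z| <= K) ->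
  `|\int[leb]_z (f z * normal_pdf a 1 z)| <= K.
Proof.
move=> mf fK; have i := integrable_pdf_bounded a mf fK.
apply: le_trans (le_normr_Rintegral measurableT i) _.
rewrite -[leRHS]addr0 -[X in _ + X]addr0 -(Rintegral_pdf_comb K 0 0 a a a).
apply: le_Rintegral => //; [by have := integrable_norm i; apply: eq_integrable|exact: integrable_pdf_comb|].
move=> z _; rewrite !mul0r !addr0 normrM (ger0_norm (normal_pdf_ge0 _ _ _)).
by rewrite ler_wpM2r ?normal_pdf_ge0.
Qed.

Lemma bpl_pdf B (kappa : R -> (symB R d -> R) -> R) (a : R) :
  (forall z, bpl B (kappa z)) ->
  (forall g, bmf g -> measurable_fun setT (fun z => kappa z g)) ->
  bpl B (fun g => \int[leb]_z (kappa z g * normal_pdf a 1 z)).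
Proof.
move=> kb mk.
have ik f : bmf f -> leb.-integrable setT (EFin \o (fun z => kappa z f * normal_pdf a 1 z)).
  move=> bf; have [_ [C fC]] := bf.
  apply: (integrable_pdf_bounded (C := B * C)); first exact: mk.
  by move=> z; exact: bpl_bound (kb _) _ _ bf fC.
split => [f g fg|c f g bf bg|f_ f C bf fC ff|f C bf fC].
- by apply: eq_Rintegral => z _; rewrite (bpl_ext (kb z) fg).
- rewrite -RintegralZl //; last exact: ik.
  rewrite -RintegralD //; first last.
  + exact: ik.
  + by have := integrableZl measurableT c (ik _ bf); under eq_fun do rewrite /= -EFinM.
  by apply: eq_Rintegral => z _; rewrite (bpl_lin (kb z)) //; ring.
- apply: (@Rintegral_cvg _ _ _ leb setT measurableT (fun z => B * C * normal_pdf a 1 z)).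
  + by have := integrableZl measurableT (B * C) (integrable_normal_pdf a 1); under eq_fun do rewrite -EFinM.
  + by move=> n; apply: measurable_funM; [exact: mk|exact: measurable_normal_pdf].
  + move=> n z _; rewrite normrM (ger0_norm (normal_pdf_ge0 _ _ _)).
    by rewrite ler_wpM2r ?normal_pdf_ge0 // (bpl_bound (kb z) (bf n) (fC n)).
  + by move=> z _; apply: cvgM; [exact: bpl_cvg (kb z) _ _ _ bf fC ff|exact: cvg_cst].
- by apply: ler_norm_pdf; [exact: mk|move=> z; exact: bpl_bound (kb z) _ _ bf fC].
Qed.

(* The expectation of [g (X + rank1 (v + \sum_j z_j *: l_j))] for independent z_j ~ N(a_j, 1). *)
Fixpoint gmean la g X v : R :=
  if la is (l, a) :: la' then
    \int[leb]_z (gmean la' g X (v + z *: l) * normal_pdf a 1 z)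
  else g (X + rank1 v).

Definition gcenter la : 'cV[R]_d := \sum_(p <- la) p.2 *: p.1.

Lemma lexp_rank1 T X v : lexp T (X + rank1 v) = expR (- bform T v v) * lexp T X.
Proof.
by rewrite /lexp -expRD symmxD mulmxDr mxtraceD mxtrace_rank1 opprD addrC.
Qed.

(** Both parts are needed together in the induction: integrating over the next variable requires
    measurability in it, which is read off the explicit value on exponentials. *)
Let spec la X v :=
  bpl 1 (fun g => gmean la g X v) /\
  forall T, possemidef T -> gmean la (lexp T) X v =
    (Num.sqrt (shrinks_det (map fst la) T))^-1 *
    (expR (- bform (shrinks (map fst la) T) (v + gcenter la) (v + gcenter la)) * lexp T X).

Let qline T u l z : bform T (u + z *: l) (u + z *: l) =
  bform T u u + 2 * bform T u l * z + bform T l l * z ^+ 2.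
Proof. by rewrite qformD !bformZl !bformZr; ring. Qed.

Let measurable_spec la g X v l : (forall u, spec la X u) -> bmf g ->
  measurable_fun setT (fun z : measurableTypeR R => gmean la g X (v + z *: l)).
Proof.
move=> IH bg.
apply: (@bpl_measurable R d _ (measurableTypeR R) setT (fun z g => gmean la g X (v + z *: l))) bg => //.
  by move=> z _; exists 1; have [] := IH (v + z *: l).
move=> T Tp.
apply: (@eq_measurable_fun _ _ (measurableTypeR R) _ _ (fun z => (Num.sqrt (shrinks_det (map fst la) T))^-1 *
  (expR (- bform (shrinks (map fst la) T) (v + gcenter la + z *: l) (v + gcenter la + z *: l)) * lexp T X))).
  by move=> z _; have [_ ->] := IH (v + z *: l); rewrite // addrAC.
apply: measurable_funM => //; apply: measurable_funM => //.
apply: measurableT_comp => //; apply: measurableT_comp => //.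
under eq_fun do rewrite qline.
apply: measurable_funD; last by apply: measurable_funM => //; exact: measurable_funX.
by apply: measurable_funD => //; exact: measurable_funM.
Qed.

Lemma gmean_spec la X v : posdef X -> spec la X v.
Proof.
move=> Xp; elim: la v => [|[l a] la IH] v /=.
  split=> [|T Tp].
    by apply: bpl_eval; apply: posdefD => //; exact: rank1_ge0.
  by rewrite /= lexp_rank1 sqrtr1 invr1 mul1r /gcenter big_nil addr0.
split=> [|T Tp].
  by apply: bpl_pdf => [z|g bg]; [have [] := IH (v + z *: l)|exact: measurable_spec].
(* The inner Gaussians have replaced T by T'. Expanded around z = a, the exponent is the quadratic
   polynomial of [gaussian_integral], and integrating it performs one more [shrink]. *)
set w := v + gcenter ((l, a) :: la).
set T' := shrinks (map fst la) T; set D := shrinks_det (map fst la) T.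
have T'p : possemidef T' by exact: shrinks_ge0.
transitivity (\int[leb]_z ((Num.sqrt D)^-1 * lexp T X *
    (expR (- (bform T' w w + 2 * bform T' w l * (z - a) + bform T' l l * (z - a) ^+ 2)) * normal_pdf a 1 z))).
  rewrite /=; apply: eq_Rintegral => z _; have [_ E] := IH (v + z *: l); rewrite E //.
  rewrite -/T' -/D -qline /w /gcenter big_cons /=.
  set c := \sum_(j <- la) _.
  have -> : v + z *: l + c = v + (a *: l + c) + (z - a) *: l.
    by move: c => c; apply/matrixP => i j; rewrite !mxE; ring.
  move: (expR _) => x; ring.
have P0 : 0 <= bform T' l l by exact: T'p.
rewrite RintegralZl //; last first.
  apply: (integrable_pdf_bounded (C := 1)).
    apply: measurableT_comp => //; apply: measurableT_comp => //.
    apply: measurable_funD; last first.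
      by apply: measurable_funM => //; apply: measurable_funX; exact: measurable_funB.
    by apply: measurable_funD => //; apply: measurable_funM => //; exact: measurable_funB.
  move=> z; rewrite ger0_norm ?expR_ge0 // -[leRHS]expR0 ler_expR oppr_le0 -qline; exact: T'p.
rewrite gaussian_integral // -/w.
have -> : bform (shrink l T') w w = bform T' w w - 2 * bform T' w l ^+ 2 / (1 + 2 * bform T' l l).
  rewrite /shrink symmxB symmxZ bformD bformN bformZ qform_rank1 trmx_mul sym_tr -/(bform _ _ _).
  by rewrite (bformC T' l w); ring.
by rewrite sqrtrM ?(le_trans ler01) ?shrinks_det_ge1 // invfM; ring.
Qed.

Lemma gmean_shift la1 la2 l a g (C : R) X v : bmf g -> posdef X ->
  (forall Y, posdef Y -> `|g Y| <= C) ->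
  `|gmean (la1 ++ (l, a) :: la2) g X v - gmean (la1 ++ (l, 0) :: la2) g X v|
     <= C * Num.sqrt (expR (a ^+ 2) - 1).
Proof.
move=> bg Xp gC.
have mk la l' u : measurable_fun setT (fun z : measurableTypeR R => gmean la g X (u + z *: l')).
  by apply: measurable_spec => // w; exact: gmean_spec.
have bd la u : `|gmean la g X u| <= C.
  by have [b1 _] := gmean_spec la u Xp; rewrite -[C]mul1r; exact: (bpl_bound b1).
elim: la1 v => [|[l1 a1] la1 IH] v /=; first exact: (gaussian_shift a (mk la2 l v)).
have i1 la := integrable_pdf_bounded a1 (mk la l1 v) (fun z => bd la (v + z *: l1)).
rewrite -RintegralB //.
under eq_Rintegral do rewrite -mulrBl.
have mB := measurable_funB (mk (la1 ++ (l, a) :: la2) l1 v) (mk (la1 ++ (l, 0) :: la2) l1 v).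
exact: (ler_norm_pdf a1 mB (fun z => IH (v + z *: l1))).
Qed.

End GaussianMean.

Section GaussianOperator.
Variables (R : realType) (d : nat).
Implicit Types (T W X Y : sym R d) (g : symB R d -> R) (l u v : 'cV[R]_d).
Implicit Types (la : seq ('cV[R]_d * R)).
Local Notation pd := (@posdef R d : set (symB R d)).

Lemma bpop_gmean la : bpop 1 (fun g X => gmean la g X 0).
Proof.
split=> [X Xp|g bg]; first by have [] := gmean_spec la 0 Xp.
apply: (@bpl_measurable R d _ (symB R d) pd (fun X g => gmean la g X 0)) bg => //.
- by move=> X Xp; exists 1; have [] := gmean_spec la 0 Xp.
move=> T Tp; pose c := (Num.sqrt (shrinks_det (map fst la) T))^-1 *
  expR (- bform (shrinks (map fst la) T) (gcenter la) (gcenter la)).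
apply: (@eq_measurable_fun _ _ (symB R d) _ pd (fun X => c * lexp T X)).
  by move=> X /set_mem Xp; have [_ ->//] := gmean_spec la 0 Xp; rewrite add0r mulrA.
by have [] := bmfZ c (bmf_lexp Tp).
Qed.

Lemma gmean_lexp la (S : sym R d) T X : symmx S = gram (map fst la) -> possemidef T -> posdef X ->
  gmean la (lexp T) X 0 = (Num.sqrt (\det (1%:M + ((T : 'M[R]_d) *m S) *+ 2)))^-1 *
    (expR (- bform (sharp T S) (gcenter la) (gcenter la)) * lexp T X).
Proof.
move=> SE Tp Xp; have [_ ->//] := gmean_spec la 0 Xp.
have [_ E] := shrinks_eq (map fst la) Tp.
by rewrite SE E -shrinksE // add0r.
Qed.

End GaussianOperator.

(** * Symbols of differential operators *)

Section Symbols.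
Variables (R : realType) (d : nat).
Implicit Types (T U W X : sym R d) (p : 'I_d * 'I_d) (P Q : symbol R d).
Local Notation N := #|{: 'I_d * 'I_d}|.

(* The value at [lexp T] of the constant-coefficient operator with symbol [P]. *)
Definition symval T P : R := meval (fun v => - T (enum_val v).1 (enum_val v).2) P.

Definition nabla_coef p : R := 2^-1 * (1 + (p.1 == p.2)%:R).

Lemma nabla_coef_neq0 p : nabla_coef p != 0.
Proof.
by rewrite /nabla_coef mulf_neq0 ?invr_neq0 ?pnatr_eq0 // -natr1 addrC natr1 pnatr_eq0.
Qed.

Definition nablas_coef (s : seq ('I_d * 'I_d)) : R := \prod_(p <- s) nabla_coef p.

(** Off the diagonal [coord_dir] moves two equal entries; the factor 1/2 in the symmetric gradient
    compensates exactly this. *)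
Lemma mxtrace_coord T p : nabla_coef p * \tr ((T : 'M[R]_d) *m coord_dir R p) = T p.1 p.2.
Proof.
have E i j : \tr ((T : 'M[R]_d) *m delta_mx i j) = T i j.
  rewrite -(mul_delta_mx (0 : 'I_1)) -(trmx_delta _ j 0) mxtrace_rank1 bform_delta.
  exact: symE.
rewrite /nabla_coef /= /coord_mx; case: (p.1 =P p.2) => [e|e].
  by rewrite E /=; field.
by rewrite mulmxDr mxtraceD !E (symE T p.2) /=; field.
Qed.

Lemma weight_nabla T p : nabla_coef p * weight T p = - T p.1 p.2.
Proof. by rewrite /weight mulrN mxtrace_coord. Qed.

Lemma symvalE T (k : multinom N) :
  nablas_coef (mono_seq k) * weights T (mono_seq k) =
  \prod_v (- T (enum_val v).1 (enum_val v).2) ^+ k v.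
Proof.
rewrite /nablas_coef /weights -big_split /= /mono_seq big_flatten /= big_map big_enum /=.
apply: eq_bigr => v _; under eq_bigr do rewrite weight_nabla.
by elim: (k v) => [|j IH] /=; rewrite ?big_nil ?expr0 // big_cons IH exprS.
Qed.

Lemma size_mono_seq (k : multinom N) : size (@mono_seq d k) = mdeg k.
Proof.
rewrite /mono_seq size_flatten /shape -map_comp mdegE sumnE big_map big_enum /=.
by apply: eq_bigr => v _; rewrite size_nseq.
Qed.

(** Supports vary with the symbol, and hence with t; a common finite index set allows symbols to be
    added, compared and fed to [elimination]. *)
Lemma sum_bounded (n : nat) P (F : multinom N -> R) : (msize P <= n.+1)%N ->
  \sum_(k <- msupp P) mcoeff k P * F k =
  \sum_(k : bmultinom N n.+1) mcoeff k P * F k.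
Proof.
move=> Pn; pose I : subFinType _ := bmultinom N n.+1.
rewrite (big_mksub I) //=; first last.
- by move=> k /msize_mdeg_lt /leq_trans; apply.
- exact: msupp_uniq.
by rewrite big_rmcond //= => k; move/memN_msupp_eq0 ->; rewrite mul0r.
Qed.

Lemma symval_sum n P T : (msize P <= n.+1)%N ->
  symval T P = \sum_(k : bmultinom N n.+1)
    mcoeff k P * (nablas_coef (mono_seq k) * weights T (mono_seq k)).
Proof.
move=> Pn; rewrite -(sum_bounded (fun k => nablas_coef (mono_seq k) * weights T (mono_seq k)) Pn).
by rewrite /symval mevalE; apply: eq_bigr => k _; rewrite symvalE.
Qed.

Lemma near_posdef W : posdef W -> nbhs W (@posdef R d).
Proof. by move=> Wp; apply: open_nbhs_nbhs; split => //; exact: posdef_open. Qed.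

Lemma nablas_pderivs s (h : sym R d -> R) W : pderivs_exist s h -> posdef W ->
  nablas s h W = nablas_coef s * pderivs s h W.
Proof.
elim: s W => [|p s IH] W /=; first by rewrite /nablas_coef big_nil mul1r.
move=> [es ds] Wp; rewrite /nabla /pderiv /nablas_coef big_cons -/(nablas_coef s) -/(nabla_coef p).
rewrite -mulrA; congr (_ * _).
transitivity ('D_(coord_dir R p) (nablas_coef s \*: pderivs s h) W).
  apply: near_eq_derive; have := near_posdef Wp.
  by apply: filterS => Y Yp; exact: IH.
by apply: deriveZ; exact: ds.
Qed.

Lemma diffopE n k0 P (h : sym R d -> R) W : (msize P <= n.+1)%N -> (n <= k0)%N -> Cb k0 h -> posdef W ->
  diffop P h W = \sum_(k : bmultinom N n.+1)
    mcoeff k P * nablas_coef (mono_seq k) * pderivs (mono_seq k) h W.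
Proof.
move=> Pn nk hh Wp.
rewrite /diffop (sum_bounded (fun k => nablas (mono_seq k) h W) Pn).
apply: eq_bigr => k _; rewrite nablas_pderivs ?mulrA //.
have kn : (size (@mono_seq d k) <= k0)%N.
  by rewrite size_mono_seq; apply: leq_trans nk; rewrite -ltnS; exact: bmdeg.
by have [] := hh _ kn.
Qed.

(** Two symbols are what [level_diffop] calls for: the increment of one level on one side, the
    integral of the next level, with one operator more, on the other. *)
Lemma diffop_elimination n P1 P2 B1 B2 rho1 rho2 (h : sym R d -> R) : Cb n h ->
  (msize P1 <= n.+1)%N -> (msize P2 <= n.+1)%N -> bpl B1 rho1 -> bpl B2 rho2 ->
  (forall T, possemidef T ->
     symval T P1 * rho1 (lexp T) + symval T P2 * rho2 (lexp T) = 0) ->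
  rho1 (diffop P1 h) + rho2 (diffop P2 h) = 0.
Proof.
move=> hh s1 s2 b1 b2 E.
have sk (k : bmultinom N n.+1) : (size (@mono_seq d k) <= n)%N.
  by rewrite size_mono_seq -ltnS; exact: bmdeg.
have rE P B rho : (msize P <= n.+1)%N -> bpl B rho -> rho (diffop P h) =
    \sum_(k : bmultinom N n.+1) mcoeff k P * nablas_coef (mono_seq k) * rho (pderivs (mono_seq k) h).
  move=> sP bB.
  rewrite -(bpl_sum (index_enum _) (fun k : bmultinom N n.+1 => mcoeff k P * nablas_coef (mono_seq k))
    bB (fun k => Cb_bmf hh (sk k))).
  by apply: (bpl_ext bB) => W Wp; rewrite (diffopE sP (leqnn n) hh Wp).
rewrite (rE _ _ _ s1 b1) (rE _ _ _ s2 b2) -big_split /=.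
apply: (@elimination R d (bmultinom N n.+1) (fun k => mono_seq k)
  (fun k g => mcoeff k P1 * nablas_coef (mono_seq k) * rho1 g
            + mcoeff k P2 * nablas_coef (mono_seq k) * rho2 g) n h hh sk).
  by move=> k; eexists; apply: bplD_closed; [exact: b1|apply: bplZ_closed; exact: b2].
move=> T Tp; rewrite -[RHS](E T Tp) (symval_sum T s1) (symval_sum T s2) !mulr_suml -big_split /=.
by apply: eq_bigr => k _; ring.
Qed.

Lemma bmf_diffop n P (h : sym R d -> R) : (msize P <= n.+1)%N -> Cb n h -> bmf (diffop P h).
Proof.
move=> sP hh; apply: (bmf_eq (f := fun W => \sum_(k : bmultinom N n.+1)
    mcoeff k P * nablas_coef (mono_seq k) * pderivs (mono_seq k) h W)).
  by move=> W /set_mem Wp; rewrite (diffopE sP (leqnn n) hh Wp).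
apply: bmf_sum => k; apply: bmfZ; apply: (Cb_bmf hh).
by rewrite size_mono_seq -ltnS; exact: bmdeg.
Qed.

End Symbols.

(** * Degree and time dependence of the symbols *)

Section TameSymbols.
Variables (R : realType) (d : nat).
Implicit Types (P Q : R -> symbol R d).
Local Notation N := #|{: 'I_d * 'I_d}|.

(** A family of symbols of total degree at most n ([msize] is one more than the degree) whose
    coefficients can be integrated against exponentials in t. *)
Definition tame (n : nat) P : Prop :=
  [/\ forall t, (msize (P t) <= n.+1)%N,
      forall k, measurable_fun setT (fun t : measurableTypeR R => mcoeff k (P t)) &
      forall k, exists C : R, forall t, 0 < t -> `|mcoeff k (P t)| <= C].

Lemma tame_weak n m P : (n <= m)%N -> tame n P -> tame m P.
Proof. by move=> nm [sP mP bP]; split => // t; apply: leq_trans (sP t) _. Qed.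

Lemma tame_C (c : R -> R) (C : R) : measurable_fun setT (c : measurableTypeR R -> R) ->
  (forall t, 0 < t -> `|c t| <= C) -> tame 0 (fun t => mpolyC _ (c t)).
Proof.
move=> mc bc; split => [t|k|k].
- by rewrite mmeasureC; case: (c t != 0).
- under eq_fun do rewrite mcoeffC; exact: measurable_funM.
- exists C => t t0; rewrite mcoeffC; case: (k == _); rewrite ?mulr1 ?bc // mulr0 normr0.
  exact: le_trans (bc _ t0).
Qed.

Lemma tame_X (m : multinom N) : mdeg m = 1%N -> tame 1 (fun _ => mpolyX R m).
Proof.
move=> m1; split => [t|k|k]; first by rewrite msizeX m1.
- exact: measurable_cst.
- by exists `|mcoeff k (mpolyX R m)|.
Qed.

Lemma tameD n P Q : tame n P -> tame n Q -> tame n (fun t => P t + Q t).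
Proof.
move=> [sP mP bP] [sQ mQ bQ]; split => [t|k|k].
- by rewrite (leq_trans (mmeasureD_le _ _ _)) // geq_max sP sQ.
- by under eq_fun do rewrite mcoeffD; exact: measurable_funD.
- have [C hC] := bP k; have [C' hC'] := bQ k; exists (C + C') => t t0.
  by rewrite mcoeffD (le_trans (ler_normD _ _)) // lerD ?hC ?hC'.
Qed.

Lemma tameM n m P Q : tame n P -> tame m Q -> tame (n + m) (fun t => P t * Q t).
Proof.
move=> [sP mP bP] [sQ mQ bQ]; split => [t|k|k].
- have [->|P0] := eqVneq (P t) 0; first by rewrite mul0r mmeasure0.
  have [->|Q0] := eqVneq (Q t) 0; first by rewrite mulr0 mmeasure0.
  rewrite (msizeM P0 Q0) -ltnS; have := leq_add (sP t) (sQ t).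
  by rewrite addnS addSn; case: (msize _ + _)%N.
- under eq_fun do rewrite mcoeffM.
  rewrite (_ : (fun t => _) = fun t : measurableTypeR R =>
    \sum_(i <- [seq i : bmultinom N (mdeg k).+1 * bmultinom N (mdeg k).+1 <- index_enum _ | k == mnm_add i.1 i.2])
      mcoeff i.1 (P t) * mcoeff i.2 (Q t)); last by apply/funext => t; rewrite big_filter.
  by apply: measurable_sum => i; exact: measurable_funM.
- have [C hC] := choice bP; have [C' hC'] := choice bQ.
  exists (\sum_(i : bmultinom N (mdeg k).+1 * bmultinom N (mdeg k).+1 | k == mnm_add i.1 i.2)
      C i.1 * C' i.2) => t t0.
  rewrite mcoeffM (le_trans (ler_norm_sum _ _ _)) // ler_sum // => i _.
  by rewrite normrM ler_pM ?hC ?hC'.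
Qed.

Lemma tame0 n : tame n (fun _ => 0).
Proof.
split => [t|k|k]; first by rewrite mmeasure0.
- exact: measurable_cst.
- by exists 0 => t _; rewrite mcoeff0 normr0.
Qed.

Lemma tame_sum n (I : Type) (s : seq I) (P : I -> R -> symbol R d) :
  (forall i, tame n (P i)) -> tame n (fun t => \sum_(i <- s) P i t).
Proof.
move=> h; elim: s => [|i s IH].
  by under eq_fun do rewrite big_nil; exact: tame0.
by under eq_fun do rewrite big_cons; exact: tameD.
Qed.

Lemma tame1 n : tame n (fun _ => 1).
Proof.
split => [t|k|k]; first by rewrite mmeasure1.
- exact: measurable_cst.
- by exists `|mcoeff k (1 : symbol R d)|.
Qed.

Lemma tame_prod n (I : Type) (s : seq I) (P : I -> R -> symbol R d) :
  (forall i, tame n (P i)) -> tame (size s * n) (fun t => \prod_(i <- s) P i t).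
Proof.
move=> h; elim: s => [|i s IH].
  by under eq_fun do rewrite big_nil; exact: tame1.
by under eq_fun do rewrite big_cons; rewrite mulSn; exact: tameM.
Qed.

Lemma tameN n P : tame n P -> tame n (fun t => - P t).
Proof.
move=> [sP mP bP]; split => [t|k|k].
- by rewrite mmeasureN.
- by under eq_fun do rewrite mcoeffN; exact: measurable_funN.
- by have [C hC] := bP k; exists C => t t0; rewrite mcoeffN normrN hC.
Qed.

Lemma tame_sign n (b : nat) P : tame n P -> tame n (fun t => (-1) ^+ b * P t).
Proof.
move=> hP; rewrite -signr_odd; case: (odd b).
  by under eq_fun do rewrite expr1 mulN1r; exact: tameN.
by under eq_fun do rewrite expr0 mul1r.
Qed.

Lemma tame_det m (A : R -> 'M[symbol R d]_m) :
  (forall i j, tame 1 (fun t => A t i j)) -> tame m (fun t => \det (A t)).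
Proof.
move=> hA; apply: tame_sum => s; apply: tame_sign.
apply: (@tame_weak (size (index_enum 'I_m) * 1)).
  by rewrite /index_enum -enumT size_enum_ord muln1.
by apply: tame_prod => i; exact: hA.
Qed.

Variable Sigma : sym R d.

Lemma one_sub_exp_bound (t : R) : 0 < t -> 0 <= 1 - expR (- 2 * t) <= 1.
Proof.
move=> t0; rewrite gerBl expR_ge0 andbT subr_ge0 -expR0 ler_expR mulNr oppr_le0.
by rewrite mulr_ge0 // ltW.
Qed.

Lemma tame_nabla i j : tame 1 (fun _ => nabla_symb R d i j).
Proof. by under eq_fun do rewrite mxE; apply: tame_X; rewrite mdeg1. Qed.

Lemma tame_D_symb i j : (0 < d)%N -> tame d (fun t => D_symb Sigma t i j).
Proof.
move=> d0; rewrite /D_symb; under eq_fun do rewrite mxE.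
apply: tame_sum => k.
suff : tame d.-1 (fun t => (\adj (1%:M - map_mx (mpolyC _ (R := R)) (Sigma_ Sigma t) *m
    nabla_symb R d *+ 2) : 'M[symbol R d]_d) k j).
  move=> h; have := tameM (tame_nabla i k) h.
  by rewrite add1n prednK.
under eq_fun do rewrite mxE /cofactor; apply: tame_sign; apply: tame_det => i' j'.
under eq_fun do rewrite !mxE; apply: tameD.
  by case: (_ == _); [exact: tame1|exact: tame0].
have h a b : tame 1 (fun t => \sum_l (map_mx (mpolyC _ (R := R)) (Sigma_ Sigma t) a l : symbol R d) *
    nabla_symb R d l b).
  apply: tame_sum => l; apply: (tameM (n := 0)); last exact: tame_nabla.
  under eq_fun do rewrite !mxE; apply: (@tame_C _ `|Sigma a l|).
    apply: measurable_funM => //; apply: measurable_funB => //.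
    by apply: measurableT_comp => //; exact: measurable_funM.
  move=> t t0; rewrite normrM ler_piMl //; have /andP[h1 h2] := one_sub_exp_bound t0.
  by rewrite ger0_norm.
by apply: tameN; apply: tameD.
Qed.

End TameSymbols.

Section SymbolValues.
Variables (R : realType) (d : nat).
Implicit Types (Sigma T U S : sym R d).

(** Evaluation is a ring morphism, so it commutes with the adjugate, and it sends [nabla_symb] to
    -T; the rest is [mul_adj_sharp]. *)
Lemma symval_D_symb Sigma S T (t : R) i j : possemidef T -> possemidef S -> symmx S = Sigma_ Sigma t ->
  symval T (D_symb Sigma t i j) =
  - (\det (1%:M + ((T : 'M[R]_d) *m S) *+ 2) * sharp T S i j).
Proof.
move=> Tp Sp SE; pose v := fun v : 'I_#|{: 'I_d * 'I_d}| => - T (enum_val v).1 (enum_val v).2.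
pose f : {rmorphism mpoly #|{: 'I_d * 'I_d}| R -> R} := meval v.
rewrite -[symval T _]/(f (D_symb Sigma t i j)).
have -> : f (D_symb Sigma t i j) = (map_mx f (D_symb Sigma t)) i j by rewrite [RHS]mxE.
have nabE : map_mx f (nabla_symb R d) = - (T : 'M[R]_d).
  apply/matrixP => a b; rewrite !mxE /f /= mevalXU /v.
  by case: (leqP a b) => _; rewrite enum_rankK //= symE.
have CE : map_mx f (map_mx (mpolyC _ (R := R)) (Sigma_ Sigma t)) = Sigma_ Sigma t.
  by apply/matrixP => a b; rewrite !mxE /f /= mevalC.
rewrite /D_symb map_mxM map_mx_adj map_mxB map_mx1 nabE.
rewrite [map_mx f (_ *+ 2)]raddfMn /= map_mxM nabE CE -SE.
rewrite mulmxN mulNrn opprK mulNmx mul_adj_sharp // [LHS]mxE.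
by rewrite [X in - X]mxE.
Qed.

(* [Q] acts on exponentials as the operator <U, D> associated with the scale matrix [S]. *)
Definition directional S U (Q : symbol R d) : Prop := forall T, possemidef T ->
  symval T Q = - (\det (1%:M + ((T : 'M[R]_d) *m S) *+ 2) * \tr (sharp T S *m U)).

Lemma symvalZ T (c : R) (Q : symbol R d) : symval T (mpolyC _ c * Q) = c * symval T Q.
Proof. by rewrite /symval mevalM mevalC. Qed.

Lemma directional_coord Sigma S (t : R) p : possemidef S -> symmx S = Sigma_ Sigma t ->
  directional S (coord_dir R p) (mpolyC _ (nabla_coef R p)^-1 * D_symb Sigma t p.1 p.2).
Proof.
move=> Sp SE T Tp; rewrite symvalZ (symval_D_symb _ _ Tp Sp SE).
have [T' _ <-] := sharp_psd Tp Sp.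
by rewrite -mxtrace_coord mulrN mulrCA mulKf // nabla_coef_neq0.
Qed.

Lemma directional_frob Sigma S (t : R) U : possemidef S -> symmx S = Sigma_ Sigma t ->
  directional S U (D_frob Sigma t U).
Proof.
move=> Sp SE T Tp; rewrite /symval /D_frob raddf_sum /=.
have [T' _ ET'] := sharp_psd Tp Sp.
rewrite -ET' mxtraceM_sum mulr_sumr -sumrN; apply: eq_bigr => i _.
rewrite raddf_sum /= mulr_sumr -sumrN; apply: eq_bigr => j _.
rewrite mevalZ -[meval _ _]/(symval T (D_symb Sigma t i j)) (symval_D_symb _ _ Tp Sp SE).
by rewrite -ET' mulrN mulrCA [in RHS](symE U) [in RHS]mulrCA mulrC mulrA [T' i j * _]mulrC; congr (- _); ring.
Qed.

Lemma tame_scaled n (c : R) (P : R -> symbol R d) : tame n P -> tame n (fun t => mpolyC _ c * P t).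
Proof.
by move=> h; apply: (tameM (n := 0)) h; apply: (@tame_C _ _ _ `|c|).
Qed.

Lemma tame_frob Sigma U : (0 < d)%N -> tame d (fun t => D_frob Sigma t U).
Proof.
move=> d0; apply: tame_sum => i; apply: tame_sum => j.
by under eq_fun do rewrite -mul_mpolyC; apply: tame_scaled; exact: tame_D_symb.
Qed.

End SymbolValues.

(** * Convolution with Gaussian squares *)

Section Frames.
Variables (R : realType) (d : nat).
Implicit Types (S T U W : sym R d) (u v l : 'cV[R]_d).

Lemma sym_inj : injective (@symmx R d).
Proof. exact: val_inj. Qed.

Lemma rank1Z (c : R) v : rank1 (c *: v) = c ^+ 2 *: rank1 v.
Proof.
apply/val_inj/matrixP => i j; rewrite /= [in RHS]mxE !mxE !big_ord1 !mxE.
by rewrite expr2; ring.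
Qed.

(** By [posdef_ge_rank1] any c below the inverse of v^T S^-1 v will do; the added 1 covers v = 0. *)
Lemma posdef_sub_rank1 S v : posdef S -> exists2 c : R, 0 < c & posdef (S - c *: rank1 v).
Proof.
move=> Sp; pose b := bform (inv_sym S) v v.
have b0 : 0 <= b by exact/posdefW/posdef_inv.
exists (1 + b)^-1; first by rewrite invr_gt0 ltr_pwDl.
rewrite posdefE => x x0; rewrite symmxB symmxZ bformD bformN bformZ qform_rank1 subr_gt0.
rewrite mulrC ltr_pdivrMr ?ltr_pwDl // (le_lt_trans (posdef_ge_rank1 v x Sp)) //.
by rewrite mulrDr mulr1 -/b [b * _]mulrC ltrDr; exact: Sp.
Qed.

Lemma posdef_sub_rank1s S (vs : seq 'cV[R]_d) : posdef S ->
  exists2 c : R, 0 < c & posdef (S - c *: \sum_(v <- vs) rank1 v).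
Proof.
move=> Sp; elim: vs => [|v vs [c1 c10 p1]].
  by exists 1 => //; rewrite big_nil scaler0 subr0.
have [c2 c20 p2] := posdef_sub_rank1 v p1.
exists (Num.min c1 c2); first by rewrite lt_min c10.
set c := Num.min c1 c2; rewrite big_cons; set A := \sum_(v <- vs) _.
have -> : S - c *: (rank1 v + A) = (S - c1 *: A - c2 *: rank1 v) +
    ((c1 - c) *: A + (c2 - c) *: rank1 v).
  apply/sym_inj/matrixP => i j; rewrite !(symmxD, symmxN, symmxZ) !mxE.
  by ring.
apply: posdefD => //; apply: possemidefD; apply: possemidefZ; rewrite ?subr_ge0 ?ge_min ?lexx ?orbT //.
  by apply: possemidef_sum => u _; exact: rank1_ge0.
exact: rank1_ge0.
Qed.

(** Small multiples of the prescribed squares are carved out of S; the remainder is still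
    nonnegative, hence a sum of squares as well. *)
Lemma frame_exists S (vs : seq 'cV[R]_d) : posdef S -> exists ls, symmx S = gram ls /\
  exists2 c : R, 0 < c & {in vs, forall v, c *: v \in ls}.
Proof.
move=> /(posdef_sub_rank1s vs)[c c0 /posdefW/psd_sum_rank1[ls E]].
have sc : 0 < Num.sqrt c by rewrite sqrtr_gt0.
exists ([seq Num.sqrt c *: v | v <- vs] ++ ls); split.
  rewrite -[S](subrK (c *: \sum_(v <- vs) rank1 v)) E symmxD symmxZ !symmx_sum.
  rewrite /gram big_cat big_map addrC scaler_sumr; congr (_ + _).
  apply: eq_bigr => v _; rewrite -[RHS]/(symmx (rank1 (Num.sqrt c *: v))) rank1Z.
  by rewrite sqr_sqrtr // ltW.
exists (Num.sqrt c) => // v vvs; rewrite mem_cat; apply/orP; left.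
exact: map_f.
Qed.

(* The signed sum and difference of two basis vectors; by polarization their squares span S^d. *)
Definition pairvec (x : 'I_d * 'I_d * bool) : 'cV[R]_d :=
  delta_mx x.1.1 0 + (-1) ^+ x.2 *: delta_mx x.1.2 0.

Definition paircoef U (x : 'I_d * 'I_d * bool) : R := 4^-1 * (-1) ^+ x.2 * U x.1.1 x.1.2.

(** The squares of e_i + e_j and e_i - e_j differ by 2 (E_ij + E_ji), and U is the sum of U_ij (E_ij
    + E_ji) / 2 over ordered pairs; together this gives the coefficient 1/4. *)
Lemma sum_pairvec U : U = \sum_x paircoef U x *: rank1 (pairvec x).
Proof.
apply/sym_inj; rewrite symmx_sum -(pair_bigA _ (fun p b => symmx (paircoef U (p, b) *: rank1 (pairvec (p, b))))) /=.
transitivity (\sum_(p : 'I_d * 'I_d) (2^-1 * U p.1 p.2) *: (delta_mx p.1 p.2 + delta_mx p.2 p.1 : 'M[R]_d)).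
  rewrite -(pair_bigA _ (fun i j => (2^-1 * U i j) *: (delta_mx i j + delta_mx j i : 'M[R]_d))) /=.
  under eq_bigr do under eq_bigr do rewrite scalerDr.
  under eq_bigr do rewrite big_split.
  rewrite big_split /= [X in _ + X]exchange_big /=.
  under [X in _ + X]eq_bigr do under eq_bigr do rewrite symE.
  rewrite -big_split /= {1}(matrix_sum_delta (U : 'M[R]_d)); apply: eq_bigr => i _.
  rewrite -big_split /=; apply: eq_bigr => j _; rewrite -scalerDl; congr (_ *: _).
  by field.
apply: eq_bigr => -[i j] _; rewrite big_bool /= /paircoef /pairvec /= !expr0 !expr1.
rewrite scale1r scaleN1r; apply/matrixP => a b; rewrite !mxE !big_ord1 !mxE.
rewrite !eqxx !andbT !mulrb.
by case: (a == i); case: (b == i); case: (a == j); case: (b == j); rewrite /=; field.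
Qed.

End Frames.

Section LineExponentials.
Variables (R : realType) (d : nat).
Implicit Types (T U W X Y : sym R d).

Lemma integrable_lexp_line T W U (s : R) : possemidef T -> posdef W -> posdef (W + s *: U) ->
  lebesgue_measure.-integrable (`[0, s] : set (measurableTypeR R))
    (EFin \o (fun r : R => lexp T (W + r *: U))).
Proof.
move=> Tp Wp Wsp; have Wr := posdef_line Wp Wsp.
apply: (@integrable_bounded _ (measurableTypeR R) _ lebesgue_measure _ _ _ _ 1) => //.
- exact: leb_itv_fin.
- apply: (@measurable_bmf_comp _ _ _ (measurableTypeR R) _ (fun r => W + r *: U) (lexp T)) => //.
  + exact: measurable_line.
  + exact: bmf_lexp.
- by move=> r /= rs; rewrite ger0_norm ?lexp_ge0 // lexp_le1 //; exact: Wr.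
Qed.

Lemma lexp_line_integral T W U (s : R) : possemidef T -> posdef W -> 0 < s -> posdef (W + s *: U) ->
  - \tr ((T : 'M[R]_d) *m U) * (\int[lebesgue_measure]_(r in `[0, s]) lexp T (W + r *: U)) =
  lexp T (W + s *: U) - lexp T W.
Proof.
move=> Tp Wp s0 Wsp; pose df Y := - \tr ((T : 'M[R]_d) *m U) * lexp T Y.
have dd t : t \in `[0, s] -> is_derive (W + t *: U) U (lexp T) (df (W + t *: U)).
  by move=> _; exact: is_derive_lexp.
have cd t : t \in `[0, s] -> {for t, continuous (fun t : R => df (W + t *: U))}.
  move=> _; apply: (continuous_comp (f := fun t : R => W + t *: U) (g := df)); first exact: continuous_line.
  set Y := W + t *: U; apply: (@cvgM _ _ (nbhs Y) (nbhs_filter Y)); first exact: cvg_cst.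
  exact: continuous_lexp.
rewrite -(line_FTC s0 dd cd) RintegralZl //; exact: integrable_lexp_line.
Qed.

End LineExponentials.

(** * Laws at a fixed time, convolved with Gaussian squares *)

Section ScaleMean.
Variables (R : realType) (d : nat) (S : sym R d).
Hypothesis Sp : posdef S.
Implicit Types (T U W X Y : sym R d) (g : symB R d -> R) (l u v : 'cV[R]_d).
Local Notation pd := (@posdef R d : set (symB R d)).

(** One choice of vectors per scale S. Containing a common multiple of every [pairvec] is what lets
    [level_lip] move W in all directions. *)
Definition frame : seq 'cV[R]_d := xget [::] [set ls | symmx S = gram ls /\
  exists2 c : R, 0 < c & {in [seq pairvec R x | x <- enum {: 'I_d * 'I_d * bool}],
     forall v, c *: v \in ls}].

Let frameP : symmx S = gram frame /\
  exists2 c : R, 0 < c & forall x, c *: pairvec R x \in frame.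
Proof.
have := frame_exists [seq pairvec R x | x <- enum {: 'I_d * 'I_d * bool}] Sp.
move=> /(xgetPex [::])[h1 [c c0 h2]]; split => //; exists c => // x.
by apply: h2; rewrite map_f // mem_enum.
Qed.

(* Adding a centered Gaussian square with covariance [S]: on [lexp T] a factor det(1 + 2 T S)^(-1/2). *)
Definition gsquare g : symB R d -> R := fun X => gmean [seq (l, 0) | l <- frame] g X 0.

Definition gsquares g := gsquare (gsquare g).

Definition scale_det T := \det (1%:M + ((T : 'M[R]_d) *m S) *+ 2).

Lemma scale_det_ge1 T : possemidef T -> 1 <= scale_det T.
Proof. by move=> Tp; apply: det_ge1 => //; exact: posdefW. Qed.

Lemma scale_det_gt0 T : possemidef T -> 0 < scale_det T.
Proof. by move=> Tp; apply: lt_le_trans (scale_det_ge1 Tp). Qed.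

Let unzip_map : map fst [seq (l, 0 : R) | l <- frame] = frame.
Proof. by rewrite -map_comp map_id. Qed.

Lemma bpop_gsquare : bpop 1 gsquare. Proof. exact: bpop_gmean. Qed.

Lemma gsquare_lexp T X : possemidef T -> posdef X ->
  gsquare (lexp T) X = (Num.sqrt (scale_det T))^-1 * lexp T X.
Proof.
move=> Tp Xp; rewrite /gsquare (@gmean_lexp R d _ S T X) ?unzip_map //; last by have [] := frameP.
have -> : gcenter [seq (l, 0) | l <- frame] = 0.
  by rewrite /gcenter big_map big1 // => l _; rewrite scale0r.
by rewrite /bform mulmx0 mxE oppr0 expR0 mul1r.
Qed.

Lemma bpop_gsquares : bpop 1 gsquares.
Proof. by have := bpop_comp bpop_gsquare bpop_gsquare; rewrite mulr1. Qed.

Lemma bpop_iter k : bpop 1 (iter k gsquares).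
Proof.
elim: k => [|k IH]; first exact: bpop_id.
by have := bpop_comp bpop_gsquares IH; rewrite mulr1.
Qed.

Lemma bpop_ext B (A : (symB R d -> R) -> symB R d -> R) g g' X : bpop B A -> posdef X ->
  (forall Y, posdef Y -> g Y = g' Y) -> A g X = A g' X.
Proof. by move=> [h _] Xp E; exact: (bpl_ext (h X Xp) E). Qed.

Lemma gsquares_lexp T X : possemidef T -> posdef X ->
  gsquares (lexp T) X = (scale_det T)^-1 * lexp T X.
Proof.
move=> Tp Xp; rewrite /gsquares (bpop_ext (g' := fun Y => (Num.sqrt (scale_det T))^-1 * lexp T Y) bpop_gsquare Xp); last first.
  by move=> Y Yp; rewrite gsquare_lexp.
rewrite (bplZ _ (bpop_gsquare.1 _ Xp)); last exact: bmf_lexp.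
rewrite gsquare_lexp // mulrA -invfM -expr2 sqr_sqrtr //.
by rewrite ltW // scale_det_gt0.
Qed.

Lemma iter_lexp k T X : possemidef T -> posdef X ->
  iter k gsquares (lexp T) X = (scale_det T) ^- k * lexp T X.
Proof.
move=> Tp; elim: k X => [|k IH] X Xp; first by rewrite expr0 invr1 mul1r.
rewrite iterS (bpop_ext (g' := fun Y => (scale_det T) ^- k * lexp T Y) bpop_gsquares Xp) //.
rewrite (bplZ _ (bpop_gsquares.1 _ Xp)); last exact: bmf_lexp.
by rewrite gsquares_lexp // mulrA -invfM exprSr.
Qed.

(* Shifting the mean of one Gaussian by [a] trades for the translation by a multiple of [rank1 l]. *)
Lemma gsquare_shift l (a : R) : l \in frame -> exists A, [/\ bpop 1 A,
  forall T X, possemidef T -> posdef X ->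
    A (lexp T) X = (Num.sqrt (scale_det T))^-1 * (expR (- (a ^+ 2 * \tr (sharp T S *m rank1 l))) * lexp T X) &
  forall g (C : R) X, bmf g -> posdef X -> (forall Y, posdef Y -> `|g Y| <= C) ->
    `|A g X - gsquare g X| <= C * Num.sqrt (expR (a ^+ 2) - 1)].
Proof.
case/splitPr fE : {-1}frame / => [l1 l2].
pose z := map (fun l : 'cV[R]_d => (l, 0 : R)).
have zE : [seq (l, 0) | l <- frame] = z l1 ++ (l, 0) :: z l2 by rewrite fE /z map_cat.
exists (fun g X => gmean (z l1 ++ (l, a) :: z l2) g X 0); split.
- exact: bpop_gmean.
- move=> T X Tp Xp; rewrite (@gmean_lexp R d _ S T X) //; last first.
    rewrite map_cat /= -!map_comp !map_id -fE.
    by have [] := frameP.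
  congr (_ * (expR (- _) * _)).
  have z0 s : \sum_(p <- z s) p.2 *: p.1 = 0.
    by rewrite big_map big1 // => l' _; rewrite scale0r.
  rewrite /gcenter big_cat big_cons /= !z0 add0r addr0 bformZl bformZr -mxtrace_rank1.
  by rewrite expr2 mulrA.
- by move=> g C X bg Xp gC; rewrite /gsquare zE; exact: gmean_shift.
Qed.

Variables (e beta : R) (K : sym R d -> probability (symB R d) R).
Hypothesis e0 : 0 < e.
Hypothesis K1 : forall W, posdef W -> K W pd = 1%E.
Hypothesis KL : forall W T, posdef W -> possemidef T ->
  \int[K W]_(X in pd) lexp T X = expR (- (e * \tr (sharp T S *m W))) * scale_det T `^ beta.

(** The power of the determinant drops from beta to beta - k: for beta = -alpha/2 this is the
    expectation under the law with alpha + 2 k in place of alpha. *)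
Definition level k W g : R := \int[K W]_(X in pd) iter k gsquares g X.

Lemma bpl_K W : posdef W -> bpl 1 (fun g => \int[K W]_(X in pd) g X).
Proof.
move=> Wp.
have KWf : (K W pd < +oo)%E by rewrite K1 // ltry.
have := @bpl_integral R d _ (symB R d) pd (fun X g => g X) (@measurable_posdef R d) 1 (K W) ler01.
rewrite mul1r (congr1 fine (K1 Wp) : _ = 1) => H; apply: H.
- exact: KWf.
- by move=> X Xp; exact: bpl_eval.
- by move=> g [].
Qed.

Lemma bpl_level k W : posdef W -> bpl 1 (level k W).
Proof. by move=> Wp; have := bpl_comp (bpl_K Wp) (bpop_iter k); rewrite mulr1. Qed.

Lemma level_lexp k W T : posdef W -> possemidef T ->
  level k W (lexp T) = expR (- (e * \tr (sharp T S *m W))) * (scale_det T `^ beta * scale_det T ^- k).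
Proof.
move=> Wp Tp; rewrite /level (bpl_ext (bpl_K Wp) (g := fun X => scale_det T ^- k * lexp T X)); last first.
  by move=> X Xp; rewrite iter_lexp.
rewrite (bplZ _ (bpl_K Wp)); last exact: bmf_lexp.
by rewrite KL //; move: (expR _) (_ `^ _) (_ ^- _) => x y z; ring.
Qed.

Lemma level_measurable (a : R) k W U g : bmf g -> posdef W -> posdef (W + a *: U) ->
  measurable_fun `[0, a] (fun r : measurableTypeR R => level k (W + r *: U) g).
Proof.
move=> bg Wp Wap; have Wr := posdef_line Wp Wap.
apply: (@bpl_measurable R d _ (measurableTypeR R) `[0, a]%classic (fun r g => level k (W + r *: U) g)) bg => //.
  by move=> r /= ra; exists 1; apply: bpl_level; exact: Wr.
move=> T Tp; apply: (@eq_measurable_fun _ _ (measurableTypeR R) _ _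
  (fun r => expR (- (e * (\tr (sharp T S *m W) + r * \tr (sharp T S *m U)))) *
    (scale_det T `^ beta * scale_det T ^- k))).
  move=> r; rewrite inE /= => ra; rewrite level_lexp //; last exact: Wr.
  by rewrite symmxD symmxZ mulmxDr -scalemxAr mxtraceD mxtraceZ.
apply: measurable_funM => //; apply: measurableT_comp => //; apply: measurableT_comp => //.
by apply: measurable_funM => //; apply: measurable_funD => //; exact: measurable_funM.
Qed.

(** On exponentials this is the fundamental theorem of calculus along the segment: Q brings the
    factor -det tr(T# U), and the additional level removes det. The integrated form asks for
    measurability in W, not continuity. *)
Lemma level_diffop n k P Q (h : sym R d -> R) W U (s : R) : Cb n h ->
  (msize P <= n.+1)%N -> (msize (Q * P) <= n.+1)%N -> directional S U Q ->
  posdef W -> 0 < s -> posdef (W + s *: U) ->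
  level k (W + s *: U) (diffop P h) - level k W (diffop P h) =
  e * \int[lebesgue_measure]_(r in `[0, s]) level k.+1 (W + r *: U) (diffop (Q * P) h).
Proof.
move=> hh sP sQP QU Wp s0 Wsp; have Wr := posdef_line Wp Wsp.
pose J g := \int[lebesgue_measure]_(r in `[0, s]) level k.+1 (W + r *: U) g.
have bJ : bpl (1 * fine (lebesgue_measure `[0, s]%classic)) J.
  apply: (@bpl_integral R d _ (measurableTypeR R) `[0, s]%classic (fun r g => level k.+1 (W + r *: U) g)) => //.
  - exact: leb_itv_fin.
  - by move=> r /= rs; apply: bpl_level; exact: Wr.
  - by move=> g bg; exact: level_measurable.
have b1 := bplD_closed (-1) (bpl_level k Wp) (bpl_level k Wsp).
have b2 := bplZ_closed (- e) bJ.
have := diffop_elimination hh sP sQP b1 b2 _.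
rewrite -/(J _) => E; apply/eqP; rewrite -subr_eq0; apply/eqP; rewrite -[RHS]E; first by ring.
move=> T Tp; have [T' T'p T'E] := sharp_psd Tp (posdefW Sp).
have eT'p : possemidef (e *: T') by apply: possemidefZ => //; exact: ltW.
(* As a function of the starting point, each level of [lexp T] is again an exponential, with e T# in
   place of T. *)
have lE j Y : posdef Y -> level j Y (lexp T) = scale_det T `^ beta * scale_det T ^- j * lexp (e *: T') Y.
  by move=> Yp; rewrite level_lexp // mulrC /lexp symmxZ -scalemxAl mxtraceZ T'E.
have -> : symval T (Q * P) = - (scale_det T * \tr ((T' : 'M[R]_d) *m U)) * symval T P.
  by rewrite /symval mevalM -/(symval T Q) QU // T'E.
have JE : J (lexp T) = scale_det T `^ beta * scale_det T ^- k.+1 *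
    \int[lebesgue_measure]_(r in `[0, s]) lexp (e *: T') (W + r *: U).
  rewrite -RintegralZl //; last exact: integrable_lexp_line.
  by apply: eq_Rintegral => r; rewrite inE /= => rs; rewrite lE //; exact: Wr.
have FTC : - (e * \tr ((T' : 'M[R]_d) *m U)) * (\int[lebesgue_measure]_(r in `[0, s]) lexp (e *: T') (W + r *: U)) =
    lexp (e *: T') (W + s *: U) - lexp (e *: T') W.
  by rewrite -lexp_line_integral // symmxZ -scalemxAl mxtraceZ.
rewrite JE !lE //.
have D0 : scale_det T != 0 by rewrite gt_eqF // scale_det_gt0.
transitivity (symval T P * (scale_det T `^ beta * scale_det T ^- k) *
  (lexp (e *: T') (W + s *: U) - lexp (e *: T') W - - (e * \tr ((T' : 'M[R]_d) *m U)) *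
   (\int[lebesgue_measure]_(r in `[0, s]) lexp (e *: T') (W + r *: U)))); last first.
  by rewrite FTC subrr mulr0.
rewrite exprS invfM; move: (lexp _ _) (lexp _ _) (\int[_]_(_ in _) _) (_ ^- k) (_ `^ _) => x y z w v.
by field.
Qed.

(** Shifting the mean of the Gaussian attached to l by a adds a^2 tr(T# l l^T) to the exponent,
    while moving W adds e r tr(T# l l^T). So a = sqrt(e r), and [gaussian_shift] gives the bound. *)
Lemma level_step k W l (r C : R) g : l \in frame -> 0 <= r -> posdef W -> bmf g ->
  (forall Y, posdef Y -> `|g Y| <= C) ->
  `|level k.+1 (W + r *: rank1 l) g - level k.+1 W g| <= C * Num.sqrt (expR (e * r) - 1).
Proof.
move=> lf r0 Wp bg gC; have er0 : 0 <= e * r by rewrite mulr_ge0 // ltW.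
have [A [bA AE Asub]] := gsquare_shift (Num.sqrt (e * r)) lf.
rewrite sqr_sqrtr // in AE Asub.
have Wrp : posdef (W + r *: rank1 l).
  by apply: posdefD => //; apply: possemidefZ => //; exact: rank1_ge0.
pose rho f := \int[K W]_(X in pd) iter k gsquares (gsquare f) X.
have brho : bpl 1 rho.
  have := bpl_comp (bpl_comp (bpl_K Wp) (bpop_iter k)) bpop_gsquare.
  by rewrite !mulr1.
have -> : level k.+1 W g = rho (gsquare g) by rewrite /level iterSr.
have brA : bpl 1 (fun g => rho (A g)) by have := bpl_comp brho bA; rewrite mulr1.
have -> : level k.+1 (W + r *: rank1 l) g = rho (A g).
  apply: (bpl_unique (bpl_level k.+1 Wrp) brA) => // T Tp; rewrite level_lexp //.
  rewrite (bpl_ext brho (g := fun X => (Num.sqrt (scale_det T))^-1 *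
    expR (- (e * r * \tr (sharp T S *m rank1 l))) * lexp T X)); last first.
    by move=> X Xp; rewrite AE // mulrA.
  rewrite (bplZ _ brho); last exact: bmf_lexp.
  have -> : rho (lexp T) = (Num.sqrt (scale_det T))^-1 * level k W (lexp T).
    rewrite -(bplZ _ (bpl_level k Wp)); last exact: bmf_lexp.
    apply: (bpl_ext (bpl_K Wp)) => X Xp; apply: (bpop_ext (bpop_iter k) Xp) => Y Yp.
    exact: gsquare_lexp.
  rewrite level_lexp // symmxD symmxZ mulmxDr -scalemxAr mxtraceD mxtraceZ mulrDr opprD expRD mulrA.
  (* Only one of the two innermost squares is shifted: one root belongs to A, the other to the
     [gsquare] inside [rho]. *)
  have sE : (scale_det T)^-1 = (Num.sqrt (scale_det T))^-1 * (Num.sqrt (scale_det T))^-1.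
    by rewrite -invfM -expr2 sqr_sqrtr // ltW // scale_det_gt0.
  rewrite exprS invfM sE [e * (r * _)]mulrA.
  move: (expR _) (expR _) (_ `^ _) (_ ^- _) (_^-1) => x y z w v; ring.
have -> : rho (A g) - rho (gsquare g) = rho (fun X => -1 * gsquare g X + A g X).
  rewrite (bpl_lin brho); [ring|exact: bpop_bmf bpop_gsquare _|exact: bpop_bmf bA _].
rewrite -[leRHS]mul1r; apply: (bpl_bound brho).
  apply: bmfD; last exact: bpop_bmf bA _.
  by apply: bmfZ; exact: bpop_bmf bpop_gsquare _.
by move=> X Xp; rewrite mulN1r addrC; exact: Asub.
Qed.

(** Since only nonnegative multiples of squares are added, every intermediate matrix stays in the
    cone. *)
Lemma level_steps k W (ls : seq ('cV[R]_d * R)) (C r : R) g : {in ls, forall x, x.1 \in frame /\ 0 <= x.2 <= r} ->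
  posdef W -> bmf g -> (forall Y, posdef Y -> `|g Y| <= C) ->
  `|level k.+1 (W + \sum_(x <- ls) x.2 *: rank1 x.1) g - level k.+1 W g|
     <= (size ls)%:R * (C * Num.sqrt (expR (e * r) - 1)).
Proof.
move=> lsr Wp bg gC; have C0 : 0 <= C by rewrite (le_trans _ (gC _ Wp)).
elim: ls W Wp lsr => [|[l s] ls IH] W Wp lsr; first by rewrite big_nil addr0 subrr normr0 mul0r.
have [lf /andP[/= s0 sr]] := lsr (l, s) (mem_head _ _).
have Wsp : posdef (W + s *: rank1 l).
  by apply: posdefD => //; apply: possemidefZ => //; exact: rank1_ge0.
rewrite big_cons addrA /= -natr1 mulrDl mul1r.
rewrite -[level _ _ _ - _](subrKA (level k.+1 (W + s *: rank1 l) g)).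
apply: (le_trans (ler_normD _ _)); apply: lerD.
  by apply: IH => // x xls; apply: lsr; rewrite inE xls orbT.
apply: le_trans (level_step _ lf s0 Wp bg gC) _.
rewrite ler_wpM2l // ler_wsqrtr // lerD2r ler_expR ler_pM2l //.
Qed.

(* By polarization W' - W is a signed combination of the squares in the frame: the positive part is
   added to W and the negative part to W', and both chains end at the same matrix. *)
Lemma level_lip k W : exists2 c : R, 0 < c & forall W' g (C : R), posdef W -> posdef W' -> bmf g ->
  (forall Y, posdef Y -> `|g Y| <= C) ->
  `|level k.+1 W' g - level k.+1 W g| <=
     2 * (#|{: 'I_d * 'I_d * bool}|%:R * (C * Num.sqrt (expR (e * (c * `|W' - W|)) - 1))).
Proof.
have [_ [c c0 cf]] := frameP.
exists (c ^- 2); first by rewrite invr_gt0 exprn_gt0.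
move=> W' g C Wp W'p bg gC; set r := c ^- 2 * _.
pose I := {: 'I_d * 'I_d * bool}; pose U := W' - W.
pose st (b : R) := [seq (c *: pairvec R x, c ^- 2 * Num.max (b * paircoef U x) 0) | x <- enum I].
have stE b : \sum_(x <- st b) x.2 *: rank1 x.1 = \sum_x Num.max (b * paircoef U x) 0 *: rank1 (pairvec R x).
  rewrite big_map big_enum /=; apply: eq_bigr => x _; rewrite rank1Z scalerA; congr (_ *: _).
  by rewrite mulrAC mulVf ?mul1r // gt_eqF // exprn_gt0.
have stU b : b = 1 \/ b = -1 -> {in st b, forall x, x.1 \in frame /\ 0 <= x.2 <= r}.
  move=> hb _ /mapP[x _ ->] /=; split; first exact: cf.
  rewrite mulr_ge0 ?invr_ge0 ?exprn_ge0 ?(ltW c0) ?le_max ?lexx ?orbT //=.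
  rewrite ler_wpM2l ?invr_ge0 ?exprn_ge0 ?(ltW c0) // ge_max normr_ge0 andbT.
  apply: le_trans (ler_norm _) _; rewrite /paircoef !normrM normrX normrN1 expr1n mulr1.
  have -> : `|b| = 1 by case: hb => ->; rewrite ?normrN1 ?normr1.
  rewrite mul1r ger0_norm ?invr_ge0 // -[leRHS]mul1r ler_pM ?invr_ge0 ?ler_norm_entry //.
  by rewrite invf_le1 // ler1n.
have sz b : size (st b) = #|I| by rewrite size_map cardE.
have EW : W + \sum_(x <- st 1) x.2 *: rank1 x.1 = W' + \sum_(x <- st (-1)) x.2 *: rank1 x.1.
  rewrite !stE; have -> : W' = W + U by rewrite addrC subrK.
  rewrite -addrA; congr (W + _); rewrite [X in X + _](sum_pairvec U) -big_split /=.
  apply: eq_bigr => x _; rewrite -scalerDl mul1r mulN1r; congr (_ *: _).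
  set u := paircoef U x; have [u0|u0] := lerP 0 u.
    by rewrite max_r ?oppr_le0 // addr0.
  by rewrite max_l ?oppr_ge0 ?subrr // ltW.
have h1 := level_steps k (stU 1 (or_introl erefl)) Wp bg gC.
have h2 := level_steps k (stU (-1) (or_intror erefl)) W'p bg gC.
rewrite !sz EW in h1 h2 *.
rewrite -[_ - _](subrKA (level k.+1 (W' + \sum_(x <- st (-1)) x.2 *: rank1 x.1) g)).
rewrite mulrDl mul1r (le_trans (ler_normD _ _)) // lerD //.
by rewrite distrC.
Qed.

End ScaleMean.

(** * The Stein solution *)

Section MeasurableMatrices.
Context {dZ} {Z : measurableType dZ} {R : realType}.
Variable D : set Z.

Lemma measurable_prod (I : Type) (s : seq I) (f : I -> Z -> R) :
  (forall i, measurable_fun D (f i)) -> measurable_fun D (fun z => \prod_(i <- s) f i z).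
Proof.
move=> mf; elim: s => [|i s IH]; first by under eq_fun do rewrite big_nil; exact: measurable_cst.
by under eq_fun do rewrite big_cons; exact: measurable_funM.
Qed.

Definition measurable_mx m n (A : Z -> 'M[R]_(m, n)) := forall i j, measurable_fun D (fun z => A z i j).

Lemma measurable_det n (A : Z -> 'M[R]_n) : measurable_mx A -> measurable_fun D (fun z => \det (A z)).
Proof.
move=> mA; apply: measurable_sum => s; apply: measurable_funM => //.
by apply: measurable_prod => i; exact: mA.
Qed.

Lemma measurable_adj n (A : Z -> 'M[R]_n) : measurable_mx A -> measurable_mx (fun z => \adj (A z)).
Proof.
move=> mA i j; under eq_fun do rewrite mxE /cofactor.
apply: measurable_funM => //; apply: measurable_det => a b.
by under eq_fun do rewrite !mxE; exact: mA.
Qed.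

Lemma measurable_mulmx m n p (A : Z -> 'M[R]_(m, n)) (B : Z -> 'M[R]_(n, p)) :
  measurable_mx A -> measurable_mx B -> measurable_mx (fun z => A z *m B z).
Proof.
move=> mA mB i j; under eq_fun do rewrite mxE; apply: measurable_sum => k.
by apply: measurable_funM; [exact: mA|exact: mB].
Qed.

Lemma measurable_mx_cst m n (A : 'M[R]_(m, n)) : measurable_mx (fun=> A).
Proof. by move=> i j; exact: measurable_cst. Qed.

Lemma measurable_mxtrace n (A : Z -> 'M[R]_n) : measurable_mx A -> measurable_fun D (fun z => \tr (A z)).
Proof. by move=> mA; apply: measurable_sum => i; exact: mA. Qed.

Lemma measurable_mxZ m n (c : Z -> R) (A : Z -> 'M[R]_(m, n)) : measurable_fun D c -> measurable_mx A ->
  measurable_mx (fun z => c z *: A z).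
Proof. by move=> mc mA i j; under eq_fun do rewrite mxE; exact: measurable_funM. Qed.

Lemma measurable_shift n (A : Z -> 'M[R]_n) : measurable_mx A -> measurable_mx (fun z => 1%:M + A z *+ 2).
Proof.
by move=> mA i j; under eq_fun do rewrite !mxE; apply: measurable_funD => //; apply: measurable_funD.
Qed.

End MeasurableMatrices.

Section DetBound.
Variables (R : realType) (d : nat).
Implicit Types (S T X : sym R d) (l : 'cV[R]_d).

Lemma bform_shrinks_le ls T x : possemidef T -> bform (shrinks ls T) x x <= bform T x x.
Proof.
move=> Tp; elim: ls => [//|l ls]; apply: le_trans; rewrite -[shrinks (l :: ls) T]/(shrink l (shrinks ls T)).
set T' := shrinks ls T.
have T'p : possemidef T' by exact: shrinks_ge0.
rewrite /shrink symmxB symmxZ bformD bformN bformZ gerBl mulr_ge0 //.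
  by rewrite divr_ge0 // addr_ge0 // mulr_ge0 //; exact: T'p.
exact: rank1_ge0.
Qed.

Lemma shrinks_det_le ls T : possemidef T ->
  shrinks_det ls T <= expR (2 * \sum_(l <- ls) bform T l l).
Proof.
move=> Tp; elim: ls => [|l ls IH] /=; first by rewrite big_nil mulr0 expR0.
rewrite big_cons [X in expR X]mulrDr [X in expR X]addrC expRD ler_pM //.
- by rewrite (le_trans ler01) // shrinks_det_ge1.
- by rewrite addr_ge0 // mulr_ge0 //; exact: shrinks_ge0.
- by apply: le_trans (expR_ge1Dx _); rewrite lerD2l ler_wpM2l // bform_shrinks_le.
Qed.

(** Each factor 1 + 2 x of the determinant is at most exp(2 x), and shrinking only decreases x. *)
Lemma scale_det_le S T : possemidef S -> possemidef T ->
  scale_det S T <= expR (2 * \tr ((T : 'M[R]_d) *m S)).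
Proof.
move=> /psd_sum_rank1[ls ->] Tp; rewrite /scale_det symmx_sum.
have [_ ->] := shrinks_eq ls Tp; rewrite mulmx_sumr raddf_sum /=.
under eq_bigr do rewrite mxtrace_rank1.
exact: shrinks_det_le.
Qed.

Lemma norm_rank1 l : `|rank1 l| = \tr (rank1 l : 'M[R]_d).
Proof.
have -> : \tr (rank1 l : 'M[R]_d) = \sum_i l i 0 ^+ 2.
  by apply: eq_bigr => i _; rewrite /= mxE big_ord1 mxE expr2.
rewrite sym_normE /frob (_ : \sum_i _ = (\sum_i l i 0 ^+ 2) ^+ 2); last first.
  rewrite [RHS]expr2 big_distrl; apply: eq_bigr => i _ /=; rewrite big_distrr /=.
  by apply: eq_bigr => j _; rewrite !mxE big_ord1 mxE exprMn.
rewrite sqrtr_sqr ger0_norm //; apply: sumr_ge0 => i _; exact: sqr_ge0.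
Qed.

Lemma norm_le_mxtrace X : possemidef X -> `|X| <= \tr (X : 'M[R]_d).
Proof.
move=> /psd_sum_rank1[ls ->]; rewrite symmx_sum raddf_sum /=.
by rewrite (le_trans (ler_norm_sum _ _ _)) // ler_sum // => l _; rewrite norm_rank1.
Qed.

End DetBound.

(** * The transition laws as functions of time and starting point *)

Section TimeLevels.
Variables (R : realType) (d : nat) (alpha : R) (Sigma : sym R d).
Variables (K : R -> sym R d -> probability (symB R d) R).
Hypothesis alpha0 : 0 < alpha.
Hypothesis hS : posdef Sigma.
Hypothesis hK : wishart_transition alpha Sigma K.
Implicit Types (T U W X Y : sym R d) (g : symB R d -> R) (t : R).
Local Notation pd := (@posdef R d : set (symB R d)).
Local Notation beta := (- (alpha / 2)).
Local Notation half := (`]0%R, +oo[%classic : set (measurableTypeR R)).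

Definition scale t : sym R d := (1 - expR (- 2 * t)) *: Sigma.

Lemma scaleE t : symmx (scale t) = Sigma_ Sigma t. Proof. by []. Qed.

Lemma posdef_scale t : 0 < t -> posdef (scale t).
Proof.
move=> t0; apply: posdefZ => //; rewrite subr_gt0 -expR0 ltr_expR mulNr oppr_lt0.
by rewrite mulr_gt0.
Qed.

Let psd_scale t : 0 < t -> possemidef (scale t).
Proof. by move=> t0; exact/posdefW/posdef_scale. Qed.

Lemma transition_posdef t W : 0 < t -> posdef W -> K t W pd = 1%E.
Proof. by move=> t0 Wp; have [_ /(_ _ t0)[]] := hK Wp. Qed.

Lemma transition_laplace t W T : 0 < t -> posdef W -> possemidef T ->
  \int[K t W]_(X in pd) lexp T X =
  expR (- (expR (- 2 * t) * \tr (sharp T (scale t) *m W))) * scale_det (scale t) T `^ beta.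
Proof.
move=> t0 Wp Tp; have [_ /(_ _ t0)[_ /(_ _ Tp)]] := hK Wp.
rewrite -scaleE (laplace_exponent Tp (psd_scale t0) _ _ (posdef_scale t0)).
by [].
Qed.

Definition lev t k W g := level (scale t) (K t) k W g.

Lemma bpl_lev t k W : 0 < t -> posdef W -> bpl 1 (lev t k W).
Proof. move=> t0; by apply: bpl_level => ? ?; exact: transition_posdef. Qed.

Lemma lev_lexp t k W T : 0 < t -> posdef W -> possemidef T -> lev t k W (lexp T) =
  expR (- (expR (- 2 * t) * \tr (sharp T (scale t) *m W))) *
  (scale_det (scale t) T `^ beta * scale_det (scale t) T ^- k).
Proof.
move=> t0 Wp Tp; apply: level_lexp => //; first exact: posdef_scale.
  by move=> ? ?; exact: transition_posdef.
by move=> ? ? ? ?; exact: transition_laplace.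
Qed.

Lemma lev_lip t k W : 0 < t -> posdef W -> exists2 c : R, 0 < c & forall W' g (C : R), posdef W' -> bmf g ->
  (forall Y, posdef Y -> `|g Y| <= C) ->
  `|lev t k.+1 W' g - lev t k.+1 W g| <=
     2 * (#|{: 'I_d * 'I_d * bool}|%:R * (C * Num.sqrt (expR (expR (- 2 * t) * (c * `|W' - W|)) - 1))).
Proof.
move=> t0 Wp.
have [c c0 h] := level_lip (posdef_scale t0) (expR_gt0 _) (fun W Wp => transition_posdef t0 Wp)
  (fun W T Wp Tp => transition_laplace t0 Wp Tp) k W.
by exists c => // W' g C W'p; exact: h.
Qed.

Lemma measurable_lev k W g : posdef W -> bmf g -> measurable_fun half (fun t => lev t k W g).
Proof.
move=> Wp bg.
apply: (@bpl_measurable R d _ (measurableTypeR R) half (fun t g => lev t k W g)) bg => //.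
  by move=> t /= t0; exists 1; apply: bpl_lev => //; move: t0; rewrite in_itv /= andbT.
move=> T Tp.
have me : measurable_fun half (fun t : measurableTypeR R => expR (- 2 * t)).
  by apply: measurableT_comp => //; exact: measurable_funM.
have msc : measurable_mx half (fun t => (T : 'M[R]_d) *m scale t).
  apply: measurable_mulmx; first exact: measurable_mx_cst.
  by apply: measurable_mxZ; [exact: measurable_funB|exact: measurable_mx_cst].
have mD : measurable_fun half (fun t => scale_det (scale t) T).
  by apply: measurable_det; exact: measurable_shift.
have mDi : measurable_fun half (fun t => scale_det (scale t) T `^ (- 1)).
  exact: (measurableT_comp (@measurable_powR R (- 1)) mD).
(* T# is written as adjugate over determinant, so that its measurability in t reduces to polynomials
   in the entries and a power of the determinant. *)
apply: (@eq_measurable_fun _ _ (measurableTypeR R) _ half (fun t =>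
   expR (- (expR (- 2 * t) * (scale_det (scale t) T `^ (- 1) * \tr (\adj (1%:M + ((T : 'M[R]_d) *m scale t) *+ 2) *m T *m W)))) *
  (scale_det (scale t) T `^ beta * (scale_det (scale t) T `^ (- 1)) ^+ k))).
  move=> t; rewrite inE /= in_itv /= andbT => t0; rewrite lev_lexp //.
  have D0 := scale_det_gt0 (posdef_scale t0) Tp.
  rewrite powR_inv1 ?(ltW D0) // exprVn; congr (expR (- (_ * _)) * _).
  rewrite /sharp /invmx unitmx_shift //; last exact: psd_scale.
  by rewrite -!scalemxAl mxtraceZ.
have mtr : measurable_fun half (fun t => \tr (\adj (1%:M + ((T : 'M[R]_d) *m scale t) *+ 2) *m T *m W)).
  apply: measurable_mxtrace; apply: measurable_mulmx; last exact: measurable_mx_cst.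
  apply: measurable_mulmx; last exact: measurable_mx_cst.
  by apply: measurable_adj; exact: measurable_shift.
apply: measurable_funM.
  apply: measurableT_comp => //; apply: measurableT_comp => //.
  by apply: measurable_funM => //; exact: measurable_funM.
apply: measurable_funM; first exact: (measurableT_comp (@measurable_powR R beta) mD).
exact: measurable_funX.
Qed.

Lemma is_derive_eps f W U (l : R) :
  (forall eps : R, 0 < eps -> exists2 dl : R, 0 < dl &
    forall s : R, `|s| < dl -> `|f (W + s *: U) - f W - s * l| <= eps * `|s|) ->
  is_derive W U (f : sym R d -> R) l.
Proof.
move=> H; suff c : (fun r : R => r^-1 *: ((f \o shift W) (r *: U) - f W) : R^o) @ 0^' --> (l : R^o).
  by apply: DeriveDef; [apply/cvg_ex; exists l|rewrite /derive; apply: (@cvg_lim R^o)].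
apply/(@cvgrPdist_le _ R^o) => eps eps0; have [dl dl0 dlH] := H _ eps0.
rewrite near_withinE; apply/nbhs_ballP; exists dl => //= s; rewrite /ball /= sub0r normrN => sdl s0.
have ns : 0 < `|s| by rewrite normr_gt0.
rewrite distrC -(ler_pM2r ns) -normrM.
apply: le_trans (dlH s sdl); rewrite le_eqVlt; apply/orP; left; apply/eqP; congr `|_|.
by rewrite /= [s *: U + W]addrC mulrBl mulrAC [l * s]mulrC mulVf // mul1r.
Qed.

Lemma diffop1 (h : sym R d -> R) W : diffop (1 : symbol R d) h W = h W.
Proof.
rewrite /diffop msupp1 big_seq1 mcoeff1 eqxx mul1r.
rewrite (_ : mono_seq _ = [::]) //; apply/size0nil.
by rewrite size_mono_seq mdeg0.
Qed.

Variables (n : nat) (h : sym R d -> R).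
Hypothesis hh : Cb n h.

Lemma diffopD P Q W : posdef W -> (msize P <= n.+1)%N -> (msize Q <= n.+1)%N ->
  diffop (P + Q : symbol R d) h W = diffop P h W + diffop Q h W.
Proof.
move=> Wp sP sQ; rewrite !(diffopE _ (leqnn n) hh) //; last first.
  by rewrite (leq_trans (mmeasureD_le _ _ _)) // geq_max sP sQ.
by rewrite -big_split; apply: eq_bigr => k _; rewrite mcoeffD /= !mulrDl.
Qed.

Lemma msize_CM (c : R) (P : symbol R d) m : (msize P <= m)%N -> (msize (mpolyC _ c * P) <= m)%N.
Proof. by rewrite mul_mpolyC => /(leq_trans (mmeasureZ_le _ _ _)). Qed.

Lemma diffopZ (c : R) P W : posdef W -> (msize P <= n.+1)%N ->
  diffop (mpolyC _ c * P : symbol R d) h W = c * diffop P h W.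
Proof.
move=> Wp sP; rewrite !(diffopE _ (leqnn n) hh) //; last exact: msize_CM.
by rewrite mulr_sumr; apply: eq_bigr => k _; rewrite mcoeffCM -!mulrA.
Qed.

Lemma tame_diffop_bound m P : (m <= n)%N -> tame m P ->
  exists2 C : R, 0 <= C & forall t W, 0 < t -> posdef W -> `|diffop (P t : symbol R d) h W| <= C.
Proof.
move=> mn /(tame_weak mn)[sP _ bP]; have [C hC] := choice bP.
have sk (k : bmultinom #|{: 'I_d * 'I_d}| n.+1) : (size (@mono_seq d k) <= n)%N.
  by rewrite size_mono_seq -ltnS; exact: bmdeg.
have bd (k : bmultinom #|{: 'I_d * 'I_d}| n.+1) : exists c : R, forall W, posdef W -> `|pderivs (mono_seq k) h W| <= c.
  by have [_ [c]] := Cb_bmf hh (sk k); exists c.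
have [C' hC'] := choice bd.
exists (\sum_(k : bmultinom #|{: 'I_d * 'I_d}| n.+1) C k * `|nablas_coef R (mono_seq k)| * C' k).
  apply: sumr_ge0 => k _; rewrite !mulr_ge0 // ?(le_trans _ (hC k 1 ltr01)) //.
  by rewrite (le_trans _ (hC' k _ (@posdef1 R d))).
move=> t W t0 Wp; rewrite (diffopE (sP t) (leqnn n) hh Wp) (le_trans (ler_norm_sum _ _ _)) // ler_sum // => k _.
by rewrite !normrM ler_pM ?mulr_ge0 ?hC' // ler_pM ?hC.
Qed.

Lemma measurable_lev_tame m k P W : (m <= n)%N -> tame m P -> posdef W ->
  measurable_fun half (fun t => lev t k W (diffop (P t : symbol R d) h)).
Proof.
move=> mn /(tame_weak mn)[sP mP _] Wp.
have sk (j : bmultinom #|{: 'I_d * 'I_d}| n.+1) : (size (@mono_seq d j) <= n)%N.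
  by rewrite size_mono_seq -ltnS; exact: bmdeg.
apply: (@eq_measurable_fun _ _ (measurableTypeR R) _ half (fun t => \sum_(k' : bmultinom #|{: 'I_d * 'I_d}| n.+1)
    mcoeff k' (P t) * nablas_coef R (mono_seq k') * lev t k W (pderivs (mono_seq k') h))).
  move=> t; rewrite inE /= in_itv /= andbT => t0.
  rewrite -(bpl_sum (index_enum _) (fun k : bmultinom _ n.+1 => mcoeff k (P t) * nablas_coef R (mono_seq k))
    (bpl_lev k t0 Wp) (fun k => Cb_bmf hh (sk k))).
  apply: (bpl_ext (bpl_lev k t0 Wp)) => X Xp.
  by rewrite (diffopE (sP t) (leqnn n) hh Xp).
apply: measurable_sum => k'; apply: measurable_funM.
  by apply: measurable_funM => //; apply: (measurable_funS measurableT) => //; exact: mP.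
exact: (measurable_lev k Wp (Cb_bmf hh (sk k'))).
Qed.

Lemma lev_diffop t k P Q W U (s : R) : 0 < t ->
  (msize P <= n.+1)%N -> (msize (Q * P : symbol R d) <= n.+1)%N -> directional (scale t) U Q ->
  posdef W -> 0 < s -> posdef (W + s *: U) ->
  lev t k (W + s *: U) (diffop P h) - lev t k W (diffop P h) =
  expR (- 2 * t) * \int[lebesgue_measure]_(r in `[0, s]) lev t k.+1 (W + r *: U) (diffop (Q * P) h).
Proof.
move=> t0 sP sQP QU Wp s0 Wsp.
exact: (level_diffop (posdef_scale t0) (expR_gt0 _) (fun W Wp => transition_posdef t0 Wp)
  (fun W T Wp Tp => transition_laplace t0 Wp Tp) k hh sP sQP QU Wp s0 Wsp).
Qed.

(** Comparison of the integrand with a constant v serves twice: v = 0 gives the Lipschitz bound, and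
    v the value at W gives the directional derivative. *)
Lemma lev_increment t k P Q W U (s v eta : R) : 0 < t ->
  (msize P <= n.+1)%N -> (msize (Q * P : symbol R d) <= n.+1)%N -> directional (scale t) U Q ->
  posdef W -> posdef (W + s *: U) ->
  (forall r, `|r| <= `|s| -> posdef (W + r *: U) -> `|lev t k.+1 (W + r *: U) (diffop (Q * P) h) - v| <= eta) ->
  `|lev t k (W + s *: U) (diffop P h) - lev t k W (diffop P h) - s * (expR (- 2 * t) * v)| <=
    expR (- 2 * t) * eta * `|s|.
Proof.
move=> t0 sP sQP QU.
have pos s' W' : 0 < s' -> posdef W' -> posdef (W' + s' *: U) ->
  (forall r, 0 <= r <= s' -> posdef (W' + r *: U) -> `|lev t k.+1 (W' + r *: U) (diffop (Q * P) h) - v| <= eta) ->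
  `|lev t k (W' + s' *: U) (diffop P h) - lev t k W' (diffop P h) - s' * (expR (- 2 * t) * v)| <=
    expR (- 2 * t) * eta * s'.
  move=> s0 Wp Wsp H; have Wr := posdef_line Wp Wsp.
  rewrite (lev_diffop k t0 sP sQP QU Wp s0 Wsp) mulrCA -mulrBr normrM ger0_norm ?expR_ge0 //.
  rewrite -mulrA ler_wpM2l ?expR_ge0 //.
  set psi := fun r => lev t k.+1 (W' + r *: U) (diffop (Q * P) h).
  have mpsi : measurable_fun (`[0, s'] : set (measurableTypeR R)) psi.
    apply: level_measurable => //; first exact: posdef_scale.
    - by move=> ? ?; exact: transition_posdef.
    - by move=> ? ? ? ?; exact: transition_laplace.
    - exact: (bmf_diffop sQP hh).
  have bpsi r : `[0, s']%classic r -> `|psi r - v| <= eta.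
    by move=> rs; apply: H; [by move: rs; rewrite /= in_itv|exact: Wr].
  have -> : \int[lebesgue_measure]_(r in `[0, s']) psi r - s' * v =
      \int[lebesgue_measure]_(r in `[0, s']) (psi r - v).
    rewrite RintegralB //.
    - by rewrite Rintegral_cst // fine_leb_itv // mulrC.
    - apply: (@integrable_bounded _ (measurableTypeR R) _ lebesgue_measure _ _ _ _ (eta + `|v|)) => //.
      + exact: leb_itv_fin.
      + by move=> r rs; rewrite -[psi r](subrK v) (le_trans (ler_normD _ _)) // lerD2r bpsi.
    - apply: (@integrable_bounded _ (measurableTypeR R) _ lebesgue_measure _ _ _ _ `|v|) => //.
      exact: leb_itv_fin.
  rewrite -[X in _ * X](fine_leb_itv s0).
  apply: (@ler_norm_Rintegral _ (measurableTypeR R)) => //; first exact: leb_itv_fin.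
  exact: measurable_funB.
move=> Wp Wsp H; have [s0|s0|s0] := ltrgt0P s.
- apply: pos => // r /andP[r0 rs]; apply: H.
  by rewrite !ger0_norm // ltW.
(* The integral identity is available for positive steps; a negative one is run from the other end
   of the segment. *)
- have E : W = (W + s *: U) + (- s) *: U by rewrite scaleNr addrK.
  have := pos (- s) (W + s *: U); rewrite -E oppr_gt0 => /(_ s0 Wsp Wp) {}pos.
  rewrite distrC (_ : _ - _ = lev t k W (diffop P h) -
    lev t k (W + s *: U) (diffop P h) - - s * (expR (- 2 * t) * v)); last by ring.
  apply: pos => r /andP[r0 rs]; rewrite -addrA -scalerDl => Wrp; apply: H => //.
  by rewrite (ltr0_norm s0) ler_norml; lra.
- by rewrite s0 scale0r addr0 subrr mul0r subrr normr0 mulr0.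
Qed.

Lemma lev_bound t k W g (C : R) : 0 < t -> posdef W -> bmf g -> (forall Y, posdef Y -> `|g Y| <= C) ->
  `|lev t k W g| <= C.
Proof. by move=> t0 Wp bg gC; rewrite -[C]mul1r; exact: (bpl_bound (bpl_lev k t0 Wp)). Qed.

Lemma posdef_ball W : posdef W -> exists2 dl : R, 0 < dl & forall Y, `|Y - W| < dl -> posdef Y.
Proof.
move=> /near_posdef/nbhs_ballP[dl /= dl0 h1]; exists dl => // Y YW.
by apply: h1; rewrite -ball_normE /= distrC.
Qed.

Lemma lev_continuous t k g W (eps : R) : 0 < t -> posdef W -> bmf g -> 0 < eps ->
  exists2 dl : R, 0 < dl & forall Y, `|Y - W| < dl -> posdef Y /\ `|lev t k.+1 Y g - lev t k.+1 W g| <= eps.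
Proof.
move=> t0 Wp bg eps0; have [_ [C gC]] := bg; have [c c0 lip] := lev_lip k t0 Wp.
have C0 : 0 <= C by rewrite (le_trans _ (gC _ Wp)).
have [dl dl0 h1] := posdef_ball Wp.
pose N : R := #|{: 'I_d * 'I_d * bool}|%:R; pose M := 2 * (N * C) + 1.
have M0 : 0 < M by rewrite ltr_wpDl // !mulr_ge0.
pose eta := eps / M; have eta0 : 0 < eta by rewrite divr_gt0.
pose ec := expR (- 2 * t) * c; have ec0 : 0 < ec by rewrite mulr_gt0 ?expR_gt0.
(* The radius at which sqrt(exp(ec |Y - W|) - 1) reaches eta. *)
exists (Num.min dl (ln (1 + eta ^+ 2) / ec)).
  by rewrite lt_min dl0 divr_gt0 // ln_gt0 // ltrDl exprn_gt0.
move=> Y; rewrite lt_min => /andP[/h1 Yp]; rewrite ltr_pdivlMr // mulrC => YW; split => //.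
apply: le_trans (lip Y g C Yp bg gC) _; rewrite -/N (mulrA _ c) -/ec.
have sq : Num.sqrt (expR (ec * `|Y - W|) - 1) <= eta.
  rewrite -(ger0_norm (ltW eta0)) -sqrtr_sqr ler_wsqrtr // lerBlDl.
  rewrite -[leRHS]lnK ?posrE ?ltr_wpDr ?sqr_ge0 // ler_expR ltW //.
have -> : eps = M * eta by rewrite /eta mulrCA divff ?mulr1 // gt_eqF.
rewrite (mulrA N) mulrA; apply: ler_pM => //; rewrite ?mulr_ge0 //.
by rewrite /M lerDl.
Qed.

Lemma lev_is_derive t k P Q W U : 0 < t ->
  (msize P <= n.+1)%N -> (msize (Q * P : symbol R d) <= n.+1)%N -> directional (scale t) U Q ->
  posdef W ->
  is_derive W U (fun W : sym R d => lev t k W (diffop P h))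
    (expR (- 2 * t) * lev t k.+1 W (diffop (Q * P) h)).
Proof.
move=> t0 sP sQP QU Wp; apply: is_derive_eps => eps eps0.
have [dl dl0 H] := lev_continuous k t0 Wp (bmf_diffop sQP hh) (divr_gt0 eps0 (expR_gt0 (- 2 * t))).
exists (dl / (`|U| + 1)); first by rewrite divr_gt0 // ltr_wpDl.
move=> s sdl; have small r : `|r| <= `|s| -> `|W + r *: U - W| < dl.
  move=> rs; rewrite [W + _]addrC addrK normrZ.
  have U1 : 0 < `|U| + 1 by rewrite ltr_wpDl.
  rewrite ltr_pdivlMr // in sdl; apply: le_lt_trans sdl.
  by rewrite ler_pM // lerDl.
have Wsp : posdef (W + s *: U) by have [] := H _ (small s (lexx _)).
have := lev_increment t0 sP sQP QU Wp Wsp (v := lev t k.+1 W (diffop (Q * P) h)) (eta := eps / expR (- 2 * t)) (k := k).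
rewrite [expR _ * (eps / _)]mulrC divfK ?gt_eqF ?expR_gt0 //; apply=> r rs _.
by have [] := H _ (small r rs).
Qed.

Lemma diffop_lin (I : Type) (s : seq I) (c : I -> R) (P : I -> symbol R d) W : posdef W ->
  (forall i, (msize (P i) <= n.+1)%N) ->
  (msize (\sum_(i <- s) mpolyC _ (c i) * P i) <= n.+1)%N /\
  diffop (\sum_(i <- s) mpolyC _ (c i) * P i) h W = \sum_(i <- s) c i * diffop (P i) h W.
Proof.
move=> Wp sP; elim: s => [|i s [s1 IH]].
  by rewrite !big_nil mmeasure0 /diffop msupp0 big_nil.
have s2 := msize_CM (c i) (sP i).
rewrite !big_cons; split; first by rewrite (leq_trans (mmeasureD_le _ _ _)) // geq_max s2 s1.
by rewrite diffopD // diffopZ // IH.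
Qed.

Lemma D_frobE t U : D_frob Sigma t U =
  \sum_(p : 'I_d * 'I_d) mpolyC _ (U p.1 p.2) * D_symb Sigma t p.1 p.2.
Proof.
rewrite -(pair_bigA _ (fun i j => mpolyC _ (U i j) * D_symb Sigma t i j)) /=.
by apply: eq_bigr => i _; apply: eq_bigr => j _; rewrite mul_mpolyC.
Qed.

Hypotheses (d0 : (0 < d)%N) (dn : (d <= n)%N).

(** One step s = 1 in the direction X - W. The symbols of D have coefficients bounded in t, so only
    the factor e^{-2t} depends on time: this is the source of the exponential ergodicity. *)
Lemma lev0_lipschitz : exists2 L : R, 0 <= L & forall t W X, 0 < t -> posdef W -> posdef X ->
  `|lev t 0 X h - lev t 0 W h| <= expR (- 2 * t) * L * `|X - W|.
Proof.
have bd (p : 'I_d * 'I_d) : exists C : R, 0 <= C /\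
    forall t W, 0 < t -> posdef W -> `|diffop (D_symb Sigma t p.1 p.2) h W| <= C.
  have [C C0 hC] := tame_diffop_bound dn (tame_D_symb Sigma p.1 p.2 d0); by exists C.
have [L hL] := choice bd.
exists (\sum_p L p); first by apply: sumr_ge0 => p _; have [] := hL p.
move=> t W X t0 Wp Xp; pose U := X - W.
have XE : X = W + 1 *: U by rewrite scale1r addrC subrK.
have s1 p : (msize (D_symb Sigma t p.1 p.2) <= n.+1)%N.
  by have [/(_ t)] := tame_weak dn (tame_D_symb Sigma p.1 p.2 d0).
have bQ Y : posdef Y -> `|diffop (D_frob Sigma t U) h Y| <= (\sum_p L p) * `|U|.
  move=> Yp; rewrite D_frobE; have [_ ->] := diffop_lin (index_enum _) (fun p => U p.1 p.2) Yp s1.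
  rewrite (le_trans (ler_norm_sum _ _ _)) // mulr_suml ler_sum // => p _.
  rewrite normrM mulrC; apply: ler_pM => //; last exact: ler_norm_entry.
  by have [_ hp] := hL p; exact: hp.
have sQ : (msize (D_frob Sigma t U) <= n.+1)%N.
  by have [/(_ t)] := tame_weak dn (tame_frob Sigma U d0).
have := @lev_increment t 0 1 (D_frob Sigma t U) W U 1 0 ((\sum_p L p) * `|U|) t0.
rewrite mulr1 mmeasure1 !mulr0 subr0 normr1 mulr1 -XE mulrA.
have h1 : diffop (1 : symbol R d) h = h by apply/funext => Y; exact: diffop1.
rewrite h1; apply=> //.
- exact: (directional_frob U (psd_scale t0) (scaleE t)).
- move=> r _ Wrp; rewrite subr0; apply: lev_bound => //.
  exact: (bmf_diffop sQ hh).
Qed.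

(** * The stationary law and convergence to it *)

Variable Winfty : probability (symB R d) R.
Hypothesis hWinfty : is_wishart alpha Sigma 0 Winfty.

Definition mean_infty g : R := \int[Winfty]_(X in pd) g X.

Lemma bpl_mean_infty : bpl 1 mean_infty.
Proof. exact: (@bpl_K R d (fun=> Winfty) (fun _ _ => hWinfty.1) Sigma hS). Qed.

Lemma mean_infty_lexp T : possemidef T -> mean_infty (lexp T) = scale_det Sigma T `^ beta.
Proof.
move=> Tp; rewrite /mean_infty (hWinfty.2 T Tp).
by rewrite mulmx0 mxtrace0 oppr0 expR0 mul1r.
Qed.

Lemma mean_infty_cst (c : R) : mean_infty (fun=> c) = c.
Proof.
rewrite /mean_infty Rintegral_cst; last exact: measurable_posdef.
by rewrite (congr1 fine hWinfty.1 : _ = 1) mulr1.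
Qed.

Lemma mean_infty_le f g : bmf f -> bmf g -> (forall X, posdef X -> `|f X| <= g X) ->
  `|mean_infty f| <= mean_infty g.
Proof.
move=> bf bg fg; have mpd := @measurable_posdef R d.
have fin : (Winfty pd < +oo)%E by have [-> _] := hWinfty; exact: ltry.
have i u : bmf u -> Winfty.-integrable pd (EFin \o u).
  by move=> [mu [C uC]]; exact: (integrable_bounded mpd fin mu uC).
apply: le_trans (le_normr_Rintegral mpd (i _ bf)) _.
apply: le_Rintegral => //; [|exact: i].
by apply: (i (fun X => `|f X|)); have [mf [C fC]] := bf; split; [exact: measurableT_comp|exists C => X Xp; rewrite normr_id fC].
Qed.

Lemma bpop_lev t k : 0 < t -> bpop 1 (fun g X => lev t k X g).
Proof.
move=> t0; split=> [X Xp|g bg]; first exact: bpl_lev.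
apply: (@bpl_measurable R d _ (symB R d) pd (fun X g => lev t k X g)) bg => //.
  by move=> X Xp; exists 1; exact: bpl_lev.
move=> T Tp; have [T' T'p ET'] := sharp_psd Tp (psd_scale t0).
apply: (@eq_measurable_fun _ _ (symB R d) _ pd (fun X => lexp (expR (- 2 * t) *: T') X *
  (scale_det (scale t) T `^ beta * scale_det (scale t) T ^- k))).
  move=> X /set_mem Xp; rewrite lev_lexp // /lexp symmxZ ET' -scalemxAl mxtraceZ.
  by [].
apply: measurable_funM => //.
by have [] := bmf_lexp (possemidefZ (expR_ge0 (- 2 * t)) T'p).
Qed.

(** On exponentials this is [det_mul_sharp] for the splitting of Sigma into S_t and e^{-2t}
    Sigma. *)
Lemma mean_infty_invariant t g : 0 < t -> bmf g -> mean_infty (fun X => lev t 0 X g) = mean_infty g.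
Proof.
move=> t0; apply: bpl_unique (bpl_comp bpl_mean_infty (bpop_lev 0 t0)) bpl_mean_infty _ _ => T Tp.
have [T' T'p ET'] := sharp_psd Tp (psd_scale t0).
have eT'p : possemidef (expR (- 2 * t) *: T') by exact: possemidefZ (expR_ge0 _) T'p.
rewrite (bpl_ext bpl_mean_infty (g := fun X => scale_det (scale t) T `^ beta * lexp (expR (- 2 * t) *: T') X)); last first.
  move=> X Xp; rewrite lev_lexp // expr0 invr1 mulr1 mulrC; congr (_ * expR (- _)).
  by rewrite [symmx (_ *: T')]symmxZ -scalemxAl mxtraceZ ET'.
rewrite (bplZ _ bpl_mean_infty); last exact: bmf_lexp.
rewrite !mean_infty_lexp // -powRM; last 2 first.
- by rewrite ltW // scale_det_gt0 //; exact: posdef_scale.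
- by rewrite ltW // scale_det_gt0.
congr (_ `^ _); have := det_mul_sharp (expR (- 2 * t) *: Sigma) Tp (psd_scale t0).
rewrite -/(scale_det _ _) -ET' -scalemxAr scalemxAl -/(scale_det Sigma (expR (- 2 * t) *: T')) => <-.
have -> : symmx (scale t) + expR (- 2 * t) *: symmx Sigma = Sigma.
  by rewrite [symmx (scale t)]symmxZ -scalerDl subrK scale1r.
by [].
Qed.

Lemma half_le_1subexp (x : R) : 0 <= x <= 1 -> x <= 2 * (1 - expR (- x)).
Proof.
move=> /andP[x0 x1]; rewrite expRN.
have ex := expR_ge1Dx x; have x10 : 0 < 1 + x by rewrite ltr_wpDr.
have : (expR x)^-1 <= (1 + x)^-1 by rewrite lef_pV2 ?posrE ?expR_gt0.
have : (1 + x)^-1 <= 1 - x / 2.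
  by rewrite -[leLHS]mul1r ler_pdivrMr //; nra.
lra.
Qed.

(** From ln det(1 + 2 s Sigma) <= 2 s tr Sigma and 1 - exp(-x) <= x. The bound is uniform in s, so
    the truncation in [mixing] can be removed. *)
Lemma mean_infty_trace (s : R) : 0 < s ->
  2 * s^-1 * (1 - mean_infty (lexp (s *: sym1 R d))) <= 2 * alpha * \tr (Sigma : 'M[R]_d).
Proof.
move=> s0; have Tp : possemidef (s *: sym1 R d) by apply: possemidefZ; [exact: ltW|exact/posdefW/posdef1].
rewrite mean_infty_lexp // -!mulrA ler_pM2l // ler_pdivrMl //.
have D0 := scale_det_gt0 hS Tp.
rewrite /powR gt_eqF //.
have lnD : ln (scale_det Sigma (s *: sym1 R d)) <= 2 * (s * \tr (Sigma : 'M[R]_d)).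
  rewrite -ler_expR lnK //; apply: le_trans (scale_det_le (posdefW hS) Tp) _.
  by rewrite symmxZ /= -scalemxAl mul1mx mxtraceZ.
have := expR_ge1Dx (beta * ln (scale_det Sigma (s *: sym1 R d))).
have := ler_wpM2l (ltW alpha0) lnD; lra.
Qed.

(* The first moment of the invariant law is bounded through its Laplace transform: the Lipschitz bound
   is integrated over [\tr X <= k], where x <= 2 (1 - exp(- x)) applies to x = \tr X / k. *)
Lemma mixing : exists2 L : R, 0 <= L & forall t W, 0 < t -> posdef W ->
  `|lev t 0 W h - mean_infty h| <= expR (- 2 * t) * L * (2 * alpha * \tr (Sigma : 'M[R]_d) + `|W|).
Proof.
have [L L0 lip] := lev0_lipschitz; exists L => // t W t0 Wp.
have bh : bmf h by exact: (Cb_bmf (s := [::]) hh).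
pose G X := lev t 0 X h + (- lev t 0 W h).
have bl : bmf (fun X => lev t 0 X h) by exact: bpop_bmf (bpop_lev 0 t0) bh.
have bG : bmf G by apply: bmfD => //; exact: bmf_cst.
(* By invariance the stationary mean of h is that of X |-> [lev t 0 X h], so the distance to
   equilibrium averages differences of starting points. *)
have -> : lev t 0 W h - mean_infty h = - mean_infty G.
  rewrite /G (bplD bpl_mean_infty bl (bmf_cst _ _)) mean_infty_invariant //.
  by rewrite mean_infty_cst; ring.
rewrite normrN.
pose A k : set (symB R d) := [set X | \tr (symmx X) <= k.+1%:R].
have mA k : measurable (A k).
  have mt : measurable_fun setT (fun X : symB R d => \tr (symmx X)).
    have := @measurable_mxtraceM R d (sym1 R d) setT.
    by under eq_fun do rewrite mul1mx.
  rewrite (_ : A k = setT `&` (fun X : symB R d => \tr (symmx X)) @^-1` `]-oo, k.+1%:R]%classic).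
    exact: mt.
  by rewrite setTI; apply/seteqP; split => X /=; rewrite in_itv.
pose G_ k X := G X * (X \in A k)%:R.
have bG_ k : bmf (G_ k) by apply: bmfM => //; exact: bmf_indic.
set M := expR _ * L * _.
have GM k : `|mean_infty (G_ k)| <= M.
  pose s : R := k.+1%:R^-1; have s0 : 0 < s by rewrite invr_gt0.
  pose c := expR (- 2 * t) * L; have c0 : 0 <= c by rewrite mulr_ge0 ?expR_ge0.
  have Tp : possemidef (s *: sym1 R d) by apply: possemidefZ; [exact: ltW|exact/posdefW/posdef1].
  (* The majorant c (2/s (1 - exp(-s tr X)) + |W|) as an affine function of one exponential, whose
     stationary mean is explicit. *)
  pose u := - (c * (2 * s^-1)); pose v := c * (2 * s^-1 + `|W|).
  have := @mean_infty_le (G_ k) (fun X => u * lexp (s *: sym1 R d) X + v) (bG_ k).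
  have bl' := bmf_lexp Tp; rewrite (bpl_lin bpl_mean_infty _ bl' (bmf_cst _ _)) mean_infty_cst => H.
  apply: le_trans (H _ _) _; first by apply: bmfD; [exact: bmfZ|exact: bmf_cst].
    move=> X Xp; rewrite /G_ normrM.
    have rhs0 : 0 <= u * lexp (s *: sym1 R d) X + v.
      rewrite (_ : _ + v = c * (2 * s^-1 * (1 - lexp (s *: sym1 R d) X) + `|W|)); last by rewrite /u /v; ring.
      rewrite mulr_ge0 // addr_ge0 // mulr_ge0 ?subr_ge0 ?lexp_le1 // mulr_ge0 // invr_ge0 ltW //.
    case: (boolP (X \in A k)) => [|_]; last by rewrite normr0 mulr0.
    rewrite inE /A /= normr1 mulr1 => trX; apply: le_trans (lip t W X t0 Wp Xp) _.
    rewrite (_ : u * _ + v = c * (2 * s^-1 * (1 - lexp (s *: sym1 R d) X) + `|W|)); last by rewrite /u /v; ring.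
    rewrite -/c ler_wpM2l //; apply: le_trans (ler_normB _ _) _; rewrite lerD2r.
    apply: le_trans (norm_le_mxtrace (posdefW Xp)) _.
    have x01 : 0 <= s * \tr (symmx X) <= 1.
      rewrite mulr_ge0 ?(ltW s0) ?(le_trans _ (norm_le_mxtrace (posdefW Xp))) //=.
      by rewrite mulrC ler_pdivrMr // mul1r.
    have := half_le_1subexp x01.
    rewrite /lexp symmxZ -scalemxAl mxtraceZ mul1mx [2 * s^-1]mulrC -mulrA.
    by rewrite -(ler_pdivlMl _ _ s0) //.
  have := mean_infty_trace s0 => tr.
  rewrite /M -/c (_ : u * _ + v = c * (2 * s^-1 * (1 - mean_infty (lexp (s *: sym1 R d))) + `|W|)); last by rewrite /u /v; ring.
  by rewrite ler_wpM2l // lerD2r.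
have [_ [C GC]] := bG.
have cv : mean_infty (G_ k) @[k --> \oo] --> mean_infty G.
  apply: (@bpl_cvg _ _ _ _ bpl_mean_infty _ _ C) => // [k X Xp|X Xp].
    rewrite /G_ normrM -[C]mulr1 ler_pM ?GC //.
    by case: (X \in A k); rewrite ?normr1 ?normr0.
  apply: cvg_near_cst; have := nbhs_infty_ger (\tr (symmx X)); apply: filterS => k Xk.
  rewrite /G_ (_ : X \in A k) ?mulr1 // inE /A /= (le_trans Xk) // ler_nat.
  exact: leqnSn.
have /cvg_norm cn := cv; rewrite -(cvg_lim _ cn) //; apply: limr_le; first by apply/cvg_ex; eexists; exact: cn.
by apply: nearW => k; exact: GM.
Qed.

(** * Integration over time *)

Lemma integrable_expR_half (c : R) : 0 < c ->
  lebesgue_measure.-integrable half (EFin \o (fun t : R => expR (- c * t))) /\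
  \int[lebesgue_measure]_(t in half) expR (- c * t) = c^-1.
Proof.
move=> c0; have mh : measurable half by [].
have E t : half t -> expR (- c * t) = c^-1 * exponential_pdf c t.
  move=> /= ; rewrite in_itv /= andbT => t0.
  by rewrite exponential_pdfE ?(ltW t0) // mulrA mulVf ?mul1r // gt_eqF.
have ip : lebesgue_measure.-integrable half (EFin \o exponential_pdf c).
  exact: (integrableS measurableT mh (@subsetT _ _) (integrable_exponential_pdf c0)).
split.
  apply: (eq_integrable mh (fun t => (c^-1)%:E * (exponential_pdf c t)%:E)%E).
    by move=> t /set_mem ht; rewrite /= E // EFinM.
  exact: (integrableZl mh c^-1 ip).
transitivity (\int[lebesgue_measure]_(t in half) (c^-1 * exponential_pdf c t)).
  by apply: eq_Rintegral => t /set_mem ht; exact: E.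
rewrite RintegralZl // -[RHS]mulr1; congr (_ * _).
rewrite Rintegral_itv_obnd_cbnd // Rintegral_mkcond.
rewrite (_ : exponential_pdf c \_ _ = exponential_pdf c); last first.
  apply/funext => t; rewrite patchE; case: ifPn => //; rewrite notin_setE /= in_itv /= andbT.
  by move=> /negP; rewrite -ltNge => /lt0_exponential_pdf ->.
by rewrite /Rintegral (integral_exponential_pdf c0).
Qed.

(** The stationary mean does not depend on W, so it is subtracted at order 0 only; higher orders
    decay through the power of e^{-2t} alone. *)
Definition Phi k (P : R -> symbol R d) W t : R :=
  expR (- 2 * t) ^+ k * lev t k W (diffop (P t) h) - (k == 0)%:R * mean_infty h.

(* Up to sign, the derivative of order [k] of the Stein solution is [stein_int k P] for suitable products [P]. *)
Definition stein_int k (P : R -> symbol R d) W : R := - \int[lebesgue_measure]_(t in half) Phi k P W t.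

(** At order 0 the subtracted mean is that of h itself, so the symbol has to be 1 for the integrand
    to decay. *)
Definition admissible k (P : R -> symbol R d) := tame (k * d) P /\ (k = 0 -> forall t, P t = 1).

Lemma measurable_Phi k P W : (k * d <= n)%N -> admissible k P -> posdef W -> measurable_fun half (Phi k P W).
Proof.
move=> kn [tP _] Wp; apply: measurable_funB; last exact: measurable_cst.
apply: measurable_funM; last exact: (measurable_lev_tame k kn tP Wp).
by apply: measurable_funX; apply: measurableT_comp => //; exact: measurable_funM.
Qed.

(** At order 0 the decay is [mixing], whose constant grows linearly in the norm of W; at order k >=
    1 one factor e^{-2t} is enough. One bound of the same shape serves both cases. *)
Lemma Phi_bound k P : (k * d <= n)%N -> admissible k P -> exists2 C : R, 0 <= C &
  forall t W, 0 < t -> posdef W -> `|Phi k P W t| <= expR (- 2 * t) * (C * (1 + `|W|)).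
Proof.
move=> kn [tP P1]; case: k kn tP P1 => [|k] kn tP P1.
  have [L L0 H] := mixing; pose c := 2 * alpha * \tr (Sigma : 'M[R]_d).
  have c0 : 0 <= c.
    rewrite mulr_ge0 ?mulr_ge0 ?(ltW alpha0) //.
    by apply: le_trans (norm_le_mxtrace (posdefW hS)).
  exists (L * (c + 1)); first by rewrite mulr_ge0 // addr_ge0.
  move=> t W t0 Wp; rewrite /Phi expr0 !mul1r P1 //.
  have -> : diffop (1 : symbol R d) h = h by apply/funext => Y; exact: diffop1.
  apply: le_trans (H _ _ t0 Wp) _; rewrite -/c -!mulrA ler_wpM2l ?expR_ge0 // ler_wpM2l //.
  by have := normr_ge0 W; nra.
have [C C0 H] := tame_diffop_bound kn tP.
exists C => // t W t0 Wp; rewrite /Phi mul0r subr0 exprS -mulrA 2!normrM.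
rewrite (ger0_norm (expR_ge0 _)) ler_wpM2l ?expR_ge0 //.
have sP := tame_weak kn tP.
have lC : `|lev t k.+1 W (diffop (P t) h)| <= C.
  by apply: lev_bound => //; [case: sP => sP _ _; exact: (bmf_diffop (sP t) hh)|move=> Y Yp; exact: H].
apply: (@le_trans _ _ (1 * C)).
  apply: ler_pM => //; rewrite normrX ger0_norm ?expR_ge0 // exprn_ile1 ?expR_ge0 //.
  by rewrite -expR0 ler_expR mulNr oppr_le0 mulr_ge0 // ltW.
by rewrite mul1r mulrDr mulr1 lerDl mulr_ge0.
Qed.

Lemma integrable_Phi k P W : (k * d <= n)%N -> admissible k P -> posdef W ->
  lebesgue_measure.-integrable half (EFin \o Phi k P W).
Proof.
move=> kn aP Wp; have [C C0 H] := Phi_bound kn aP.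
have [i _] := integrable_expR_half (ltr0n R 2 : 0 < 2).
apply: (le_integrable _ _ _ (integrableZr _ (C * (1 + `|W|)) i)) => //.
- by apply/measurable_EFinP; exact: measurable_Phi.
- move=> t /=; rewrite in_itv /= andbT => t0.
  rewrite -[leRHS]/((`|expR (- 2 * t) * (C * (1 + `|W|))|)%:E) lee_fin.
  by apply: le_trans (H _ _ t0 Wp) _; exact: ler_norm.
Qed.

Lemma Phi_derive k P Q W U t : (k.+1 * d <= n)%N -> tame (k * d) P -> tame d Q ->
  (forall t, 0 < t -> directional (scale t) U (Q t)) -> 0 < t -> posdef W ->
  is_derive W U (fun W : sym R d => Phi k P W t) (Phi k.+1 (fun t => Q t * P t) W t).
Proof.
move=> kn tP tQ QU t0 Wp.
have kn' : (k * d <= n)%N by rewrite (leq_trans _ kn) // leq_mul2r leqnSn orbT.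
have tQP : tame (k.+1 * d) (fun t => Q t * P t) by rewrite mulSn; exact: tameM.
have [sP _ _] := tame_weak kn' tP; have [sQP _ _] := tame_weak kn tQP.
have [lder lval] := lev_is_derive k t0 (sP t) (sQP t) (QU t t0) Wp.
have -> : Phi k.+1 (fun t => Q t * P t) W t = expR (- 2 * t) ^+ k *
    (expR (- 2 * t) * lev t k.+1 W (diffop (Q t * P t) h)).
  by rewrite /Phi mul0r subr0 exprSr mulrA.
set c := expR (- 2 * t) ^+ k; pose b := (k == 0)%:R * mean_infty h.
have E : (fun W : sym R d => Phi k P W t) = (c \*: (fun W : sym R d => lev t k W (diffop (P t) h) : R^o)) \- cst b.
  by apply/funext.
rewrite E -lval -[X in is_derive _ _ _ X]subr0; apply: is_deriveB.
  exact: is_deriveZ.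
Qed.

Lemma stein_int_derive k P Q W U : (k.+1 * d <= n)%N -> admissible k P -> tame d Q ->
  (forall t, 0 < t -> directional (scale t) U (Q t)) -> posdef W ->
  is_derive W U (stein_int k P) (stein_int k.+1 (fun t => Q t * P t) W).
Proof.
move=> kn aP tQ QU Wp; have [tP P1] := aP.
have kn' : (k * d <= n)%N by rewrite (leq_trans _ kn) // leq_mul2r leqnSn orbT.
have tQP : tame (k.+1 * d) (fun t => Q t * P t) by rewrite mulSn; exact: tameM.
have aQP : admissible k.+1 (fun t => Q t * P t) by split.
have [C C0 HC] := Phi_bound kn aQP.
have [dl dl0 Wdl] := posdef_ball Wp.
(* The segment stays in the cone, and by the 1 the norm stays below |W| + |U|, which makes the
   dominating function independent of the point. *)
pose r := Num.min 1 (dl / (`|U| + 1)).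
have U1 : 0 < `|U| + 1 by rewrite ltr_wpDl.
have r0 : 0 < r by rewrite lt_min ltr01 divr_gt0.
have Ip x : `]-r, r[%classic x -> posdef (W + x *: U) /\ `|W + x *: U| <= `|W| + `|U|.
  rewrite /= in_itv /= -ltr_norml lt_min => /andP[x1]; rewrite ltr_pdivlMr // => xdl; split.
    apply: Wdl; rewrite addrC addKr normrZ; apply: le_lt_trans xdl.
    by rewrite ler_wpM2l // lerDl.
  rewrite (le_trans (ler_normD _ _)) // lerD2l normrZ -[leRHS]mul1r ler_wpM2r //.
  exact: ltW.
have D x t : `]-r, r[%classic x -> half t ->
    is_derive (x : R^o) (1 : R^o) (fun s : R^o => Phi k P (W + s *: U) t : R^o)
      (Phi k.+1 (fun t => Q t * P t) (W + x *: U) t).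
  move=> xr /=; rewrite in_itv /= andbT => t0.
  exact: (@is_derive_line R d (fun W => Phi k P W t) W U x _ (Phi_derive kn tP tQ QU t0 (Ip x xr).1)).
have d1E x t : `]-r, r[%classic x -> half t ->
    partial1of2 (fun s t => Phi k P (W + s *: U) t) x t = Phi k.+1 (fun t => Q t * P t) (W + x *: U) t.
  by move=> xr t0; rewrite partial1of2E; have [_ ->] := D x t xr t0.
pose G (t : R) := expR (- 2 * t) * (C * (1 + (`|W| + `|U|))).
have iG : lebesgue_measure.-integrable half (EFin \o G).
  have [i _] := integrable_expR_half (ltr0n R 2 : 0 < 2).
  by apply: (integrableZr _ (C * (1 + (`|W| + `|U|))) i).
have G0 t : 0 <= G t by rewrite /G mulr_ge0 ?expR_ge0 // mulr_ge0 // !addr_ge0.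
have mh : measurable half by [].
have I0 : `]-r, r[%classic (0 : R) by rewrite /= in_itv /= oppr_lt0 r0.
have iPhi x : `]-r, r[%classic x -> lebesgue_measure.-integrable half (EFin \o Phi k P (W + x *: U)).
  by move=> xr; apply: integrable_Phi => //; have [] := Ip x xr.
have dPhi x t : `]-r, r[%classic x -> half t ->
    derivable ((fun s t => Phi k P (W + s *: U) t)^~ t : R^o -> R^o) x 1.
  by move=> xr t0; have [] := D x t xr t0.
have bPhi x t : `]-r, r[%classic x -> half t ->
    `|partial1of2 (fun s t => Phi k P (W + s *: U) t) x t| <= G t.
  move=> xr t0; rewrite d1E //; have [xp xn] := Ip x xr.
  apply: le_trans (HC _ _ _ xp) _; first by move: t0; rewrite /= in_itv /= andbT.
  by rewrite /G ler_wpM2l ?expR_ge0 // ler_wpM2l // lerD2l.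
have der := derivable_under_integral mh I0 iPhi dPhi G0 iG bPhi.
have val := differentiation_under_integral mh I0 iPhi dPhi G0 iG bPhi.
apply: is_derive_line_inv.
rewrite /stein_int -[X in - X](_ : \int[lebesgue_measure]_(t in half) partial1of2 (fun s t => Phi k P (W + s *: U) t) 0 t = _); last first.
  by apply: eq_Rintegral => t /set_mem t0; rewrite d1E // scale0r addr0.
apply: is_deriveN; apply: DeriveDef; first exact: der.
by rewrite -derive1E.
Qed.

(** Dominated convergence along sequences: failure would give points tending to W with a gap. At
    fixed t the integrand converges by [lev_continuous], for which the order is at least 1 so that a
    Gaussian square is present. *)
Lemma stein_int_continuous k P W (eps : R) : (k.+1 * d <= n)%N -> tame (k.+1 * d) P -> posdef W -> 0 < eps ->
  exists2 dl : R, 0 < dl & forall Y, `|Y - W| < dl ->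
    posdef Y /\ `|stein_int k.+1 P Y - stein_int k.+1 P W| <= eps.
Proof.
move=> kn tP Wp eps0; have aP : admissible k.+1 P by split.
have [C C0 HC] := Phi_bound kn aP; have [dl dl0 Wdl] := posdef_ball Wp.
apply: contrapT => H.
have bad (j : nat) : exists Y, [/\ `|Y - W| < Num.min (Num.min 1 dl) j.+1%:R^-1 & eps < `|stein_int k.+1 P Y - stein_int k.+1 P W|].
  apply: contrapT => H'; apply: H; exists (Num.min (Num.min 1 dl) j.+1%:R^-1).
    by rewrite !lt_min ltr01 dl0 invr_gt0 ltr0n.
  move=> Y YW; split; first by apply: Wdl; move: YW; rewrite !lt_min => /andP[/andP[]].
  by rewrite leNgt; apply/negP => e; apply: H'; exists Y.
have [Y HY] := choice bad.
have Yp j : posdef (Y j) by have [h1 _] := HY j; apply: Wdl; move: h1; rewrite !lt_min => /andP[/andP[]].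
have Yn j : `|Y j| <= `|W| + 1.
  have [h1 _] := HY j; rewrite -[Y j](subrK W) addrC (le_trans (ler_normD _ _)) // lerD2l.
  by move: h1; rewrite !lt_min => /andP[/andP[/ltW]].
have [i _] := integrable_expR_half (ltr0n R 2 : 0 < 2).
have mh : measurable half by [].
have iG := integrableZr mh (C * (1 + (`|W| + 1))) i.
have cv := @Rintegral_cvg _ _ _ lebesgue_measure half mh
  (fun t => expR (- 2 * t) * (C * (1 + (`|W| + 1)))) (fun j => Phi k.+1 P (Y j)) (Phi k.+1 P W) iG.
have {}cv : \int[lebesgue_measure]_(t in half) Phi k.+1 P (Y j) t @[j --> \oo] -->
    \int[lebesgue_measure]_(t in half) Phi k.+1 P W t.
  apply: cv => [j|j t|t].
  - exact: measurable_Phi.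
  - rewrite /= in_itv /= andbT => t0; apply: le_trans (HC _ _ t0 (Yp j)) _.
    by rewrite ler_wpM2l ?expR_ge0 // ler_wpM2l // lerD2l.
  - rewrite /= in_itv /= andbT => t0; apply/(@cvgrPdist_le _ R^o) => e e0.
    have [sP _ _] := tame_weak kn tP.
    have [dt dt0 Hdt] := lev_continuous k t0 Wp (bmf_diffop (sP t) hh) e0.
    have := near_infty_natSinv_lt (PosNum dt0); apply: filterS => j /= jdt.
    have [YW _] := HY j; have Ydt : `|Y j - W| < dt.
      by apply: lt_trans jdt; move: YW; rewrite !lt_min => /andP[].
    have [_ b] := Hdt (Y j) Ydt.
    rewrite /Phi !mul0r !subr0 -mulrBr normrM distrC.
    apply: le_trans b; rewrite ler_piMl // normrX ger0_norm ?expR_ge0 // exprn_ile1 ?expR_ge0 //.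
    by rewrite -expR0 ler_expR mulNr oppr_le0 mulr_ge0 // ltW.
move/(@cvgrPdist_lt _ R^o)/(_ _ eps0): cv => [j _ /(_ j (leqnn j)) /=].
have [_] := HY j; rewrite /stein_int opprK addrC => /lt_trans h1 /h1.
by rewrite ltxx.
Qed.

Lemma stein_int_lin (I : Type) (s : seq I) k (c : I -> R) (P : I -> R -> symbol R d) W :
  (k.+1 * d <= n)%N -> (forall i, tame (k.+1 * d) (P i)) -> posdef W ->
  stein_int k.+1 (fun t => \sum_(i <- s) mpolyC _ (c i) * P i t) W = \sum_(i <- s) c i * stein_int k.+1 (P i) W.
Proof.
move=> kn tP Wp; have mh : measurable half by [].
have tS r : tame (k.+1 * d) (fun t => \sum_(i <- r) mpolyC _ (c i) * P i t).
  by apply: tame_sum => i; exact: tame_scaled.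
have E r t : 0 < t -> Phi k.+1 (fun t => \sum_(i <- r) mpolyC _ (c i) * P i t) W t =
    \sum_(i <- r) c i * Phi k.+1 (P i) W t.
  move=> t0; rewrite /Phi mul0r subr0.
  under [RHS]eq_bigr do rewrite subr0 mulrCA.
  rewrite -mulr_sumr; congr (_ * _).
  have sP i : (msize (P i t) <= n.+1)%N by have [/(_ t)] := tame_weak kn (tP i).
  rewrite -(bpl_sum r c (bpl_lev k.+1 t0 Wp) (fun i => bmf_diffop (sP i) hh)).
  apply: (bpl_ext (bpl_lev k.+1 t0 Wp)) => X Xp.
  by have [_ ->] := diffop_lin r c Xp sP.
have ip i : lebesgue_measure.-integrable half (EFin \o Phi k.+1 (P i) W) by apply: integrable_Phi.
rewrite /stein_int; elim: s => [|i s IH].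
  rewrite big_nil; apply/eqP; rewrite oppr_eq0; apply/eqP.
  transitivity (\int[lebesgue_measure]_(t in half) ((0 : R) : R)).
    by apply: eq_Rintegral => t /set_mem /=; rewrite in_itv /= andbT => t0; rewrite E // big_nil.
  by rewrite Rintegral_cst // mul0r.
rewrite big_cons -IH mulrN -opprD; congr (- _).
rewrite -RintegralZl // -RintegralD //; last 2 first.
- exact: (integrableZl mh (c i) (ip i)).
- by apply: integrable_Phi.
apply: eq_Rintegral => t /set_mem /=; rewrite in_itv /= andbT => t0.
by rewrite !E // big_cons.
Qed.

Lemma stein_int_bound k P (B : R) W : (0 < k)%N -> (k * d <= n)%N -> tame (k * d) P ->
  (forall t Y, 0 < t -> posdef Y -> `|diffop (P t) h Y| <= B) -> posdef W ->
  `|stein_int k P W| <= (2 * k%:R)^-1 * B.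
Proof.
case: k => // k _ kn tP PB Wp; have mh : measurable half by [].
have c0 : (0 : R) < 2 * k.+1%:R by rewrite mulr_gt0.
have [i E] := integrable_expR_half c0.
have ip : lebesgue_measure.-integrable half (EFin \o Phi k.+1 P W) by apply: integrable_Phi.
rewrite /stein_int normrN (le_trans (le_normr_Rintegral mh ip)) //.
rewrite -E -RintegralZr //; apply: le_Rintegral => //.
- exact: integrable_norm ip.
- exact: (integrableZr mh B i).
move=> t /=; rewrite in_itv /= andbT => t0; rewrite /Phi mul0r subr0 normrM.
have [sP _ _] := tame_weak kn tP.
rewrite normrX ger0_norm ?expR_ge0 // -expRM_natl.
rewrite (_ : k.+1%:R * (-2 * t) = - (2 * k.+1%:R) * t); last by ring.
rewrite ler_wpM2l ?expR_ge0 //; apply: lev_bound => // [|Y Yp]; first exact: (bmf_diffop (sP t) hh).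
exact: PB.
Qed.

Lemma stein_solE W : posdef W -> stein_sol K Winfty h W = stein_int 0 (fun=> 1) W.
Proof.
move=> Wp; have mh : measurable half by [].
have a1 : admissible 0 (fun=> 1 : symbol R d) by split => //; exact: tame1.
have ip : lebesgue_measure.-integrable half (EFin \o Phi 0 (fun=> 1) W) by apply: integrable_Phi.
have E t : half t -> Phi 0 (fun=> 1) W t = semigroup K t h W - mean_infty h.
  move=> _; rewrite /Phi expr0 !mul1r; congr (_ - _).
  by rewrite (_ : diffop 1 h = h) //; apply/funext => Y; exact: diffop1.
(* The point t = 0, where the law is a Dirac mass, is negligible; all level estimates live on t >
   0. *)
rewrite /stein_sol /stein_int -Rintegral_itv_obnd_cbnd.
  by congr (- _); apply: eq_Rintegral => t /set_mem ht; rewrite E.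
by apply: (eq_integrable mh (EFin \o Phi 0 (fun=> 1) W)) ip => t /set_mem ht; rewrite /= E.
Qed.

Lemma differentiable_coef (f : sym R d -> R) W (a : 'I_d * 'I_d -> R) :
  (forall eps : R, 0 < eps -> exists2 dl : R, 0 < dl & forall H : sym R d, `|H| < dl ->
     `|f (W + H) - f W - \sum_p H p.1 p.2 * a p| <= eps * `|H|) ->
  differentiable (f : sym R d -> R^o) W /\
  forall H, 'd (f : sym R d -> R^o) W H = \sum_p H p.1 p.2 * a p.
Proof.
move=> est; pose L (H : sym R d) : R^o := \sum_p H p.1 p.2 * a p.
have Llin : linear L.
  move=> c U V; rewrite /L scaler_sumr -big_split; apply: eq_bigr => p _.
  by rewrite symmxD symmxZ !mxE mulrDl /= /GRing.scale /= mulrA.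
pose LL : {linear sym R d -> R^o} := HB.pack L (GRing.isLinear.Build _ _ _ _ L Llin).
have Lc : continuous LL.
  apply: bounded_linear_continuous; apply/linear_boundedP; exists (\sum_p `|a p|); split; first exact: num_real.
  move=> r ar V; apply: le_trans (ler_norm_sum _ _ _) _.
  apply: (@le_trans _ _ ((\sum_p `|a p|) * `|V|)); last by rewrite ler_wpM2r // ltW.
  rewrite mulr_suml; apply: ler_sum => p _; rewrite normrM mulrC ler_pM //.
  exact: ler_norm_entry.
have E : f \o shift W = cst (f W) + LL +o_ (0 : sym R d) id.
  apply/eqaddoP => eps eps0; have [dl dl0 H] := est _ eps0.
  apply/nbhs_ballP; exists dl => //= V; rewrite -ball_normE /= sub0r normrN => Vdl.
  have := H V Vdl; congr (`|_| <= _).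
  by rewrite -[RHS]/(f (V + W) - (f W + L V)) [V + W]addrC opprD addrA.
have dE := diff_unique Lc E.
split; last by move=> H; rewrite dE.
by apply/diff_locallyP; rewrite dE.
Qed.

(** * Derivatives of the Stein solution *)

Local Notation f0 := (stein_sol K Winfty h).

Lemma near_stein_sol k (P : R -> symbol R d) (g : sym R d -> R) W : posdef W ->
  (forall Y, posdef Y -> g Y = stein_int k P Y) -> \near W, stein_int k P W = g W.
Proof. by move=> Wp E; have := near_posdef Wp; apply: filterS => Y Yp; rewrite E. Qed.

(** Normalized for plain partial derivatives along [coord_dir]; [nablas_coef_symb] restores the
    entries of D that belong to the symmetric gradient. *)
Definition coord_symb t (s : seq ('I_d * 'I_d)) : symbol R d :=
  \prod_(p <- s) (mpolyC _ (nabla_coef R p)^-1 * D_symb Sigma t p.1 p.2).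

Lemma tame_coord_symb s : tame (size s * d) (coord_symb^~ s).
Proof. by apply: tame_prod => p; apply: tame_scaled; exact: tame_D_symb. Qed.

Lemma pderivs_stein_sol s : (size s * d <= n)%N -> pderivs_exist s f0 /\
  forall W, posdef W -> pderivs s f0 W = stein_int (size s) (coord_symb^~ s) W.
Proof.
elim: s => [|p s IH] sn.
  split => // W Wp; rewrite -[LHS]/(f0 W) (stein_solE Wp).
  rewrite (_ : coord_symb^~ [::] = fun=> 1) //.
  by apply/funext => t; rewrite /coord_symb big_nil.
have sn' : (size s * d <= n)%N by rewrite (leq_trans _ sn) // leq_mul2r leqnSn orbT.
have [ex E] := IH sn'.
have D W : posdef W -> is_derive W (coord_dir R p) (pderivs s f0)
    (stein_int (size s).+1 (coord_symb^~ (p :: s)) W).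
  move=> Wp; apply: (near_eq_is_derive (near_stein_sol Wp E)).
  have -> : coord_symb^~ (p :: s) =
      fun t => mpolyC _ (nabla_coef R p)^-1 * D_symb Sigma t p.1 p.2 * coord_symb t s.
    by apply/funext => t; rewrite /coord_symb big_cons.
  apply: stein_int_derive => //.
  - split; first exact: tame_coord_symb.
    by move=> s0 t; rewrite /coord_symb (size0nil s0) big_nil.
  - by apply: tame_scaled; exact: tame_D_symb.
  - by move=> t t0; exact: (directional_coord p (psd_scale t0) (scaleE t)).
split; first by split => // W /D[].
by move=> W /D[].
Qed.

Lemma nablas_coef_symb t s : mpolyC _ (nablas_coef R s) * coord_symb t s =
  \prod_(p <- s) D_symb Sigma t p.1 p.2.
Proof.
elim: s => [|p s IH]; first by rewrite /nablas_coef /coord_symb !big_nil mulr1.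
rewrite big_cons -IH /nablas_coef /coord_symb !big_cons mpolyCM.
rewrite -/(coord_symb t s) -/(nablas_coef R s).
rewrite [LHS](_ : _ = (mpolyC _ (nabla_coef R p) * mpolyC _ (nabla_coef R p)^-1) *
  (D_symb Sigma t p.1 p.2 * (mpolyC _ (nablas_coef R s) * coord_symb t s))); last by ring.
by rewrite -mpolyCM divff ?nabla_coef_neq0 // mul1r.
Qed.

Lemma nablas_stein_sol_bound s (B : R) W : (0 < size s)%N -> (size s * d <= n)%N ->
  (forall t Y, 0 < t -> posdef Y -> `|diffop (\prod_(p <- s) D_symb Sigma t p.1 p.2) h Y| <= B) ->
  posdef W -> `|nablas s f0 W| <= (2 * (size s)%:R)^-1 * B.
Proof.
move=> s0 sn HB Wp; have [ex E] := pderivs_stein_sol sn.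
rewrite (nablas_pderivs ex Wp) E //.
have sn' : ((size s).-1.+1 * d <= n)%N by rewrite prednK.
have := @stein_int_lin unit [:: tt] (size s).-1 (fun=> nablas_coef R s) (fun _ => coord_symb^~ s) W sn'.
rewrite prednK // !big_seq1 => <- //; last by move=> _; exact: tame_coord_symb.
apply: stein_int_bound => //.
  under eq_fun do rewrite big_seq1.
  by apply: tame_scaled; exact: tame_coord_symb.
by move=> t Y t0 Yp; rewrite big_seq1 nablas_coef_symb; exact: HB.
Qed.

Definition frob_symb t (us : seq (sym R d)) : symbol R d := \prod_(U <- us) D_frob Sigma t U.

Lemma tame_frob_symb us : tame (size us * d) (frob_symb^~ us).
Proof. by apply: tame_prod => U; exact: tame_frob. Qed.

Lemma frob_symb_expand k (us : k.-tuple (sym R d)) t : frob_symb t us =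
  \sum_(g : {ffun 'I_k -> 'I_d * 'I_d}) mpolyC _ (\prod_l tnth us l (g l).1 (g l).2) *
    \prod_l D_symb Sigma t (g l).1 (g l).2.
Proof.
rewrite /frob_symb big_tuple; under eq_bigr do rewrite D_frobE.
rewrite bigA_distr_bigA; apply: eq_bigr => g _.
by rewrite big_split /= rmorph_prod.
Qed.

(** Uniformity over directions comes from multilinearity: in coordinates there are finitely many
    continuous functions, with coefficients of size at most M^(k+1). *)
Lemma stein_int_equicontinuous k W (M eps : R) : (k.+1 * d <= n)%N -> posdef W -> 0 <= M -> 0 < eps ->
  exists2 dl : R, 0 < dl & forall Y, `|Y - W| < dl -> posdef Y /\
    forall us : k.+1.-tuple (sym R d), (forall l, `|tnth us l| <= M) ->
    `|stein_int k.+1 (frob_symb^~ us) Y - stein_int k.+1 (frob_symb^~ us) W| <= eps.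
Proof.
move=> kn Wp M0 eps0; pose I := {ffun 'I_k.+1 -> 'I_d * 'I_d}.
pose E (g : I) t : symbol R d := \prod_l D_symb Sigma t (g l).1 (g l).2.
have tE (g : I) : tame (k.+1 * d) (E g).
  have := @tame_prod R d d 'I_k.+1 (index_enum 'I_k.+1) (fun l t => D_symb Sigma t (g l).1 (g l).2).
  have -> : size (index_enum 'I_k.+1) = k.+1 by rewrite /index_enum -enumT size_enum_ord.
  apply => l; exact: tame_D_symb.
pose B : R := #|{: I}|%:R * M ^+ k.+1 + 1.
have B0 : 0 < B by rewrite ltr_wpDl // mulr_ge0 // exprn_ge0.
have eB : 0 < eps / B by rewrite divr_gt0.
have near_g (g : I) : \forall Y \near nbhs W, `|stein_int k.+1 (E g) Y - stein_int k.+1 (E g) W| <= eps / B.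
  have [dl dl0 H] := stein_int_continuous kn (tE g) Wp eB.
  apply/nbhs_ballP; exists dl => //= Y; rewrite -ball_normE /= distrC => YW.
  by have [] := H Y YW.
have /nbhs_ballP[dl1 /= dl10 H1] := filter_forall (nbhs_filter W) near_g.
have [dl2 dl20 H2] := posdef_ball Wp.
exists (Num.min dl1 dl2); first by rewrite lt_min dl10.
move=> Y; rewrite lt_min => /andP[YW1 /H2 Yp]; split => // us usM.
have {}H1 (g : I) : `|stein_int k.+1 (E g) Y - stein_int k.+1 (E g) W| <= eps / B.
  by apply: H1; rewrite -ball_normE /= distrC.
have ex : frob_symb^~ us = fun t => \sum_(g <- index_enum I)
    mpolyC _ (\prod_l tnth us l (g l).1 (g l).2) * E g t.
  by apply/funext => t; rewrite frob_symb_expand.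
rewrite ex !stein_int_lin // -sumrB.
apply: le_trans (ler_norm_sum _ _ _) _.
have c0 (g : I) : `|\prod_l tnth us l (g l).1 (g l).2| <= M ^+ k.+1.
  rewrite normr_prod -[k.+1 in leRHS]card_ord -prodr_const; apply: ler_prod => l _.
  by rewrite normr_ge0 /= (le_trans (ler_norm_entry _ _ _)).
apply: (@le_trans _ _ (\sum_(g : I) M ^+ k.+1 * (eps / B))).
  by apply: ler_sum => g _; rewrite -mulrBr normrM ler_pM.
rewrite sumr_const -mulr_natl mulrA -[leRHS](divfK (lt0r_neq0 B0)) [leRHS]mulrC.
by rewrite ler_wpM2r ?(ltW eB) // /B lerDl.
Qed.

Lemma stein_int_frob_cons us U W : (size (U :: us) * d <= n)%N -> posdef W ->
  stein_int (size us).+1 (frob_symb^~ (U :: us)) W =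
  \sum_p U p.1 p.2 * stein_int (size us).+1 (fun t => D_symb Sigma t p.1 p.2 * frob_symb t us) W.
Proof.
move=> kn Wp; have tp (p : 'I_d * 'I_d) : tame ((size us).+1 * d) (fun t => D_symb Sigma t p.1 p.2 * frob_symb t us).
  by rewrite mulSn; apply: tameM; [exact: tame_D_symb|exact: tame_frob_symb].
rewrite -(stein_int_lin (index_enum _) (fun p => U p.1 p.2) kn tp Wp).
suff -> : frob_symb^~ (U :: us) = fun t => \sum_(p : 'I_d * 'I_d) mpolyC _ (U p.1 p.2) *
    (D_symb Sigma t p.1 p.2 * frob_symb t us) by [].
apply/funext => t; rewrite /frob_symb big_cons D_frobE mulr_suml.
by apply: eq_bigr => p _; rewrite mulrA.
Qed.

(** The mean value theorem along the segment together with equicontinuity one order higher.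
    Uniformity in [us] is what the operator norm clause of [frechet_differentiable] demands. *)
Lemma stein_int_taylor k W (M eps : R) : (k.+1 * d <= n)%N -> posdef W -> 1 <= M -> 0 < eps ->
  exists2 dl : R, 0 < dl & forall H, `|H| < dl -> posdef (W + H) /\
    forall us : k.-tuple (sym R d), (forall l, `|tnth us l| <= M) ->
    `|stein_int k (frob_symb^~ us) (W + H) - stein_int k (frob_symb^~ us) W -
      stein_int k.+1 (frob_symb^~ (H :: us)) W| <= eps * `|H|.
Proof.
move=> kn Wp M1 eps0; have [dl dl0 eq] := stein_int_equicontinuous kn Wp (le_trans ler01 M1) eps0.
exists dl => // H Hdl.
have Ydl Y : `|Y| <= `|H| -> `|W + Y - W| < dl.
  by move=> YH; rewrite addrC addKr; apply: le_lt_trans Hdl.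
have [WHp _] := eq _ (Ydl H (lexx _)); split => // us usM.
have sus : size us = k by rewrite size_tuple.
have kn' U : (size (U :: us) * d <= n)%N by rewrite /= sus.
have consE U Y : posdef Y -> stein_int k.+1 (frob_symb^~ (U :: us)) Y =
    \sum_p U p.1 p.2 * stein_int k.+1 (fun t => D_symb Sigma t p.1 p.2 * frob_symb t us) Y.
  by move=> Yp; have := stein_int_frob_cons (kn' U) Yp; rewrite sus.
have [H0|Hn0] := eqVneq H 0.
  rewrite consE // H0 addr0 subrr sub0r normrN big1 ?normr0 ?mulr0 // => p _.
  by rewrite symmx0 mxE mul0r.
have nH : 0 < `|H| by rewrite normr_gt0.
(* The direction is normalized so that it obeys the same bound M >= 1 as [us]; the factor |H| of the
   estimate is then split off by linearity. *)
pose V := `|H|^-1 *: H.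
have HV : H = `|H| *: V by rewrite /V scalerA divff ?scale1r // gt_eqF.
have nV : `|V| = 1 by rewrite normrZ ger0_norm ?invr_ge0 // mulVf // gt_eqF.
have aus : admissible k (frob_symb^~ us).
  split; first by have := tame_frob_symb us; rewrite sus.
  by move=> k0 t; rewrite /frob_symb (_ : tval us = [::]) ?big_nil //; apply: size0nil; rewrite sus.
have seg c : 0 <= c <= `|H| -> `|c *: V| <= `|H|.
  by move=> /andP[c0 cH]; rewrite normrZ nV mulr1 ger0_norm.
have Wc c : 0 <= c <= `|H| -> posdef (W + c *: V).
  by move=> cH; have [] := eq _ (Ydl _ (seg c cH)).
have D c : 0 <= c <= `|H| -> is_derive (c : R^o) (1 : R^o) (fun s : R^o => stein_int k (frob_symb^~ us) (W + s *: V) : R^o)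
    (stein_int k.+1 (frob_symb^~ (V :: us)) (W + c *: V)).
  move=> cH; apply: (@is_derive_line R d (stein_int k (frob_symb^~ us)) W V c).
  have -> : frob_symb^~ (V :: us) = fun t => D_frob Sigma t V * frob_symb t us.
    by apply/funext => t; rewrite /frob_symb big_cons.
  apply: (stein_int_derive kn aus (tame_frob Sigma V d0) _ (Wc c cH)) => t t0.
  exact: (directional_frob V (psd_scale t0) (scaleE t)).
have oc c : c \in `]0, `|H|[ -> 0 <= c <= `|H|.
  by rewrite in_itv /= => /andP[/ltW -> /ltW ->].
have cont : {within `[0, `|H|], continuous (fun s : R => stein_int k (frob_symb^~ us) (W + s *: V))}.
  apply: derivable_within_continuous => c; rewrite in_itv /= => cH.
  by have [] := D c cH.
have [c cI E] := @MVT R (fun s => stein_int k (frob_symb^~ us) (W + s *: V))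
  (fun c => stein_int k.+1 (frob_symb^~ (V :: us)) (W + c *: V)) 0 `|H| nH
  (fun c cI => D c (oc c cI)) cont.
rewrite scale0r addr0 -HV subr0 in E; rewrite E.
have -> : stein_int k.+1 (frob_symb^~ (H :: us)) W = stein_int k.+1 (frob_symb^~ (V :: us)) W * `|H|.
  rewrite !consE // mulr_suml; apply: eq_bigr => p _.
  by rewrite [in LHS]HV symmxZ mxE; ring.
rewrite -mulrBl normrM normr_id ler_wpM2r //.
have [_ /(_ [tuple of V :: us])] := eq _ (Ydl _ (seg c (oc c cI))).
apply=> l; case: (unliftP ord0 l) => [j|] ->; first by rewrite tnthS; exact: usM.
by rewrite tnth0 nV.
Qed.

(** The function g is only assumed to agree with the integral on the cone, since an iterated
    [frechet] is a total function whose values elsewhere are not controlled. *)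
Lemma stein_int_differentiable k (us : k.-tuple (sym R d)) (g : sym R d -> R) W :
  (k.+1 * d <= n)%N -> posdef W ->
  (forall Y, posdef Y -> g Y = stein_int k (frob_symb^~ us) Y) ->
  differentiable g W /\ forall H, 'd g W H = stein_int k.+1 (frob_symb^~ (H :: us)) W.
Proof.
move=> kn Wp gE; have sus : size us = k by rewrite size_tuple.
pose a (p : 'I_d * 'I_d) := stein_int k.+1 (fun t => D_symb Sigma t p.1 p.2 * frob_symb t us) W.
have consE U : stein_int k.+1 (frob_symb^~ (U :: us)) W = \sum_p U p.1 p.2 * a p.
  have := @stein_int_frob_cons us U W; rewrite /= sus; exact.
pose M : R := 1 + \sum_l `|tnth us l|.
have M1 : 1 <= M by rewrite lerDl sumr_ge0.
have usM l : `|tnth us l| <= M.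
  rewrite /M (bigD1 l) //= addrCA lerDl addr_ge0 // sumr_ge0 //.
have [] := @differentiable_coef g W a; last by move=> dg E; split => // H; rewrite E consE.
move=> eps eps0; have [dl dl0 H] := stein_int_taylor kn Wp M1 eps0.
exists dl => // V Vdl; have [WVp /(_ us usM)] := H V Vdl.
by rewrite consE !gE.
Qed.

Lemma frechet_stein_sol us W : (size us * d <= n)%N -> posdef W ->
  frechet f0 us W = stein_int (size us) (frob_symb^~ us) W.
Proof.
elim: us W => [|U us IH] W kn Wp.
  rewrite -[LHS]/(f0 W) (stein_solE Wp).
  suff -> : frob_symb^~ [::] = fun=> 1 by [].
  by apply/funext => t; rewrite /frob_symb big_nil.
have kn' : (size us * d <= n)%N by rewrite (leq_trans _ kn) // leq_mul2r leqnSn orbT.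
have [_ E] := @stein_int_differentiable (size us) (in_tuple us) (frechet f0 us) W kn Wp (fun Y Yp => IH Y kn' Yp).
exact: E.
Qed.

Lemma frechet_differentiable_stein_sol m : (m * d <= n)%N -> frechet_differentiable m f0.
Proof.
move=> mn k km W Wp; have kn : (k.+1 * d <= n)%N by rewrite (leq_trans _ mn) // leq_mul2r km orbT.
have kn' : (k * d <= n)%N by rewrite (leq_trans _ kn) // leq_mul2r leqnSn orbT.
have E (us : k.-tuple (sym R d)) Y : posdef Y -> frechet f0 us Y = stein_int k (frob_symb^~ us) Y.
  by move=> Yp; rewrite frechet_stein_sol ?size_tuple.
have D us := stein_int_differentiable kn Wp (E us).
split=> [us|eps eps0]; first by have [] := D us.
have [dl dl0 H] := stein_int_taylor kn Wp (lexx 1) eps0.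
apply/nbhs_ballP; exists dl => //= V; rewrite -ball_normE /= sub0r normrN => Vdl us usU.
have [WVp /(_ us)] := H V Vdl; have [_ ->] := D us.
by rewrite !E //; apply=> l; rewrite usU.
Qed.

Lemma frechet_stein_sol_bound us (B : R) W : (0 < size us)%N -> (size us * d <= n)%N ->
  (forall t Y, 0 < t -> posdef Y -> `|diffop (frob_symb t us) h Y| <= B) ->
  posdef W -> `|frechet f0 us W| <= (2 * (size us)%:R)^-1 * B.
Proof.
move=> us0 usn HB Wp; rewrite frechet_stein_sol //.
by apply: stein_int_bound => //; exact: tame_frob_symb.
Qed.

End TimeLevels.

Theorem theorem3p6 (R : realType) (d m : nat) (hd : (0 < d)%N) (hm : (0 < m)%N)
    (alpha : R) (halpha : 3 * d%:R - 3 < alpha)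
    (Sigma : sym R d) (hSigma : posdef Sigma)
    (K : R -> sym R d -> probability (symB R d) R)
    (hK : wishart_transition alpha Sigma K)
    (Winfty : probability (symB R d) R)
    (hWinfty : is_wishart alpha Sigma 0 Winfty)
    (h : sym R d -> R) (hh : Cb (m * d) h) :
  (B_class m Sigma h ->
    forall ij : m.-tuple ('I_d * 'I_d),
      pderivs_exist ij (stein_sol K Winfty h) /\
      (supnorm (nablas ij (stein_sol K Winfty h)) <=
        ((2 * m%:R)^-1)%:E * D_supnorm Sigma ij h)%E) /\
  ((MD m Sigma h < +oo)%E ->
    frechet_differentiable m (stein_sol K Winfty h) /\
    (M_ m (stein_sol K Winfty h) <= ((2 * m%:R)^-1)%:E * MD m Sigma h)%E).
Proof.
(* As d >= 1, the bound 3 d - 3 is nonnegative. *)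
have alpha0 : 0 < alpha.
  apply: le_lt_trans halpha; have : (1 : R) <= d%:R by rewrite ler1n.
  lra.
have dn : (d <= m * d)%N by rewrite leq_pmull.
split=> [hB ij|hMD].
  have sij : size ij = m by rewrite size_tuple.
  have sn : (size ij * d <= m * d)%N by rewrite sij.
  split; first by have [] := pderivs_stein_sol alpha0 hSigma hK hh hd dn hWinfty sn.
  have [_ Dfin] := hB ij.
  have le_D t Y : 0 < t -> posdef Y -> (`|diffop (D_prod Sigma t ij) h Y|%:E <= D_supnorm Sigma ij h)%E.
    move=> t0 Yp; apply: (@le_trans _ _ (supnorm (diffop (D_prod Sigma t ij) h))).
      by apply: ereal_sup_ubound; exists Y.
    by apply: ereal_sup_ubound; exists t.
  apply: ge_ereal_sup => _ [W Wp <-].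
  (* A point of the cone rules out a supremum equal to minus infinity; with the upper bound from the
     class, the supremum is a real number. *)
  have Dge0 : (0 <= D_supnorm Sigma ij h)%E.
    by apply: le_trans (le_D 1 W ltr01 Wp); rewrite lee_fin.
  have Df : D_supnorm Sigma ij h \is a fin_num by rewrite ge0_fin_numE.
  rewrite -(fineK Df) -EFinM lee_fin -[X in (2 * X%:R)^-1]sij.
  apply: (nablas_stein_sol_bound alpha0 hSigma hK hh hd dn hWinfty) => //; first by rewrite sij.
  move=> t Y t0 Yp; rewrite -lee_fin fineK // big_tuple; exact: le_D.
split; first exact: (frechet_differentiable_stein_sol alpha0 hSigma hK hh hd dn hWinfty (leqnn _)).
apply: ge_ereal_sup => _ [W Wp <-]; apply: ge_ereal_sup => _ [us usU <-].
have sus : size us = m by rewrite size_tuple.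
have le_D t Y : 0 < t -> posdef Y -> (`|diffop (frob_symb Sigma t us) h Y|%:E <= MD m Sigma h)%E.
  move=> t0 Yp; apply: le_trans (ereal_sup_ubound _); last by exists t.
  apply: le_trans (ereal_sup_ubound _); last by exists Y.
  by apply: ereal_sup_ubound; exists us => //; rewrite /frob_symb big_tuple.
have Dge0 : (0 <= MD m Sigma h)%E.
  by apply: le_trans (le_D 1 W ltr01 Wp); rewrite lee_fin.
have Df : MD m Sigma h \is a fin_num by rewrite ge0_fin_numE.
rewrite -(fineK Df) -EFinM lee_fin -[X in (2 * X%:R)^-1]sus.
apply: (frechet_stein_sol_bound alpha0 hSigma hK hh hd dn hWinfty) => //; rewrite ?sus //.
by move=> t Y t0 Yp; rewrite -lee_fin fineK //; exact: le_D.
Qed.
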